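(* Let $(S_1,\dots,S_N)$ be contracting similarities of $\mathbb{R}^d$ with ratios $r_i\in(0,1)$, let $(p_1,\dots,p_N)$ be a probability vector with all $p_i>0$ ($N\ge 2$), and let $K$ and $\mu$ be the associated self-similar set and self-similar measure. Assume that the Open Set Condition is satisfied. Let $\alpha_{\min}=\min_i \frac{\log p_i}{\log r_i}$ and $\alpha_{\max}=\max_i\frac{\log p_i}{\log r_i}$. (1) If $I\subseteq\mathbb{R}$ is not a closed subinterval of $[\alpha_{\min},\alpha_{\max}]$, then $$\{x\in K: A(D(x))=I\}=\emptyset.$$ (2) If $I\subseteq\mathbb{R}$ is a closed subinterval of $[\alpha_{\min},\alpha_{\max}]$, then $$\dim_P\{x\in K: A(D(x))=I\}=\dim_P\{x\in K: A(D(x))\subseteq I\}=\sup_{\alpha\in I}\beta^*(\alpha).$$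
   Context: $K$ is the unique non-empty compact subset of $\mathbb{R}^d$ with $K=\bigcup_{i=1}^N S_i(K)$, and $\mu$ is the unique Borel probability measure on $\mathbb{R}^d$ with $\mu=\sum_{i=1}^N p_i\,\mu\circ S_i^{-1}$; the support of $\mu$ is $K$. Open Set Condition (OSC): there exists an open, non-empty and bounded set $U\subseteq\mathbb{R}^d$ such that $\bigcup_i S_i(U)\subseteq U$ and $S_i(U)\cap S_j(U)=\emptyset$ for all $i\ne j$. For $x\in K$ and $r>0$ (with $r \neq 1$), $D_r(x)=\frac{\log\mu(B(x,r))}{\log r}$, where $B(x,r)$ is the closed ball of radius $r$ centered at $x$. The set of accumulation points of $D_r(x)$ as $r\searrow 0$ is $$A(D(x))=\{y\in(0,+\infty): \lim_{k\to\infty}D_{r_k}(x)=y \text{ for some sequence } r_k\searrow 0\}.$$ The function $\beta:\mathbb{R}\to\mathbb{R}$ is defined by $\sum_{i=1}^N p_i^q r_i^{\beta(q)}=1$ for $q\in\mathbb{R}$. The Legendre transform of $\varphi:\mathbb{R}\to\mathbb{R}$ is $\varphi^*(x)=\inf_{y\in\mathbb{R}}(xy+\varphi(y))$; thus $\beta^*(\alpha)=\inf_{q\in\mathbb{R}}(\alpha q+\beta(q))$. ''Closed subinterval'' means a non-empty closed interval; a singleton is regarded as a closed subinterval. $\dim_P$ denotes packing dimension. *)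

(* Defs.v *)
From HB Require Import structures.
From mathcomp Require Import all_boot all_order all_algebra.
From mathcomp Require Import all_classical all_reals all_analysis.

Set Implicit Arguments.
Unset Strict Implicit.
Unset Printing Implicit Defensive.

Import Order.TTheory GRing.Theory Num.Theory.
Import numFieldNormedType.Exports.

Local Open Scope classical_set_scope.
Local Open Scope ring_scope.

(* The norm that MathComp-Analysis puts on ['rV[R]_d] is the sup norm. It
   induces the usual topology, hence the usual open, compact and bounded sets,
   but balls and similarities must refer to the Euclidean norm below. *)
Definition enorm (R : realType) (d : nat) (x : 'rV[R]_d) : R :=
  Num.sqrt (\sum_(j < d) x 0 j ^+ 2).

Definition eball (R : realType) (d : nat) (x : 'rV[R]_d) (r : R)
    : set 'rV[R]_d :=
  closed_ball_ (@enorm R d) x r.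

(* [R^d] with its Borel sigma-algebra. *)
Definition borelRV (R : realType) (d : nat) :=
  g_sigma_algebraType (@open 'rV[R]_d).

Section SelfSimilar.
Context (R : realType) (d N : nat).
Implicit Types (S : 'I_N -> 'rV[R]_d -> 'rV[R]_d) (p r : 'I_N -> R).

Definition similarity (c : R) (f : 'rV[R]_d -> 'rV[R]_d) : Prop :=
  forall x y, enorm (f x - f y) = c * enorm (x - y).

Definition probability_vector p : Prop :=
  (forall i, 0 <= p i) /\ \sum_(i < N) p i = 1.

Definition self_similar_set S (K : set 'rV[R]_d) : Prop :=
  [/\ K !=set0, compact K & K = \bigcup_i (S i @` K)].

Definition self_similar_measure S p (mu : probability (borelRV R d) R) : Prop :=
  forall A : set (borelRV R d), measurable A ->
    mu A = (\sum_(i < N) (p i)%:E * mu (S i @^-1` A))%E.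

Definition open_set_condition S : Prop :=
  exists U : set 'rV[R]_d,
    [/\ open U, U !=set0, bounded_set U,
        \bigcup_i (S i @` U) `<=` U &
        forall i j, i != j -> (S i @` U) `&` (S j @` U) = set0].

End SelfSimilar.

Definition minimum_of (R : realType) (A : set R) (m : R) : Prop :=
  A m /\ lbound A m.

Definition maximum_of (R : realType) (A : set R) (m : R) : Prop :=
  A m /\ ubound A m.

Section LocalDimension.
Context (R : realType) (d : nat) (mu : probability (borelRV R d) R).

Definition Dr (r : R) (x : 'rV[R]_d) : R :=
  ln (fine (mu (eball x r))) / ln r.

Definition accumulation_points (x : 'rV[R]_d) : set R :=
  [set y : R | 0 < y /\
    exists rk : R^nat,
      [/\ forall k, 0 < rk k, nonincreasing_seq rk, rk @ \oo --> (0 : R) &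
          Dr (rk k) x @[k --> \oo] --> y]].

End LocalDimension.

(* The infimum may be [-oo], so it is taken in the extended reals. *)
Definition legendre (R : realType) (phi : R -> R) (x : R) : \bar R :=
  ereal_inf [set (x * y + phi y)%:E | y in [set: R]].

(* A non-empty closed interval contained in [lo, hi]; singletons allowed. *)
Definition closed_subinterval (R : realType) (lo hi : R) (I : set R) : Prop :=
  exists a b : R, [/\ lo <= a, a <= b, b <= hi & I = `[a, b]%classic].

(* Packing dimension is taken in the sense of Tricot, via packing measures. *)
Section Packing.
Context (R : realType) (d : nat).
Implicit Types (E : set 'rV[R]_d) (s delta : R).

(* A finite or countably infinite family, indexed by [J], of disjoint closed
   balls centred in [E] with diameters at most [delta]. *)
Definition packing delta E (J : set nat) (c : nat -> 'rV[R]_d)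
    (rad : nat -> R) : Prop :=
  (forall i, J i -> [/\ E (c i), 0 < rad i & 2 * rad i <= delta]) /\
  trivIset J (fun i => eball (c i) (rad i)).

Definition packing_premeasure_at s delta E : \bar R :=
  ereal_sup [set m | exists J c rad, packing delta E J c rad /\
    m = \esum_(i in J) ((2 * rad i) `^ s)%:E].

(* [packing_premeasure_at] is nondecreasing in [delta], so this infimum is its
   limit as [delta] tends to 0. *)
Definition packing_premeasure s E : \bar R :=
  ereal_inf [set packing_premeasure_at s delta E
            | delta in [set delta | 0 < delta]].

Definition packing_measure s E : \bar R :=
  ereal_inf [set m | exists F : nat -> set 'rV[R]_d,
    E `<=` \bigcup_i F i /\
    m = (\sum_(0 <= i <oo) packing_premeasure s (F i))%E].

Definition packing_dim E : \bar R :=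
  ereal_inf [set s%:E | s in [set s | 0 <= s /\ packing_measure s E = 0%E]].

End Packing.

(* Main.v *)
Require Import Defs.
From mathcomp Require Import all_boot all_order all_algebra.
From mathcomp Require Import finmap.
From mathcomp Require Import all_classical all_reals all_analysis.
From mathcomp Require Import ring lra zify.

Set Implicit Arguments.
Unset Strict Implicit.
Unset Printing Implicit Defensive.

Import Order.TTheory GRing.Theory Num.Theory.
Import numFieldNormedType.Exports.

Local Open Scope classical_set_scope.
Local Open Scope ring_scope.

(** Write [sw w] for the composition of the similarities along a word [w], [wt r w]
    and [wt p w] for the corresponding products of ratios and probabilities, and
    [lr w], [lp w] for minus their logarithms. By the open set condition a ball
    meets a bounded number of cylinders of its own size ([near_bound]). So its
    mass is, up to constants, at least the weight of the cylinder around its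
    centre and at most that of the heaviest cylinder nearby, and the quotients
    [Dr mu t x] are asymptotically between the extreme exponents.

    The quotient is continuous in [t], since spheres are null ([m_sphere]): in
    the coordinates [1, y, |y|^2] intersections of spheres are linear systems,
    and among the systems of a given rank one of almost maximal mass would be
    invariant under a contraction, hence a point. The accumulation points of a
    bounded continuous function form a closed interval ([acc_interval]).

    Upper bound. Let [max (a q, b q) + beta q < s]. A ball centred at a point
    with local dimensions in [[a, b]] contains a cylinder whose weight for the
    probability vector [p_i^q r_i^(beta q)] dominates the [s]-th power of the
    diameter. Disjoint balls give incomparable words, and Kraft's inequality
    bounds the sum over a packing ([packing_measure_eq0]). Since [beta] is convex,
    the infimum over [q] of [max (a q, b q) + beta q] is the supremum of the
    Legendre transform over [[a, b]] ([minimax]).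

    Lower bound. Let [s] be less than the Legendre transform at [al], with
    [a <= al <= b]. Some word [w0] separates: points of the cylinder [u ++ w0] are
    at least its ratio away from all cylinders incomparable with [u]
    ([separated]), and balls of that radius around them have mass at most that
    of [u] ([m_ball_le_prefix]). The law of large numbers for a tilted vector
    gives families of words that end with [w0], have exponents close to [al] and
    satisfy [sum r_w^s >= 2] ([blocks_rich]). Concatenating such words in stages
    with targets [a], [b], [al], [a], [b], [al] and so on, each stage much longer
    than all the previous ones together, yields a tree of codes whose points have
    exactly [[a, b]] as accumulation points ([acc_subset], [acc_target]). Below
    each node of the tree there are arbitrarily deep stages over which the sum of
    the [s]-th powers of the ratios is at least [1], so a set of points of the
    tree that is dense below a node has packing premeasure at least [1]
    ([dense_premeasure]). By Baire's argument countably many sets that are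
    nowhere dense in this sense do not exhaust the tree ([packing_tree]), and the
    packing measure is positive. *)

(** * The Euclidean norm *)

Section Euclid.
Context {R : realType} {d : nat}.
Implicit Types x y z : 'rV[R]_d.

Definition dot x y : R := \sum_(j < d) x 0 j * y 0 j.

Lemma dotC x y : dot x y = dot y x.
Proof. by apply: eq_bigr => j _; rewrite mulrC. Qed.

Lemma dotDl x y z : dot (x + y) z = dot x z + dot y z.
Proof. by rewrite -big_split; apply: eq_bigr => j _; rewrite !mxE mulrDl. Qed.

Lemma dotZl a x y : dot (a *: x) y = a * dot x y.
Proof. by rewrite /dot big_distrr; apply: eq_bigr => j _; rewrite !mxE -mulrA. Qed.

Lemma dotDr x y z : dot x (y + z) = dot x y + dot x z.
Proof. by rewrite dotC dotDl !(dotC _ x). Qed.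

Lemma dotZr a x y : dot x (a *: y) = a * dot x y.
Proof. by rewrite dotC dotZl dotC. Qed.

Lemma dotNl x y : dot (- x) y = - dot x y.
Proof. by rewrite -scaleN1r dotZl mulN1r. Qed.

Lemma dotNr x y : dot x (- y) = - dot x y.
Proof. by rewrite dotC dotNl dotC. Qed.

Lemma dot_ge0 x : 0 <= dot x x.
Proof. by apply: sumr_ge0 => j _; rewrite -expr2 sqr_ge0. Qed.

Lemma enormE x : enorm x = Num.sqrt (dot x x).
Proof. by congr Num.sqrt; apply: eq_bigr => j _; rewrite expr2. Qed.

Lemma sqr_enorm x : enorm x ^+ 2 = dot x x.
Proof. by rewrite enormE sqr_sqrtr // dot_ge0. Qed.

Lemma enorm_ge0 x : 0 <= enorm x.
Proof. exact: sqrtr_ge0. Qed.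

Lemma ler_coord_enorm x j : `|x 0 j| <= enorm x.
Proof.
rewrite -(@ler_pXn2r _ 2) ?nnegrE ?enorm_ge0// sqr_enorm real_normK ?num_real//.
rewrite /dot (bigD1 j) //= -expr2 lerDl; apply: sumr_ge0 => i _.
by rewrite -expr2 sqr_ge0.
Qed.

Lemma enorm_eq0 x : enorm x = 0 -> x = 0.
Proof.
move=> x0; apply/rowP => j; rewrite mxE; apply/eqP; rewrite -normr_le0.
by rewrite (le_trans (ler_coord_enorm x j)) // x0.
Qed.

Lemma enorm0 : enorm (0 : 'rV[R]_d) = 0.
Proof. by rewrite enormE /dot big1 ?sqrtr0// => j _; rewrite !mxE mulr0. Qed.

Lemma CauchySchwarz x y : dot x y ^+ 2 <= dot x x * dot y y.
Proof.
have [y0|yn0] := eqVneq (dot y y) 0.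
  have -> : y = 0 by apply: enorm_eq0; rewrite enormE y0 sqrtr0.
  rewrite -{1}(scale0r 0) dotZr mul0r expr0n /= mulr_ge0 ?dot_ge0//.
have : 0 <= dot (dot y y *: x - dot x y *: y) (dot y y *: x - dot x y *: y).
  exact: dot_ge0.
rewrite !(dotDl, dotDr, dotNl, dotNr, dotZl, dotZr) (dotC y x).
set a := dot x x; set b := dot y y; set c := dot x y => h.
have b0 : 0 < b by rewrite lt_def yn0 dot_ge0.
have : 0 <= b * (a * b - c ^+ 2) by move: h; congr (_ <= _); ring.
by rewrite pmulr_rge0 // subr_ge0.
Qed.

Lemma enormD x y : enorm (x + y) <= enorm x + enorm y.
Proof.
rewrite -(@ler_pXn2r _ 2) ?nnegrE ?addr_ge0 ?enorm_ge0// sqr_enorm.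
rewrite sqrrD !sqr_enorm !(dotDl, dotDr) (dotC y x).
have h : dot x y <= enorm x * enorm y.
  rewrite (le_trans (ler_norm _)) // -(@ler_pXn2r _ 2) ?nnegrE ?mulr_ge0 ?enorm_ge0//.
  by rewrite real_normK ?num_real// exprMn !sqr_enorm CauchySchwarz.
rewrite -mulr_natr; lra.
Qed.

Lemma enormZ a x : enorm (a *: x) = `|a| * enorm x.
Proof.
by rewrite !enormE dotZl dotZr mulrA -expr2 sqrtrM ?sqr_ge0// sqrtr_sqr.
Qed.

Lemma enormN x : enorm (- x) = enorm x.
Proof. by rewrite -scaleN1r enormZ normrN normr1 mul1r. Qed.

Lemma enormB x y : enorm (x - y) = enorm (y - x).
Proof. by rewrite -enormN opprB. Qed.

Lemma enorm_triangle y x z : enorm (x - z) <= enorm (x - y) + enorm (y - z).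
Proof. by rewrite (le_trans _ (enormD _ _)) // addrA subrK. Qed.

Lemma ler_enorm_sup x : enorm x <= d%:R * `|x|.
Proof.
rewrite -(@ler_pXn2r _ 2) ?nnegrE ?mulr_ge0 ?enorm_ge0// sqr_enorm.
have h j : x 0 j * x 0 j <= `|x| ^+ 2.
  rewrite -expr2 -(real_normK (num_real _)) ler_pXn2r ?nnegrE//.
  by rewrite [leRHS]/Num.norm /= mx_normrE (le_bigmax _ _ (0, j)).
rewrite /dot (le_trans (ler_sum _ (fun j _ => h j))) // sumr_const card_ord.
rewrite exprMn -[leLHS]mulr_natl ler_wpM2r ?sqr_ge0//.
by rewrite -natrX ler_nat; case: d => // n; rewrite expnS leq_pmulr // expn_gt0.
Qed.

Lemma ler_sup_enorm x : `|x| <= enorm x.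
Proof.
rewrite [leLHS]/Num.norm /= mx_normrE (bigmax_le _ (enorm_ge0 x)) //= => -[i j] _.
by rewrite /= (ord1 i) ler_coord_enorm.
Qed.

Lemma open_eballP (U : set 'rV[R]_d) x : open U -> U x ->
  exists2 e, 0 < e & forall y, enorm (x - y) < e -> U y.
Proof.
move=> oU Ux; have /nbhs_ballP[e /= e0 eU] : nbhs x U by exact: open_nbhs_nbhs.
exists e => // y xy; apply: eU; rewrite -ball_normE /=.
exact: (le_lt_trans (ler_sup_enorm _)).
Qed.

(** The Euclidean and the sup norm define the same open sets. *)
Lemma eball_open (U : set 'rV[R]_d) :
  (forall x, U x -> exists2 e, 0 < e & forall y, enorm (x - y) < e -> U y) ->
  open U.
Proof.
move=> h; rewrite openE => x /h[e e0 eU]; apply/nbhs_ballP.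
have d0 : 0 < d%:R + 1 :> R by rewrite ltr_wpDl.
exists (e / (d%:R + 1)); first exact: divr_gt0.
move=> y; rewrite -ball_normE /= ltr_pdivlMr // => xy; apply: eU.
rewrite (le_lt_trans (ler_enorm_sup _)) // (le_lt_trans _ xy) // mulrC.
by rewrite ler_wpM2l // lerDl.
Qed.

Lemma closed_eball x t : closed (eball x t).
Proof.
rewrite -[eball x t]setCK; apply/open_closedC/eball_open => y.
move/negP; rewrite -ltNge => ty; exists (enorm (x - y) - t); rewrite ?subr_gt0//.
move=> z yz; apply/negP; rewrite -ltNge.
by have := enorm_triangle z x y; rewrite (enormB z y); lra.
Qed.

Lemma measurable_eball x t : measurable (eball x t : set (borelRV R d)).
Proof.
rewrite -[eball x t]setCK; apply: measurableC; apply: sub_sigma_algebra.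
exact/closed_openC/closed_eball.
Qed.

End Euclid.

(** * Similarities are affine *)

Section Similarity.
Context {R : realType} {d : nat} (c : R) (f : 'rV[R]_d -> 'rV[R]_d).
Context (c0 : 0 < c) (fS : similarity c f).

Let L x := f x - f 0.

Let LB x y : enorm (L x - L y) = c * enorm (x - y).
Proof. by rewrite /L opprB addrA subrK fS. Qed.

Let L0 : L 0 = 0. Proof. by rewrite /L subrr. Qed.

Let Ldot x y : dot (L x) (L y) = c ^+ 2 * dot x y.
Proof.
have sq u v : dot (L u - L v) (L u - L v) = c ^+ 2 * dot (u - v) (u - v).
  by rewrite -!sqr_enorm LB exprMn.
have := sq x 0; have := sq y 0; have := sq x y.
rewrite L0 !subr0; move: (L x) (L y) => u v.
rewrite !(dotDl, dotDr, dotNl, dotNr) (dotC v u) (dotC y x).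
move=> h1 h2 h3; lra.
Qed.

(** By polarisation [f - f 0] preserves inner products up to [c^2], so it is
    determined by its values on the canonical basis, which are orthogonal. *)
Lemma similarity_affine : exists (A : 'M[R]_d) (b : 'rV[R]_d),
  A \in unitmx /\ forall x, f x = x *m A + b.
Proof.
pose A : 'M[R]_d := \matrix_i L (delta_mx 0 i).
have LA x : L x *m A^T = c ^+ 2 *: x.
  apply/rowP => j; rewrite !mxE; transitivity (dot (L x) (L (delta_mx 0 j))).
    by apply: eq_bigr => k _; rewrite !mxE.
  rewrite Ldot; congr (_ * _); rewrite /dot (bigD1 j) //= mxE !eqxx mulr1.
  rewrite big1 ?addr0// => k kj; rewrite mxE (negbTE kj) andbF mulr0 //.
have AAT : A *m A^T = (c ^+ 2)%:M.
  apply/row_matrixP => i; rewrite row_mul rowK LA rowE.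
  by rewrite -mul_mx_scalar.
have uA : A \in unitmx.
  have : A *m A^T \in unitmx.
    by rewrite AAT unitmxE det_scalar unitfE gt_eqF// !exprn_gt0.
  by rewrite unitmx_mul => /andP[].
exists A, (f 0); split=> // x; apply/eqP; rewrite -subr_eq; apply/eqP.
rewrite -/(L x); have uAT : A^T \in unitmx by rewrite unitmx_tr.
apply: (can_inj (mulmxK uAT)); rewrite LA -mulmxA AAT mul_mx_scalar //.
Qed.

End Similarity.

(** * Two facts from real analysis *)

Lemma expr_small {R : realType} (x e : R) : 0 <= x < 1 -> 0 < e ->
  exists n, x ^+ n <= e.
Proof.
move=> /andP[x0 x1] e0; have := @cvg_expr R x; rewrite ger0_norm // => /(_ x1).
move=> /cvgrPdist_le /(_ _ e0) [n _ /(_ n (leqnn n))] /=.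
by rewrite sub0r normrN => h; exists n; rewrite (le_trans (ler_norm _) h).
Qed.

Lemma continuous_sumr {R : realType} (T : topologicalType) (I : Type) (s : seq I)
  (f : I -> T -> R) :
  (forall i, continuous (f i)) -> continuous (fun y => \sum_(i <- s) f i y).
Proof.
move=> cf; elim: s => [|i s IH].
  by under eq_fun do rewrite big_nil; exact: cst_continuous.
under eq_fun do rewrite big_cons.
by move=> x; exact: (continuousD (cf i x) (IH x)).
Qed.

(** * Weights of words and stopped words *)

Section Words.
Context {R : realType} {N : nat}.
Implicit Types (f r p : 'I_N -> R) (u v w : seq 'I_N) (rho : R).

Definition wt f w : R := \prod_(i <- w) f i.

Lemma wt_nil f : wt f [::] = 1. Proof. exact: big_nil. Qed.
Lemma wt_cons f i w : wt f (i :: w) = f i * wt f w. Proof. exact: big_cons. Qed.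
Lemma wt_cat f u v : wt f (u ++ v) = wt f u * wt f v. Proof. exact: big_cat. Qed.
Lemma wt_rcons f w i : wt f (rcons w i) = wt f w * f i.
Proof. by rewrite -cats1 wt_cat wt_cons wt_nil mulr1. Qed.

Lemma wt_gt0 f w : (forall i, 0 < f i) -> 0 < wt f w.
Proof. by move=> f0; apply: prodr_gt0. Qed.

Lemma wt_le1 f w : (forall i, 0 < f i <= 1) -> wt f w <= 1.
Proof.
move=> f1; elim: w => [|i w IH]; first by rewrite wt_nil.
have /andP[f0 fi] := f1 i; rewrite wt_cons mulr_ile1 // ?(ltW f0)//.
by apply/ltW/wt_gt0 => j; have /andP[] := f1 j.
Qed.

Lemma wt_powR p r q b w : (forall i, 0 < p i) -> (forall i, 0 < r i) ->
  wt (fun i => p i `^ q * r i `^ b) w = wt p w `^ q * wt r w `^ b.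
Proof.
move=> p0 r0; elim: w => [|i w IH]; first by rewrite !wt_nil !powR1 mulr1.
rewrite !wt_cons IH !powRM ?(ltW (p0 _)) ?(ltW (r0 _)) ?(ltW (wt_gt0 _ p0)) ?(ltW (wt_gt0 _ r0))//.
by rewrite mulrACA.
Qed.

(** For ratios below [1] these are the words whose ratio is at most [rho] while
    that of their parent still exceeds [rho]. Recursion on the first letter makes
    the stopped words below [i] those of scale [rho / r i]. *)
Fixpoint stop r rho w : bool :=
  if w is i :: w' then (rho < 1) && stop r (rho / r i) w' else 1 <= rho.

Lemma stop_le r rho w : (forall i, 0 < r i) -> stop r rho w -> wt r w <= rho.
Proof.
move=> r0; elim: w rho => [|i w IH] rho /=; first by rewrite wt_nil.
by case/andP=> _ /IH; rewrite wt_cons ler_pdivlMr ?r0// mulrC.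
Qed.

Lemma stop_gt r rho m w : (forall i, 0 < r i) -> 0 < m ->
  (forall i, m <= r i) -> stop r rho w -> rho * m < 1 -> rho * m < wt r w.
Proof.
move=> r0 m0 mr; elim: w rho => [|i w IH] rho /=; first by rewrite wt_nil.
case/andP=> rho1 st _; have [rhop|rhop] := leP rho 0.
  by rewrite (le_lt_trans _ (wt_gt0 _ r0))// pmulr_lle0.
have h : rho / r i * m <= rho.
  by rewrite mulrAC ler_pdivrMr ?r0// ler_wpM2l ?(ltW rhop).
have := IH _ st (le_lt_trans h rho1).
by rewrite wt_cons mulrAC ltr_pdivrMr ?r0// (mulrC (r i)).
Qed.

Lemma stop_cat r rho u v : (forall i, 0 < r i < 1) -> 0 < rho <= 1 ->
  stop r rho v -> stop r (wt r u * rho) (u ++ v).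
Proof.
move=> r01 /andP[rho0 rho1] st; have r0 i : 0 < r i by case/andP: (r01 i).
have r1 i : 0 < r i <= 1 by case/andP: (r01 i) => -> /ltW.
elim: u => [|i u IH] /=; first by rewrite wt_nil mul1r.
rewrite wt_cons -mulrA mulrAC divff ?gt_eqF// mul1r IH andbT.
have [ri0 ri1] := andP (r01 i); rewrite (le_lt_trans _ ri1) // ler_piMr ?(ltW ri0)//.
by rewrite mulr_ile1 ?(ltW rho0) ?(ltW (wt_gt0 _ r0)) ?wt_le1.
Qed.

Lemma stop_prefix r rho v w : stop r rho v -> stop r rho w -> prefix v w ->
  v = w.
Proof.
elim: v w rho => [|i v IH] [|j w] rho //=; first by rewrite leNgt => /negP h /andP[].
by move=> /andP[_ sv] /andP[_ sw] /andP[/eqP ij vw]; rewrite ij in sv *; rewrite (IH w _ sv sw vw).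
Qed.

Lemma prefix_total u v w : prefix u w -> prefix v w -> prefix u v || prefix v u.
Proof.
elim: u v w => [|i u IH] [|j v] [|k w] //=.
move=> /andP[/eqP-> uw] /andP[/eqP-> vw].
by rewrite eqxx /= (IH _ _ uw vw).
Qed.

(** The stopped words form a finite tree section: a quantity that is
    distributed among the children of every word is the sum of its values over
    the stopped words. *)
Lemma stop_enum r rho : (forall i, 0 < r i < 1) -> 0 < rho ->
  exists L : seq (seq 'I_N), [/\ uniq L, forall w, (w \in L) = stop r rho w &
    forall F : seq 'I_N -> R, (forall w, F w = \sum_i F (rcons w i)) ->
      F [::] = \sum_(w <- L) F w].
Proof.
move=> r01 rho0; have r0 i : 0 < r i by case/andP: (r01 i).
pose m := \big[Order.max/2^-1]_(i < N) r i.
have m0 : 0 < m by rewrite (lt_le_trans _ (bigmax_ge_id _ _ _ _)).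
have m1 : m < 1.
  by apply/bigmax_ltP; split=> [|i _]; [lra|case/andP: (r01 i)].
have rm i : r i <= m by exact: le_bigmax.
have [n hn] : exists n, m ^+ n <= rho. by apply: expr_small => //; rewrite m1 ltW.
elim: n rho rho0 hn => [|n IH] rho rho0 hn.
  rewrite expr0 in hn; exists [:: [::]]; split=> // [[|i w]|F _].
  - by rewrite inE eqxx /= hn.
  - by rewrite inE /= ltNge hn.
  - by rewrite big_seq1.
have [rho1|rho1] := leP 1 rho.
  exists [:: [::]]; split=> // [[|i w]|F _].
  - by rewrite inE eqxx /= rho1.
  - by rewrite inE /= ltNge rho1.
  - by rewrite big_seq1.
have hi i : exists L : seq (seq 'I_N), [/\ uniq L,
    forall w, (w \in L) = stop r (rho / r i) w &
    forall F : seq 'I_N -> R, (forall w, F w = \sum_i F (rcons w i)) ->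
      F [::] = \sum_(w <- L) F w].
  apply: IH; first exact: divr_gt0.
  rewrite ler_pdivlMr ?r0// (le_trans _ hn) // exprSr.
  by rewrite ler_wpM2l // exprn_ge0 // ltW.
have [L HL] := choice hi.
exists [seq i :: w | i <- enum 'I_N, w <- L i]; split.
- apply: allpairs_uniq_dep => [|i _|]; rewrite ?enum_uniq//; first by have [] := HL i.
  by move=> [i v] [j w] _ _ /= [-> ->].
- case=> [|i w] /=.
    by rewrite leNgt rho1; apply/negbTE/allpairsPdep => -[i [w [_ _]]].
  rewrite rho1 /=; have [_ <- _] := HL i; apply/allpairsPdep/idP.
    by move=> [j [v [_ vL [-> ->]]]].
  by move=> wL; exists i, w; split=> //; rewrite mem_enum.
- move=> F HF; rewrite HF big_allpairs_dep /= big_enum /=; apply: eq_bigr => i _.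
  have [_ _ /(_ (fun w => F (i :: w)))] := HL i; apply.
  by move=> w; rewrite HF.
Qed.

(** Kraft's inequality, by induction on the greatest length: the words of a
    prefix-free family are sorted by their first letter, unless the family
    contains the empty word and hence no other one. *)
Lemma kraft f (L : seq (seq 'I_N)) : (forall i, 0 <= f i) -> \sum_i f i <= 1 ->
  uniq L -> {in L &, forall v w, prefix v w -> v = w} ->
  \sum_(w <- L) wt f w <= 1.
Proof.
move=> f0 f1; have [n hn] : exists n, forall w, w \in L -> (size w < n)%N.
  exists (\max_(w <- L) size w).+1 => w wL; rewrite ltnS.
  by rewrite (big_rem w) //= leq_maxl.
elim: n L hn => [|n IH] L hn uL aL.
  case: L hn {uL aL} => [|w L] hn; first by rewrite big_nil.
  by have := hn w; rewrite mem_head => /(_ isT).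
have [eL|eL] := boolP ([::] \in L).
  have L1 w : w \in L -> w = [::] by move=> wL; rewrite -(aL _ _ eL wL) ?prefix0s.
  case: L uL L1 {hn aL eL} => [|v [|w L]] uL L1; rewrite ?big_nil ?big_seq1//.
    by rewrite (L1 v) ?wt_nil// mem_head.
  move: uL; rewrite /= (L1 v) ?mem_head// (L1 w) ?inE ?eqxx ?orbT//.
pose Li i := [seq behead w | w <- L & ohead w == Some i].
have step : \sum_(w <- L) wt f w = \sum_i f i * \sum_(w <- Li i) wt f w.
  transitivity (\sum_(w <- L) \sum_(i | ohead w == Some i) wt f w).
    rewrite big_seq [RHS]big_seq; apply: eq_bigr => -[|i w] wL; first by rewrite wL in eL.
    by rewrite /= (big_pred1 i) // => j /=; rewrite eq_sym; apply/eqP/eqP => [[]|->].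
  rewrite (exchange_big_dep predT) //=; apply: eq_bigr => i _.
  rewrite big_map big_filter big_distrr /=; apply: eq_bigr => -[|j w] //= /eqP[->].
  by rewrite wt_cons.
rewrite step (le_trans _ f1) //; apply: ler_sum => i _.
rewrite ler_piMr //; apply: IH.
- move=> w /mapP[[|j v]]; rewrite mem_filter => /andP[//= _ vL] ->.
  by have := hn _ vL.
- rewrite map_inj_in_uniq ?filter_uniq// => v w.
  rewrite !mem_filter => /andP[hv _] /andP[hw _].
  by case: v w hv hw => [|j v] [|k w] //= /eqP[->] /eqP[->] ->.
- move=> v w /mapP[[|j v']]; rewrite mem_filter => /andP[//= /eqP[->] vL] ->.
  move=> /mapP[[|k w']]; rewrite mem_filter => /andP[//= /eqP[->] wL] -> vw.
  by have [] : i :: v' = i :: w' by apply: aL => //=; rewrite eqxx.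
Qed.

Lemma kraft_prefix f u (L : seq (seq 'I_N)) : (forall i, 0 <= f i) ->
  \sum_i f i <= 1 -> uniq L -> {in L &, forall v w, prefix v w -> v = w} ->
  {in L, forall w, prefix u w} -> \sum_(w <- L) wt f w <= wt f u.
Proof.
move=> f0 f1 uL aL pL.
have catL w : w \in L -> u ++ drop (size u) w = w.
  by move=> /pL /prefixP[v ->]; rewrite drop_size_cat.
have -> : \sum_(w <- L) wt f w =
    wt f u * \sum_(w <- map (drop (size u)) L) wt f w.
  rewrite big_map big_distrr /= big_seq [RHS]big_seq; apply: eq_bigr => w wL.
  by rewrite -wt_cat catL.
rewrite ler_piMr ?prodr_ge0//; apply: kraft => //.
- rewrite map_inj_in_uniq// => v w vL wL vw.
  by rewrite -(catL _ vL) vw catL.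
- move=> _ _ /mapP[v vL ->] /mapP[w wL ->] vw; congr drop; apply: aL => //.
  have [z hz] := prefixP vw; apply/prefixP; exists z.
  by rewrite -[LHS](catL _ wL) hz catA catL.
Qed.

Lemma kraft_stop r rho (L : seq (seq 'I_N)) :
  {in L, forall w, stop r rho w} -> {in L &, forall v w, prefix v w -> v = w}.
Proof. by move=> sL v w /sL sv /sL sw; exact: stop_prefix sv sw. Qed.

End Words.

(** * The self-similar set and measure *)

Section SelfSimilarMeasure.
Context {R : realType} {d N : nat} (hN : (2 <= N)%N).
Context (S : 'I_N -> 'rV[R]_d -> 'rV[R]_d) (r p : 'I_N -> R).
Context (hr : forall i, 0 < r i < 1) (hS : forall i, similarity (r i) (S i)).
Context (hp : probability_vector p) (hp0 : forall i, 0 < p i).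
Context (K : set 'rV[R]_d) (hK : self_similar_set S K).
Context (mu : probability (borelRV R d) R) (hmu : self_similar_measure S p mu).
Context (hOSC : open_set_condition S).
Local Notation bmeas A := (measurable (A : set (borelRV R d))).
Implicit Types (x y z : 'rV[R]_d) (u v w : seq 'I_N) (A B : set 'rV[R]_d).

Lemma r_gt0 i : 0 < r i. Proof. by case/andP: (hr i). Qed.
Lemma r_lt1 i : r i < 1. Proof. by case/andP: (hr i). Qed.
Local Hint Resolve r_gt0 r_lt1 hp0 : core.

Lemma p_sum : \sum_i p i = 1. Proof. by case: hp. Qed.

Lemma p_lt1 i : p i < 1.
Proof.
have [j ji] : exists j : 'I_N, j != i.
  case: N hN i => [|[|n]] // _ i; have [->|i0] := eqVneq i ord0.
    by exists ord_max; apply/eqP => /(congr1 val).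
  by exists ord0; rewrite eq_sym.
rewrite -p_sum (bigD1 i) //= ltrDl (bigD1 j) //= ltr_wpDr //.
by apply: sumr_ge0 => k _; exact: ltW.
Qed.

Definition rmin : R := \big[Order.min/2^-1]_i r i.
Definition rmax : R := \big[Order.max/2^-1]_i r i.

Lemma rmin_gt0 : 0 < rmin. Proof. by apply/bigmin_gtP; split=> // i _. Qed.
Lemma rmin_lt1 : rmin < 1.
Proof. by rewrite (@le_lt_trans _ _ 2^-1) ?bigmin_le_id//; lra. Qed.
Lemma rmin_le i : rmin <= r i. Proof. exact: bigmin_le. Qed.
Lemma rmax_lt1 : rmax < 1.
Proof. by apply/bigmax_ltP; split=> [|i _]; [lra|]. Qed.
Lemma rmax_ge i : r i <= rmax. Proof. exact: le_bigmax. Qed.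
Lemma rmax_gt0 : 0 < rmax.
Proof. by rewrite (lt_le_trans _ (bigmax_ge_id _ _ _ _)). Qed.
Local Hint Resolve rmin_gt0 rmin_lt1 rmax_gt0 rmax_lt1 : core.

Lemma wtr_gt0 w : 0 < wt r w. Proof. exact: wt_gt0. Qed.
Lemma wtp_gt0 w : 0 < wt p w. Proof. exact: wt_gt0. Qed.
Lemma wtr_le1 w : wt r w <= 1.
Proof. by apply: wt_le1 => i; rewrite r_gt0 ltW. Qed.
Lemma wtp_le1 w : wt p w <= 1.
Proof. by apply: wt_le1 => i; rewrite hp0 (ltW (p_lt1 i)). Qed.
Local Hint Resolve wtr_gt0 wtp_gt0 : core.

Lemma wtr_le_exp w : wt r w <= rmax ^+ size w.
Proof.
elim: w => [|i w IH]; first by rewrite wt_nil.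
by rewrite wt_cons exprS ler_pM ?rmax_ge// ltW.
Qed.

Lemma wtr_ge_exp w : rmin ^+ size w <= wt r w.
Proof.
elim: w => [|i w IH]; first by rewrite wt_nil.
by rewrite wt_cons exprS ler_pM ?exprn_ge0 ?rmin_le// ltW.
Qed.

Lemma stop_gt_rmin rho w : rho <= 1 -> stop r rho w -> rho * rmin < wt r w.
Proof.
move=> rho1 /(stop_gt r_gt0 rmin_gt0 rmin_le); apply.
have [rho0|rho0] := leP rho 0; first by rewrite (le_lt_trans _ ltr01)// pmulr_lle0.
by rewrite (le_lt_trans _ rmin_lt1)// ler_piMl // ltW.
Qed.

(** * Maps indexed by words *)

Definition sw w x := foldr S x w.

Lemma sw_cat u v x : sw (u ++ v) x = sw u (sw v x).
Proof. exact: foldr_cat. Qed.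

Lemma sw_rcons w i x : sw (rcons w i) x = sw w (S i x).
Proof. by rewrite -cats1 sw_cat. Qed.

Lemma sw_sim w : similarity (wt r w) (sw w).
Proof.
move=> x y; elim: w => [|i w IH]; first by rewrite wt_nil mul1r.
by rewrite wt_cons -mulrA -IH -hS.
Qed.

Lemma sw_surj w y : exists x, sw w x = y.
Proof.
have [A [b [uA fE]]] := similarity_affine (wtr_gt0 w) (sw_sim w).
by exists ((y - b) *m invmx A); rewrite fE mulmxKV // subrK.
Qed.

Lemma sw_inj w : injective (sw w).
Proof.
move=> x y xy; apply/eqP; rewrite -subr_eq0; apply/eqP/enorm_eq0.
have /eqP := sw_sim w x y; rewrite xy subrr enorm0 eq_sym mulf_eq0.
by rewrite gt_eqF //= => /eqP.
Qed.

Lemma open_preimage_sw w A : open A -> open (sw w @^-1` A).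
Proof.
move=> oA; apply: eball_open => x Ax; have [e e0 eA] := open_eballP oA Ax.
exists (e / wt r w); first exact: divr_gt0.
by move=> y; rewrite ltr_pdivlMr // mulrC -sw_sim => xy; exact: eA.
Qed.

Lemma measurable_sw w A : bmeas A ->
  bmeas (sw w @^-1` A).
Proof.
move=> mA; rewrite -[X in measurable X]setTI.
have : measurable_fun setT (sw w : borelRV R d -> borelRV R d).
  apply: (@measurability _ _ (borelRV R d) (borelRV R d) setT (sw w)
            (@open 'rV[R]_d) erefl).
  move=> _ [B oB <-]; rewrite setTI; apply: sub_sigma_algebra.
  exact: open_preimage_sw.
by apply.
Qed.

(** * The real-valued measure *)

Definition m A : R := fine (mu A).

Lemma mE A : bmeas A -> mu A = (m A)%:E.
Proof. by move=> mA; rewrite fineK // fin_num_measure. Qed.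

Lemma m_ge0 A : 0 <= m A. Proof. exact: fine_ge0. Qed.

Lemma m_le A B : bmeas A ->
  bmeas B -> A `<=` B -> m A <= m B.
Proof.
by move=> mA mB AB; rewrite -lee_fin -!mE// le_measure ?inE.
Qed.

Lemma m_setT : m setT = 1. Proof. by rewrite /m probability_setT. Qed.

Lemma m_le1 A : bmeas A -> m A <= 1.
Proof. by move=> mA; rewrite -m_setT m_le. Qed.

Lemma m_setC A : bmeas A -> m (~` A) = 1 - m A.
Proof.
move=> mA; apply/EFin_inj; rewrite EFinB -!mE//; last exact: measurableC.
exact: probability_setC.
Qed.

Lemma m_setU0 A B : bmeas A ->
  bmeas B -> m (A `&` B) = 0 ->
  m (A `|` B) = m A + m B.
Proof.
move=> mA mB AB; apply/EFin_inj; rewrite EFinD -!mE//; last exact: measurableU.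
rewrite measureUfinl -?ge0_fin_numE ?fin_num_measure//.
by have /= -> := mE (measurableI _ _ mA mB); rewrite AB sube0.
Qed.

Lemma m_word A w : bmeas A ->
  m (sw w @^-1` A) = \sum_i p i * m (sw (rcons w i) @^-1` A).
Proof.
move=> mA; have mwA := measurable_sw w mA.
rewrite {1}/m hmu // (_ : (\sum_(i < N) _)%E =
    (\sum_(i < N) p i * m (sw (rcons w i) @^-1` A))%:E)//.
rewrite -sumEFin; apply: eq_bigr => i _; rewrite EFinM -mE; last exact: measurable_sw.
by congr (_ * mu _)%E; rewrite -comp_preimage; apply: eq_set => x /=; rewrite sw_rcons.
Qed.

(** Iterating self-similarity along a stopped section. *)
Lemma m_stop A (L : seq (seq 'I_N)) :
  bmeas A ->
  (forall F : seq 'I_N -> R, (forall w, F w = \sum_i F (rcons w i)) ->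
      F [::] = \sum_(w <- L) F w) ->
  m A = \sum_(w <- L) wt p w * m (sw w @^-1` A).
Proof.
move=> mA /(_ (fun w => wt p w * m (sw w @^-1` A))).
rewrite /= wt_nil mul1r; apply=> w.
rewrite m_word // big_distrr /=; apply: eq_bigr => i _.
by rewrite wt_rcons mulrA.
Qed.

(** Every term of the iterated self-similarity relation is bounded by the whole. *)
Lemma m_ge_word A w : bmeas A ->
  wt p w * m (sw w @^-1` A) <= m A.
Proof.
move=> mA; elim/last_ind: w => [|w i IH]; first by rewrite wt_nil mul1r.
apply: le_trans IH; rewrite wt_rcons -mulrA ler_wpM2l ?(ltW (wtp_gt0 _))//.
rewrite [leRHS]m_word // (bigD1 i) //= lerDl; apply: sumr_ge0 => j _.
by rewrite mulr_ge0 ?m_ge0 ?ltW.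
Qed.

(** * An invariant ball of full measure *)

Let Qb c : set 'rV[R]_d := [set x | enorm x <= c].

Let QbE c : Qb c = eball 0 c.
Proof. by apply: eq_set => x; rewrite /= sub0r enormN. Qed.

Let measurable_Qb c : bmeas (Qb c).
Proof. by rewrite QbE; exact: measurable_eball. Qed.

(** On a ball of large radius [c] every map contracts towards the origin by a
    fixed factor [th]. Self-similarity then bounds the mass of the ball of
    radius [t / th] by that of the ball of radius [t], for all [t >= c], so
    that the ball of radius [c] already carries all the mass. *)
Lemma invariant_ball : exists c, [/\ 0 < c,
  forall i x, enorm x <= c -> enorm (S i x) <= c,
  forall x, K x -> enorm x <= c & m [set x | enorm x <= c] = 1].
Proof.
have [_ cK _] := hK.
have [M0 [_ hM]] := compact_bounded cK.
pose M := `|M0| + 1.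
have KM x : K x -> `|x| <= M by apply: hM; rewrite ltr_pwDr ?ler_norm.
pose C := \sum_i enorm (S i 0) + 1.
have CS i : enorm (S i 0) <= C.
  rewrite /C (bigD1 i) //= -addrA lerDl addr_ge0 // sumr_ge0 // => j _.
  exact: enorm_ge0.
have C0 : 0 < C by rewrite ltr_wpDl // sumr_ge0 // => j _; exact: enorm_ge0.
have rm1 : 0 < 1 - rmax by rewrite subr_gt0.
pose c := 2 * C / (1 - rmax) + d%:R * M.
have M0' : 0 <= d%:R * M by rewrite mulr_ge0 // addr_ge0.
have c0 : 0 < c by rewrite ltr_pwDl // divr_gt0 // mulr_gt0.
have Cc : C <= (1 - rmax) / 2 * c.
  have -> : C = (1 - rmax) / 2 * (2 * C / (1 - rmax)) by field; rewrite gt_eqF.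
  by rewrite ler_wpM2l ?lerDl// divr_ge0 // ltW.
pose th := (1 + rmax) / 2.
have th0 : 0 < th by rewrite divr_gt0 // addr_gt0.
have th1 : th < 1 by rewrite /th ltr_pdivrMr //; have := rmax_lt1; lra.
have Sth i x t : c <= t -> enorm x <= t -> enorm (S i x) <= th * t.
  move=> ct xt; rewrite -[S i x](subrK (S i 0)) (le_trans (enormD _ _))//.
  rewrite hS subr0 (@le_trans _ _ (rmax * t + C)) ?lerD//.
    by rewrite ler_pM ?enorm_ge0 ?rmax_ge// ltW.
  rewrite -lerBrDl (le_trans Cc)// (@le_trans _ _ ((1 - rmax) / 2 * t))//.
    by rewrite ler_wpM2l // divr_ge0 // ltW.
  by rewrite /th; lra.
have Sc i x : enorm x <= c -> enorm (S i x) <= c.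
  by move=> xc; rewrite (le_trans (Sth _ _ _ (lexx c) xc)) // ler_piMl ?ltW.
have mono s t : s <= t -> m (Qb s) <= m (Qb t).
  by move=> st; apply: m_le => // x /le_trans; apply.
have step t : c <= t -> m (Qb (t / th)) <= m (Qb t).
  move=> ct; have := m_word [::] (measurable_Qb t).
  rewrite (_ : sw [::] @^-1` Qb t = Qb t) // => ->.
  rewrite -[leLHS]mul1r -p_sum big_distrl /=; apply: ler_sum => i _.
  rewrite ler_wpM2l ?(ltW (hp0 i))//; apply: m_le => //; first exact: measurable_sw.
  move=> x /= xt; rewrite (_ : t = th * (t / th)); last by field; rewrite gt_eqF.
  by apply: Sth => //; rewrite ler_pdivlMr // (le_trans _ ct) // ler_piMr ?ltW.
have cth n : c <= c / th ^+ n.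
  by rewrite ler_pdivlMr ?exprn_gt0// ler_piMr ?(ltW c0)// exprn_ile1 ?ltW.
have iter n : m (Qb (c / th ^+ n)) <= m (Qb c).
  elim: n => [|n IH]; first by rewrite expr0 divr1.
  by rewrite exprSr invfM mulrA (le_trans (step _ (cth n))).
have all n : m (Qb n%:R) <= m (Qb c).
  have [k hk] : exists k, th ^+ k <= c / n.+1%:R.
    by apply: expr_small; [rewrite th1 ltW|rewrite divr_gt0].
  apply: le_trans (iter k); apply: mono.
  rewrite ler_pdivlMr ?exprn_gt0// (@le_trans _ _ (n.+1%:R * th ^+ k)) //.
    by rewrite ler_wpM2r ?exprn_ge0 ?(ltW th0)// ler_nat.
  by rewrite mulrC -ler_pdivlMr.
exists c; split=> // [x Kx|].
  rewrite (le_trans (ler_enorm_sup _)) // (@le_trans _ _ (d%:R * M)) ?lerDr//.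
    by rewrite ler_wpM2l // KM.
  by rewrite divr_ge0 ?mulr_ge0 ?ltW.
apply/eqP; rewrite eq_le m_le1 /=; last exact: (measurable_Qb c).
have cv : m (Qb n%:R) @[n --> \oo] --> (1 : R).
  pose F (n : nat) : set (borelRV R d) := Qb n%:R.
  have FT : \bigcup_n F n = setT.
    apply/seteqP; split=> // x _; exists (Num.truncn (enorm x)).+1 => //=.
    by apply/ltW; rewrite truncnS_gt.
  have h : (mu \o F) x @[x --> \oo] --> mu (\bigcup_n F n).
    apply: nondecreasing_cvg_mu; first by move=> n; exact: measurable_Qb.
      by rewrite FT; exact: measurableT.
    by move=> a b ab; apply/subsetPset => x /= /le_trans; apply; rewrite ler_nat.
  rewrite FT probability_setT in h.
  by have /fine_cvgP[] := h.
rewrite -(cvg_lim _ cv) //; apply: limr_le; first by apply/cvg_ex; exists 1.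
exact: nearW.
Qed.

Definition c0 : R := projT1 (cid invariant_ball).
Definition Q : set 'rV[R]_d := [set x | enorm x <= c0].

Lemma c0_gt0 : 0 < c0.
Proof. by rewrite /c0; case: (cid _) => c []. Qed.
Local Hint Resolve c0_gt0 : core.

Lemma S_Q i x : Q x -> Q (S i x).
Proof. by rewrite /Q /c0; case: (cid _) => c /= [_ + _ _]; apply. Qed.

Lemma K_Q x : K x -> Q x.
Proof. by rewrite /Q /c0; case: (cid _) => c /= [_ _ + _]; apply. Qed.

Lemma m_Q : m Q = 1.
Proof. by rewrite /Q /c0; case: (cid _) => c []. Qed.

Lemma sw_Q w x : Q x -> Q (sw w x).
Proof. by move=> Qx; elim: w => //= i w; exact: S_Q. Qed.

Lemma Q_diam x y : Q x -> Q y -> enorm (x - y) <= 2 * c0.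
Proof.
move=> Qx Qy; rewrite (le_trans (enormD _ _)) // enormN mulr_natl mulr2n.
exact: lerD.
Qed.

Lemma measurable_Q : bmeas Q. Proof. exact: measurable_Qb. Qed.

Lemma m_disjoint_Q A : bmeas A -> (forall x, Q x -> ~ A x) -> m A = 0.
Proof.
move=> mA AQ; apply/eqP; rewrite eq_le m_ge0 andbT.
have -> : 0 = m (~` Q) by rewrite m_setC ?m_Q ?subrr//; exact: measurable_Q.
by apply: m_le => //; [apply: measurableC; exact: measurable_Q|move=> x Ax /AQ].
Qed.

Lemma m_contains_Q A : bmeas A -> Q `<=` A -> m A = 1.
Proof.
move=> mA QA; apply/eqP; rewrite eq_le m_le1 //= -m_Q m_le //.
exact: measurable_Q.
Qed.

(** * Addresses *)

Lemma K_S i x : K x -> K (S i x).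
Proof. by move=> Kx; have [_ _ ->] := hK; exists i => //; exists x. Qed.

Lemma K_sw w x : K x -> K (sw w x).
Proof. by move=> Kx; elim: w => //= i w; exact: K_S. Qed.

(** Reading on from [u] along an address of [z], the ratio eventually drops to
    [rho]; if it is already smaller at [u], the stopped word is a prefix of
    [u]. *)
Lemma stop_point rho u z : 0 < rho -> K z ->
  exists v, [/\ stop r rho v, (sw v @` K) (sw u z) & prefix u v || prefix v u].
Proof.
move=> rho0 Kz; have [n hn] : exists n, rmax ^+ n <= rho.
  by apply: expr_small => //; rewrite rmax_lt1 ltW.
have nilP rho' u' z' : 1 <= rho' -> K z' -> exists v,
    [/\ stop r rho' v, (sw v @` K) (sw u' z') & prefix u' v || prefix v u'].
  move=> rho1 Kz'; exists [::]; split=> //; last by rewrite prefix0s orbT.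
  by exists (sw u' z') => //; exact: K_sw.
elim: n rho rho0 hn u z Kz => [|n IH] rho rho0 hn u z Kz; first exact: nilP.
have [rho1|rho1] := leP 1 rho; first exact: nilP.
have rho0' i : 0 < rho / r i by exact: divr_gt0.
have hn' i : rmax ^+ n <= rho / r i.
  rewrite ler_pdivlMr // (le_trans _ hn) // exprSr ler_wpM2l ?rmax_ge//.
  by rewrite exprn_ge0 // ltW.
case: u => [|i u].
  have [_ _ KE] := hK; have := Kz; rewrite {1}KE => -[i _ [y Ky yz]].
  have [v [sv [y' Ky' yE] _]] := IH _ (rho0' i) (hn' i) [::] y Ky.
  exists (i :: v); split; rewrite /= ?rho1 ?prefix0s//.
  by exists y' => //=; rewrite yE.
have [v [sv [y Ky yE] uv]] := IH _ (rho0' i) (hn' i) u z Kz.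
exists (i :: v); split; rewrite /= ?rho1 ?eqxx//.
by exists y => //=; rewrite yE.
Qed.

(** * Counting neighbours *)

(** At the first letter where the words differ, the open set condition
    separates the images. *)
Lemma disjoint_sw (U : set 'rV[R]_d) v w : (forall i x, U x -> U (S i x)) ->
  (forall i j, i != j -> (S i @` U) `&` (S j @` U) = set0) ->
  ~~ prefix v w -> ~~ prefix w v -> forall x y, U x -> U y -> sw v x <> sw w y.
Proof.
move=> SU disj; have swU u x : U x -> U (sw u x).
  by move=> Ux; elim: u => //= i u; exact: SU.
elim: v w => [|i v IH] [|j w] //=; rewrite ?prefix0s// => vw wv x y Ux Uy.
have [ij|ij] := eqVneq i j.
  move: vw wv; rewrite ij !eqxx /= => vw wv xy; apply: (IH w vw wv x y Ux Uy).
  by apply: (@sw_inj [:: j]).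
move=> xy; have : ((S i @` U) `&` (S j @` U)) (S i (sw v x)).
  by split; [exists (sw v x)|rewrite xy; exists (sw w y)] => //; exact: swU.
by rewrite disj.
Qed.

(** Volume counting without a volume: the images of a point of the open set
    under stopped words of scale [rho] are [tau * rmin * rho] apart and lie in a
    cube of side comparable to [rho], so that cutting the cube into a grid of
    mesh [h * rho] puts them into distinct cells. *)
Lemma near_bound C : 0 <= C -> exists M : nat, forall rho x (L : seq (seq 'I_N)),
  0 < rho <= 1 -> uniq L ->
  (forall w, w \in L -> stop r rho w /\
     exists2 y, Q y & enorm (x - sw w y) <= C * rho) ->
  (size L <= M)%N.
Proof.
move=> C0; have [U [oU [u0 Uu0] _ SU disj]] := hOSC.
have SU' i x : U x -> U (S i x) by move=> Ux; apply: SU; exists i => //; exists x.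
have [tau tau0 tauU] := open_eballP oU Uu0.
pose h := tau * rmin / d.+1%:R.
have h0 : 0 < h by rewrite divr_gt0 // mulr_gt0.
pose C1 := C + (c0 + enorm u0).
have C10 : 0 <= C1 by rewrite !addr_ge0 ?enorm_ge0// ltW.
(* The number of cells along each axis. *)
pose k := (Num.truncn (2 * C1 / h)).+1.
exists (k ^ d)%N => rho x L /andP[rho0 rho1] uL nL.
pose c w := sw w u0.
have far v w : v \in L -> w \in L -> v != w ->
    tau * (rho * rmin) <= enorm (c v - c w).
  move=> vL wL vw; rewrite leNgt; apply/negP => lt.
  have [sv _] := nL v vL; have [sw' _] := nL w wL.
  have [z zE] := sw_surj v (c w).
  have Uz : U z.
    apply: tauU; rewrite -(@ltr_pM2l _ (wt r v)) // -sw_sim zE (lt_le_trans lt)//.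
    by rewrite mulrC ler_wpM2r ?(ltW tau0)// ltW // stop_gt_rmin.
  apply: (disjoint_sw SU' disj _ _ Uz Uu0 zE).
    by apply: contra vw => /(stop_prefix sv sw') /eqP.
  by apply: contra vw => /(stop_prefix sw' sv) /esym/eqP.
have close w : w \in L -> enorm (c w - x) <= C1 * rho.
  move=> wL; have [sw' [y Qy xy]] := nL w wL.
  rewrite enormB (le_trans (enorm_triangle (sw w y) _ _))// /C1 mulrDl lerD//.
  rewrite sw_sim mulrC ler_pM ?enorm_ge0 ?(ltW (wtr_gt0 _))//.
    by rewrite (le_trans (enormD _ _)) // enormN lerD2r.
  exact: stop_le.
have hrho : 0 < h * rho by exact: mulr_gt0.
pose t w (j : 'I_d) := ((c w - x) 0 j + C1 * rho) / (h * rho).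
have t0 w j : w \in L -> 0 <= t w j.
  move=> /close cw; rewrite divr_ge0 ?(ltW hrho)// -lerBlDr sub0r.
  by have := le_trans (ler_coord_enorm (c w - x) j) cw; rewrite ler_norml => /andP[].
have tk w j : w \in L -> (Num.truncn (t w j) < k)%N.
  move=> wL; rewrite ltnS; apply: le_truncn; rewrite ler_pdivrMr //.
  have -> : 2 * C1 / h * (h * rho) = 2 * C1 * rho by field; rewrite gt_eqF.
  have := le_trans (ler_coord_enorm (c w - x) j) (close w wL).
  by rewrite ler_norml => /andP[_]; lra.
pose g w : {ffun 'I_d -> 'I_k} := [ffun j => inord (Num.truncn (t w j))].
have ginj : {in L &, injective g}.
  move=> v w vL wL gvw; apply/eqP/negP => /negP vw.
  have := far _ _ vL wL vw; apply/negP; rewrite -ltNge.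
  have cj j : `|(c v - c w) 0 j| <= h * rho.
    have /(congr1 val) := congr1 (fun G : {ffun 'I_d -> 'I_k} => G j) gvw.
    rewrite !ffunE /= !inordK ?tk// => tE.
    have /andP[a1 a2] := truncn_itv (t0 _ j vL).
    have /andP[b1 b2] := truncn_itv (t0 _ j wL).
    rewrite tE in a1 a2.
    have E : (c v - c w) 0 j = (t v j - t w j) * (h * rho).
      by rewrite /t -mulrBl divfK ?gt_eqF// !mxE; ring.
    rewrite E normrM (ger0_norm (ltW hrho)) ler_piMl ?(ltW hrho)// ler_norml.
    by move: a1 a2 b1 b2; rewrite -natr1; lra.
  rewrite (le_lt_trans (ler_enorm_sup _))//.
  rewrite (@le_lt_trans _ _ (d%:R * (h * rho)))//.
    rewrite ler_wpM2l // [leLHS]/Num.norm /= mx_normrE (bigmax_le _ (ltW hrho))//.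
    by move=> [i j] _ /=; rewrite (ord1 i).
  rewrite (_ : tau * (rho * rmin) = d.+1%:R * (h * rho)); last by rewrite /h; field.
  by rewrite ltr_pM2r // ltr_nat.
rewrite -(size_map g) (_ : (k ^ d)%N = #|{ffun 'I_d -> 'I_k}|); last first.
  by rewrite card_ffun !card_ord.
have /card_uniqP <- : uniq (map g L) by rewrite map_inj_in_uniq.
exact: max_card.
Qed.

(** * Measure of balls *)

Lemma m_ball_ge x t v : (sw v @` Q) x -> 2 * c0 * wt r v <= t ->
  wt p v <= m (eball x t).
Proof.
move=> [z Qz <-] vt; apply: le_trans (m_ge_word v (measurable_eball _ _)).
rewrite m_contains_Q ?mulr1//; first by apply: measurable_sw; exact: measurable_eball.
move=> y Qy; rewrite /= /eball /closed_ball_ /= sw_sim (le_trans _ vt)// mulrC.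
by rewrite ler_wpM2r ?(ltW (wtr_gt0 _))// Q_diam.
Qed.

(** A cylinder that misses the set contributes nothing to its measure. *)
Lemma m_le_meeting A (L : seq (seq 'I_N)) : bmeas A ->
  (forall F : seq 'I_N -> R, (forall w, F w = \sum_i F (rcons w i)) ->
      F [::] = \sum_(w <- L) F w) ->
  m A <= \sum_(w <- [seq w <- L | `[< exists2 x, Q x & A (sw w x) >]]) wt p w.
Proof.
move=> mA sL; rewrite (m_stop mA sL) big_filter [leRHS]big_mkcond /=.
apply: ler_sum => w _; case: asboolP => [_|no].
  by rewrite ler_piMr ?(ltW (wtp_gt0 _))// m_le1 //; exact: measurable_sw.
rewrite m_disjoint_Q ?mulr0//; first exact: measurable_sw.
by move=> x Qx Ax; apply: no; exists x.
Qed.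

(** A ball carries at most a bounded multiple of the measure of the heaviest
    cylinder of comparable size that it meets. *)
Lemma m_ball_le k : 0 < k <= 1 -> exists2 M : R, 0 < M & forall x t, 0 < t <= 1 ->
  0 < m (eball x t) -> exists v, [/\ stop r (k * t) v,
    exists2 y, Q y & eball x t (sw v y) & m (eball x t) <= M * wt p v].
Proof.
move=> /andP[k0 k1]; have [|M hM] := @near_bound k^-1; first by rewrite invr_ge0 ltW.
exists M.+1%:R => // x t /andP[t0 t1] mt.
have kt0 : 0 < k * t by exact: mulr_gt0.
have [L [uL memL sL]] := stop_enum hr kt0.
pose L' := [seq w <- L | `[< exists2 y, Q y & eball x t (sw w y) >]].
have le : m (eball x t) <= \sum_(w <- L') wt p w.
  exact: (m_le_meeting (measurable_eball x t) sL).
have inL' w : w \in L' -> stop r (k * t) w /\ exists2 y, Q y & eball x t (sw w y).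
  by rewrite mem_filter memL => /andP[/asboolP].
have sz : (size L' <= M)%N.
  apply: (hM (k * t) x L') => [||w /inL'[sw' [y Qy xy]]].
  - by rewrite kt0 mulr_ile1 ?(ltW k0) ?(ltW t0).
  - exact: filter_uniq.
  - by split=> //; exists y => //; rewrite mulrA mulVf ?gt_eqF// mul1r.
pose P v := m (eball x t) <= M.+1%:R * wt p v.
have [/hasP[v vL Pv]|/hasPn no] := boolP (has P L').
  by exists v; have [] := inL' v vL.
suff : \sum_(w <- L') wt p w < m (eball x t) by rewrite ltNge le.
rewrite (@le_lt_trans _ _ (\sum_(w <- L') m (eball x t) / M.+1%:R))//.
  rewrite big_seq [leRHS]big_seq; apply: ler_sum => w /no; rewrite /P -ltNge => lt.
  by rewrite ler_pdivlMr // mulrC ltW.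
rewrite big_const_seq count_predT iter_addr_0 -[ltLHS]mulr_natr mulrAC ltr_pdivrMr //.
by rewrite ltr_pM2l // ltr_nat ltnS.
Qed.

(** * Comparing weights of cylinders *)

Context (amin amax : R).
Context (hmin : minimum_of (range (fun i => ln (p i) / ln (r i))) amin).
Context (hmax : maximum_of (range (fun i => ln (p i) / ln (r i))) amax).

Definition lp w : R := - ln (wt p w).
Definition lr w : R := - ln (wt r w).

Lemma ln_r_lt0 i : ln (r i) < 0. Proof. by rewrite ln_lt0 // hr. Qed.
Local Hint Resolve ln_r_lt0 : core.

Lemma amin_gt0 : 0 < amin.
Proof.
have [[i _ <-] _] := hmin; rewrite -mulrNN -invrN divr_gt0 ?oppr_gt0//.
by rewrite ln_lt0 // hp0 p_lt1.
Qed.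
Local Hint Resolve amin_gt0 : core.

Lemma amin_le_amax : amin <= amax.
Proof. by have [Am _] := hmin; have [_ /(_ _ Am)] := hmax. Qed.

Lemma amax_gt0 : 0 < amax. Proof. exact: lt_le_trans amin_le_amax. Qed.

Lemma lr_cat u v : lr (u ++ v) = lr u + lr v.
Proof. by rewrite /lr wt_cat lnM ?posrE// opprD. Qed.

Lemma lp_cat u v : lp (u ++ v) = lp u + lp v.
Proof. by rewrite /lp wt_cat lnM ?posrE// opprD. Qed.

Lemma lr_nil : lr [::] = 0. Proof. by rewrite /lr wt_nil ln1 oppr0. Qed.
Lemma lp_nil : lp [::] = 0. Proof. by rewrite /lp wt_nil ln1 oppr0. Qed.

Lemma lr_cons i w : lr (i :: w) = - ln (r i) + lr w.
Proof. by rewrite -cat1s lr_cat {1}/lr wt_cons wt_nil mulr1. Qed.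

Lemma lp_cons i w : lp (i :: w) = - ln (p i) + lp w.
Proof. by rewrite -cat1s lp_cat {1}/lp wt_cons wt_nil mulr1. Qed.

Lemma lr_ge0 w : 0 <= lr w.
Proof. by rewrite oppr_ge0 ln_le0 // wtr_le1. Qed.

Lemma lp_ge0 w : 0 <= lp w.
Proof. by rewrite oppr_ge0 ln_le0 // wtp_le1. Qed.

Lemma lpi_bounds i : amin * - ln (r i) <= - ln (p i) <= amax * - ln (r i).
Proof.
have [_ /(_ (ln (p i) / ln (r i)))] := hmin.
have [_ /(_ (ln (p i) / ln (r i)))] := hmax.
move=> /(_ (ex_intro2 _ _ i I erefl)) h1 /(_ (ex_intro2 _ _ i I erefl)) h2.
have -> : - ln (p i) = (ln (p i) / ln (r i)) * - ln (r i).
  by rewrite mulrN divfK // lt_eqF.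
have l0 : 0 <= - ln (r i) by rewrite oppr_ge0 ltW.
by rewrite !ler_wpM2r.
Qed.

Lemma lp_bounds w : amin * lr w <= lp w <= amax * lr w.
Proof.
elim: w => [|i w /andP[h1 h2]]; first by rewrite lr_nil lp_nil !mulr0 lexx.
have /andP[k1 k2] := lpi_bounds i.
by rewrite lr_cons lp_cons !mulrDr !lerD.
Qed.

Lemma wtpE w : wt p w = expR (- lp w). Proof. by rewrite opprK lnK ?posrE. Qed.

(** * The measure has no atom *)

Lemma stop_lr rho w : 0 < rho -> stop r rho w -> - ln rho <= lr w.
Proof. by move=> rho0 /(stop_le r_gt0); rewrite lerN2 => h; rewrite ler_ln ?posrE. Qed.

Lemma measurable_set1 x : bmeas [set x].
Proof.
rewrite (_ : [set x] = eball x 0); first exact: measurable_eball.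
apply/seteqP; split=> y /=; first by move=> ->; rewrite /eball /closed_ball_ /= subrr enorm0.
rewrite /eball /closed_ball_ /= => xy; apply/eqP; rewrite eq_sym -subr_eq0.
by apply/eqP/enorm_eq0/le_anti; rewrite xy enorm_ge0.
Qed.

(** A ball of radius [expR (- s)] has at most [M] times the weight of a cylinder
    of comparable size, which decays like [expR (- (amin * s))]. *)
Lemma m_set1 x : m [set x] = 0.
Proof.
apply/eqP; rewrite eq_le m_ge0 andbT leNgt; apply/negP => e0.
have [|M M0 hM] := @m_ball_le 1; first by rewrite ltr01 lexx.
pose e := m [set x]; pose s := `|ln (M / e)| / amin + 1.
have s0 : 0 < s by rewrite ltr_wpDl // divr_ge0 // ltW.
have t01 : 0 < expR (- s) <= 1 by rewrite expR_gt0 expR_le1 oppr_le0 ltW.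
have xt : [set x] `<=` eball x (expR (- s)).
  by move=> y /= ->; rewrite /eball /closed_ball_ /= subrr enorm0 expR_ge0.
have le := m_le (measurable_set1 x) (measurable_eball x (expR (- s))) xt.
have [v [sv _ mv]] := hM x _ t01 (lt_le_trans e0 le).
rewrite mul1r in sv; have := stop_lr (expR_gt0 _) sv; rewrite expRK opprK => sl.
have : e <= M * expR (- (amin * s)).
  apply: (le_trans le); apply: (le_trans mv); rewrite ler_wpM2l ?(ltW M0)//.
  rewrite wtpE ler_expR lerN2; have /andP[+ _] := lp_bounds v; apply: le_trans.
  by rewrite ler_wpM2l // ltW.
rewrite -ler_pdivrMl // -(@lnK _ (M^-1 * e)) ?posrE ?mulr_gt0 ?invr_gt0//.
rewrite ler_expR leNgt => /negP; apply.
have -> : ln (M^-1 * e) = - ln (M / e).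
  by rewrite -lnV ?posrE ?divr_gt0// invfM invrK.
rewrite ltrN2 /s mulrDr mulr1 (mulrC amin) divfK ?gt_eqF//.
by rewrite (le_lt_trans (ler_norm _)) // ltrDl.
Qed.

(** * Spheres are null *)

Local Notation n := (1 + d + 1)%N.

(** In the coordinates [1], [y_j], [|y|^2] spheres and hyperplanes become linear
    hyperplanes and similarities become linear maps, so that one induction over
    linear systems handles all the intersections of spheres. *)
Definition lift_pt (y : 'rV[R]_d) : 'cV[R]_n :=
  (row_mx (row_mx (1%:M : 'M[R]_1) y) ((dot y y)%:M : 'M[R]_1))^T.

Definition Z k (B : 'M[R]_(k, n)) : set 'rV[R]_d := [set y | B *m lift_pt y = 0].

Lemma Z_sub k l (B : 'M[R]_(k, n)) (C : 'M[R]_(l, n)) :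
  (B <= C)%MS -> Z C `<=` Z B.
Proof. by move=> /submxP[D ->] y; rewrite /Z /= -mulmxA => ->; rewrite mulmx0. Qed.

Lemma Z_adds k l (B : 'M[R]_(k, n)) (C : 'M[R]_(l, n)) :
  Z B `&` Z C `<=` Z (B + C)%MS.
Proof.
move=> y [By Cy]; apply: (@Z_sub _ _ _ (col_mx B C)); first by rewrite addsmxE.
by rewrite /Z /= mul_col_mx By Cy col_mx0.
Qed.

Lemma measurable_Z k (B : 'M[R]_(k, n)) : bmeas (Z B).
Proof.
pose g i (y : 'rV[R]_d) : R := (B *m lift_pt y) i 0.
have cl j : continuous (fun y => lift_pt y j 0 : R).
  have -> : (fun y => lift_pt y j 0) = match fintype.split j with
      | inl j' => match fintype.split j' with
                  | inl k => cst ((1%:M : 'M[R]_1) 0 k) | inr k => fun y => y 0 k end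
      | inr _ => fun y => dot y y end.
    apply/funext => y; rewrite /lift_pt mxE mxE; case: (fintype.split j) => j'.
      by rewrite mxE; case: (fintype.split j').
    by rewrite mxE (ord1 j') eqxx mulr1n.
  case: (fintype.split j) => [j'|_].
    by case: (fintype.split j') => k'; [exact: cst_continuous|exact: coord_continuous].
  by apply: continuous_sumr => l y; exact: (continuousM (@coord_continuous _ _ _ _ _ y) (@coord_continuous _ _ _ _ _ y)).
have cg i : continuous (g i).
  rewrite (_ : g i = fun y => \sum_j B i j * lift_pt y j 0); last first.
    by apply/funext => y; rewrite /g mxE.
  apply: continuous_sumr => j y.
  exact: (continuousM (@cst_continuous _ _ (B i j : R) y) (cl j y)).
have -> : Z B = \bigcap_(i in setT) (g i @^-1` [set 0]).
  apply/seteqP; split => y /=; first by move=> By i _; rewrite /g /= By mxE.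
  by move=> gy; apply/colP => i; rewrite [RHS]mxE; exact: gy.
rewrite -[X in measurable X]setCK; apply: measurableC; apply: sub_sigma_algebra.
apply: closed_openC.
have cz i : closed (g i @^-1` [set 0]).
  by apply: preimage_closed; [move=> y _; exact: cg|exact: closed_eq].
exact: closed_bigI (fun i _ => cz i).
Qed.

Lemma similarity_lift c f : 0 < c -> similarity c f ->
  exists2 T : 'M[R]_n, T \in unitmx & forall y, lift_pt (f y) = T *m lift_pt y.
Proof.
move=> c0 fS; have [A [b [uA fE]]] := similarity_affine c0 fS.
have dotA y : dot (y *m A) (y *m A) = c ^+ 2 * dot y y.
  have f0 : f 0 = b by rewrite fE mul0mx add0r.
  have -> : y *m A = f y - f 0 by rewrite f0 fE addrK.
  by rewrite -!sqr_enorm fS subr0 exprMn.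
have dotM (x y : 'rV[R]_d) : x *m y^T = (dot x y)%:M.
  apply/matrixP => i j; rewrite !ord1 !mxE eqxx mulr1n.
  by apply: eq_bigr => k _; rewrite mxE.
pose T : 'M[R]_n := block_mx (block_mx (1%:M : 'M[R]_1) b 0 A)
  (col_mx ((dot b b)%:M : 'M[R]_1) (2 *: (A *m b^T))) 0 ((c ^+ 2)%:M : 'M[R]_1).
have uT : T \in unitmx.
  rewrite unitmxE det_ublock det_ublock !det_scalar !expr1 mul1r unitrM.
  by rewrite -unitmxE uA unitfE gt_eqF // exprn_gt0.
exists T^T; first by rewrite unitmx_tr.
move=> y; rewrite /lift_pt -trmx_mul; congr (_^T).
rewrite /T mul_row_block mul_row_block !mulmx0 !addr0 !mul_row_col !mul1mx.
congr (row_mx (row_mx _ _) _).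
  by rewrite fE addrC.
rewrite -scalemxAr mulmxA dotM -scalar_mxM; apply/matrixP => i j.
rewrite !ord1 !mxE eqxx !mulr1n.
rewrite fE !(dotDl, dotDr) dotA (dotC b); ring.
Qed.

Lemma m_setU_null A B : bmeas A -> bmeas B -> m A = 0 -> m B = 0 ->
  m (A `|` B) = 0.
Proof.
move=> mA mB A0 B0; rewrite m_setU0 ?A0 ?B0 ?addr0//.
apply/eqP; rewrite eq_le m_ge0 andbT -A0 m_le //; exact: measurableI.
Qed.

Lemma m_almost_disjoint (F : nat -> set 'rV[R]_d) k :
  (forall j, bmeas (F j)) ->
  (forall i j, (i < j < k)%N -> m (F i `&` F j) = 0) ->
  \sum_(j < k) m (F j) <= 1.
Proof.
move=> mF dF; pose G l := \big[setU/set0]_(j < l) F j.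
have mG l : bmeas (G l) by apply: bigsetU_measurable => j _; exact: mF.
have GF l j : (l <= j < k)%N -> m (G l `&` F j) = 0.
  elim: l => [|l IH] /andP[lj jk].
    by rewrite /G big_ord0 set0I /m measure0.
  rewrite /G big_ord_recr /= -/(G l) setIUl m_setU_null //; try exact: measurableI.
    by apply: IH; rewrite jk ltnW.
  by apply: dF; rewrite jk lj.
suff <- : m (G k) = \sum_(j < k) m (F j) by exact: m_le1.
have : (k <= k)%N by []; elim: {-2}k => [|l IH] lk.
  by rewrite /G !big_ord0 /m measure0.
rewrite /G !big_ord_recr /= m_setU0 -/(G l) ?IH ?(ltnW lk)//.
by apply: GF; rewrite lk leqnn.
Qed.

Definition ebounded A := exists M, forall x, A x -> enorm x <= M.

Lemma ebounded_sw w A : ebounded A -> ebounded (sw w @^-1` A).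
Proof.
move=> [M hM]; exists ((M + enorm (sw w 0)) / wt r w) => x /hM h.
rewrite ler_pdivlMr // mulrC -{1}[x]subr0 -sw_sim.
by rewrite (le_trans (enormD _ _))// enormN lerD2r.
Qed.

(** Two points of the set can be pulled back along the contraction any number of
    times within the bounded set, and each time their distance grows by the
    same factor. *)
Lemma invariant_subsingleton w A x y : (0 < size w)%N -> ebounded A ->
  (forall z, A z <-> A (sw w z)) -> A x -> A y -> x = y.
Proof.
move=> w0 [M hM] inv; have wr1 : wt r w < 1.
  by rewrite (le_lt_trans (wtr_le_exp w))// exprn_ilt1 ?ltW// -lt0n.
have main k z t : A z -> A t -> enorm (z - t) <= wt r w ^+ k * (2 * M).
  elim: k z t => [|k IH] z t Az At.
    rewrite expr0 mul1r (le_trans (enormD _ _))// enormN mulr_natl mulr2n.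
    by rewrite lerD ?hM.
  have [z' zE] := sw_surj w z; have [t' tE] := sw_surj w t.
  rewrite -zE -tE sw_sim exprS -mulrA ler_wpM2l ?(ltW (wtr_gt0 _))//.
  by apply: IH; apply/inv; rewrite ?zE ?tE.
move=> Ax Ay; apply/eqP; rewrite -subr_eq0; apply/eqP/enorm_eq0/eqP.
rewrite eq_le enorm_ge0 andbT leNgt; apply/negP => e0.
have M0 : 0 < 2 * M.
  by have := lt_le_trans e0 (main 0 x y Ax Ay); rewrite expr0 mul1r.
have [k hk] : exists k, wt r w ^+ k <= enorm (x - y) / (2 * (2 * M)).
  by apply: expr_small; rewrite ?wr1 ?(ltW (wtr_gt0 _))// divr_gt0 // mulr_gt0.
have := main k x y Ax Ay; rewrite leNgt => /negP; apply.
rewrite (@le_lt_trans _ _ (enorm (x - y) / (2 * (2 * M)) * (2 * M)))//.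
  by rewrite ler_wpM2r // ltW.
move: M0 e0; move: (2 * M) (enorm _) => W e W0 e0.
by rewrite invfM mulrA divfK ?gt_eqF// ltr_pdivrMr //; lra.
Qed.

(** Induction on the codimension of the linear system [B]. Among systems of a
    given rank, two with different row spaces have almost disjoint zero sets by
    induction, so only finitely many zero sets can have almost the largest
    measure; but pulling back by a similarity preserves the rank and nearly
    preserves an almost largest measure. Hence some zero set is invariant under
    a contraction, and being bounded it is a point. *)
Lemma m_Z_null (B : 'M[R]_n) : ebounded (Z B) -> m (Z B) = 0.
Proof.
have i0 : 'I_N by case: N hN => // k _; exact: ord0.
have exT i : exists T : 'M[R]_n, T \in unitmx /\
    forall y, lift_pt (S i y) = T *m lift_pt y.
  by have [T uT TE] := similarity_lift (r_gt0 i) (hS i); exists T.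
have [T hT] := choice exT.
have ZT i C : Z (C *m T i) = S i @^-1` Z C.
  by apply/seteqP; split=> y; have [_ TE] := hT i; rewrite /Z /= TE mulmxA.
have rT i (C : 'M[R]_n) : \rank (C *m T i) = \rank C.
  by apply: mxrankMfree; rewrite row_free_unit; have [] := hT i.
have bT i C : ebounded (Z C) -> ebounded (Z (C *m T i)).
  by move=> /(@ebounded_sw [:: i]); rewrite ZT.
have [c] := ubnP (n - \rank B); elim: c B => // c IH B lt bB.
apply/eqP; rewrite eq_le m_ge0 andbT leNgt; apply/negP => B0.
pose k := \rank B.
pose E := [set e | exists C : 'M[R]_n, [/\ \rank C = k, ebounded (Z C) & e = m (Z C)]].
have Eub : has_ubound E by exists 1 => _ [C [_ _ ->]]; apply: m_le1; exact: measurable_Z.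
have Esup : has_sup E by split=> //; exists (m (Z B)), B.
pose s := sup E.
have Es (C : 'M[R]_n) : \rank C = k -> ebounded (Z C) -> m (Z C) <= s.
  by move=> kC bC; apply: ub_le_sup => //; exists C.
have s0 : 0 < s by rewrite (lt_le_trans B0) // Es.
have [l hl] : exists l : nat, 1 < l%:R * (s / 2).
  exists (Num.truncn (2 / s)).+1; rewrite mulrA ltr_pdivlMr // mul1r -ltr_pdivrMr //.
  exact: truncnS_gt.
pose q := p i0.
have q0 : 0 < q by exact: hp0.
have e0 : 0 < q ^+ l * (s / 2) by rewrite mulr_gt0 ?exprn_gt0 ?divr_gt0.
have [_ [C [kC bC ->]]] := sup_adherent e0 Esup.
rewrite -/s => hC.
pose P j := iter j (fun D : 'M[R]_n => D *m T i0) C.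
have PS j : P j.+1 = P j *m T i0 by [].
have kP j : \rank (P j) = k by elim: j => // j; rewrite PS rT.
have bP j : ebounded (Z (P j)) by elim: j => // j /bT; apply.
have ZP j e : Z (P (e + j)%N) = sw (nseq e i0) @^-1` Z (P j).
  elim: e => // e IHe; have -> : P (e.+1 + j)%N = P (e + j)%N *m T i0 by [].
  have nE : nseq e.+1 i0 = nseq e i0 ++ [:: i0] by rewrite -(nseqD e 1) addn1.
  rewrite ZT IHe nE; apply/seteqP.
  by split=> y; rewrite /preimage /= sw_cat.
have sP j : (s - m (Z (P j))) * q ^+ j <= s - m (Z C).
  elim: j => [|j IHj]; first by rewrite expr0 mulr1.
  apply: le_trans IHj; rewrite exprS mulrA ler_wpM2r ?exprn_ge0 ?(ltW q0)//.
  have := m_word [::] (measurable_Z (P j)).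
  rewrite (bigD1 i0) //= (_ : sw [::] @^-1` _ = Z (P j)) // => ->.
  rewrite (_ : sw _ @^-1` _ = Z (P j.+1)); last by rewrite PS ZT.
  suff : \sum_(i < N | i != i0) p i * m (sw [:: i] @^-1` Z (P j)) <= (1 - q) * s.
    by rewrite -/q; lra.
  have -> : 1 - q = \sum_(i < N | i != i0) p i.
    by rewrite -p_sum (bigD1 i0) //= addrAC subrr add0r.
  rewrite big_distrl /=; apply: ler_sum => i _; rewrite ler_wpM2l ?(ltW (hp0 i))//.
  rewrite (_ : sw _ @^-1` _ = Z (P j *m T i)); last by rewrite ZT.
  by apply: Es; [rewrite rT|exact: bT].
have half j : (j < l)%N -> s / 2 <= m (Z (P j)).
  move=> jl; have := le_trans (sP j) (ltW (_ : s - m (Z C) < q ^+ l * (s / 2))).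
  have lt' : s - m (Z C) < q ^+ l * (s / 2) by move: hC; lra.
  move=> /(_ lt'); rewrite (_ : q ^+ l = q ^+ (l - j) * q ^+ j); last first.
    by rewrite -exprD subnK // ltnW.
  rewrite mulrAC ler_pM2r ?exprn_gt0// => h.
  have : q ^+ (l - j) * (s / 2) <= s / 2.
    rewrite ler_piMl ?(ltW (divr_gt0 s0 _))// exprn_ile1 ?(ltW q0)//.
    by rewrite ltW // p_lt1.
  lra.
suff : \sum_(j < l) m (Z (P j)) <= 1.
  rewrite leNgt => /negP; apply; apply: (lt_le_trans hl).
  rewrite mulr_natl -[X in _ *+ X](card_ord l) -sumr_const.
  by apply: ler_sum => j _; exact: half.
apply: (@m_almost_disjoint (fun j => Z (P j))) => [j|i j /andP[ij jl]].
  exact: measurable_Z.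
have mI : bmeas (Z (P i) `&` Z (P j)) by apply: measurableI; exact: measurable_Z.
have sub : ebounded (Z (P i + P j)%MS).
  have [M hM] := bP i; exists M => x /(@Z_sub _ _ (P i)) h; apply: hM; apply: h.
  exact: addsmxSl.
have [eqk|nek] := eqVneq (\rank (P i + P j)%MS) k; last first.
  apply/eqP; rewrite eq_le m_ge0 andbT.
  rewrite (le_trans (m_le mI (measurable_Z _) (@Z_adds _ _ _ _))) //.
  rewrite IH //.
  have : (k < \rank (P i + P j)%MS)%N.
    by rewrite ltn_neqAle eq_sym nek -(kP i) mxrankS // addsmxSl.
  move: lt (rank_leq_row (P i + P j)%MS); rewrite -/k; lia.
have PiPj : Z (P i) = Z (P j).
  have h1 : (P i + P j <= P i)%MS.
    by rewrite -(mxrank_leqif_sup (addsmxSl (P i) (P j))) eqk kP.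
  have h2 : (P i + P j <= P j)%MS.
    by rewrite -(mxrank_leqif_sup (addsmxSr (P i) (P j))) eqk kP.
  apply/seteqP; split; apply: Z_sub.
    by rewrite (submx_trans _ h1) // addsmxSr.
  by rewrite (submx_trans _ h2) // addsmxSl.
have [x Zx] : Z (P i) !=set0.
  apply/set0P/eqP => Z0; have := half i (ltn_trans ij jl).
  by rewrite Z0 /m measure0 leNgt divr_gt0.
have : m (Z (P i)) <= m [set x].
  apply: m_le; [exact: measurable_Z|exact: measurable_set1|].
  move=> y Zy /=; apply: (@invariant_subsingleton (nseq (j - i) i0) (Z (P i))) => //.
    by rewrite size_nseq subn_gt0.
  move=> z; have := ZP i (j - i)%N; rewrite subnK ?(ltnW ij)// -PiPj => ZE.
  have E2 := congr1 (fun A : set _ => A z) ZE.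
  by split; [rewrite {1}E2|move=> h; rewrite E2].
by rewrite m_set1 leNgt (lt_le_trans _ (half i (ltn_trans ij jl))) // divr_gt0.
Qed.

(** A sphere is cut out by one linear equation in the lifted coordinates. *)
Lemma m_sphere x t : m [set y | enorm (x - y) = t] = 0.
Proof.
have [t0|t0] := leP 0 t; last first.
  rewrite (_ : [set _ | _] = set0) ?/m ?measure0//; apply/seteqP; split=> // y /= xy.
  by move: t0; rewrite -xy ltNge enorm_ge0.
pose L : 'rV[R]_n := row_mx (row_mx ((dot x x - t ^+ 2)%:M : 'M[R]_1) (- 2 *: x)) (1%:M : 'M[R]_1).
have LE y : L *m lift_pt y = (enorm (x - y) ^+ 2 - t ^+ 2)%:M.
  rewrite /lift_pt !tr_row_mx !mul_row_col trmx1 tr_scalar_mx mulmx1 mul1mx.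
  apply/matrixP => i j; rewrite !ord1 !mxE eqxx !mulr1n.
  rewrite (_ : \sum_j0 _ = - 2 * dot x y); last first.
    by rewrite /dot big_distrr; apply: eq_bigr => k _; rewrite !mxE -mulrA.
  by rewrite sqr_enorm !(dotDl, dotDr, dotNl, dotNr) (dotC y x); ring.
have ZL : Z L = [set y | enorm (x - y) = t].
  apply/seteqP; split=> y; rewrite /Z /= LE.
    move=> /(congr1 (fun A : 'M[R]_1 => A 0 0)); rewrite !mxE eqxx mulr1n => /eqP.
    by rewrite subr_eq0 eqrXn2 ?enorm_ge0// => /eqP.
  by move=> ->; rewrite subrr; apply/matrixP => i j; rewrite !mxE mul0rn.
have ZgL : Z <<L>>%MS = Z L by apply/seteqP; split; apply: Z_sub; rewrite genmxE.
rewrite -ZL -ZgL m_Z_null // ZgL ZL; exists (enorm x + t) => y /= xy.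
by rewrite -[y](subKr x) (le_trans (enormD _ _)) // enormN xy.
Qed.

Lemma m_setD A B : bmeas A -> bmeas B -> B `<=` A -> m (A `\` B) = m A - m B.
Proof.
move=> mA mB BA; apply/eqP; rewrite eq_sym subr_eq; apply/eqP.
rewrite -{1}(setDUK BA) setUC m_setU0 //; first exact: measurableD.
by rewrite setDKI /m measure0.
Qed.

(** The shells between the radii [t0 - h] and [t0 + h] decrease to a sphere,
    which is null. *)
Lemma m_ball_continuous x t0 e : 0 < e -> exists2 del, 0 < del &
  forall t, `|t - t0| <= del -> `|m (eball x t) - m (eball x t0)| <= e.
Proof.
move=> e0; pose h (k : nat) : R := k.+1%:R^-1.
have h0 k : 0 < h k by rewrite invr_gt0.
pose A k : set (borelRV R d) := eball x (t0 + h k) `\` eball x (t0 - h k).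
have mono s t : s <= t -> eball x s `<=` eball x t by move=> st y /le_trans; apply.
have mA k : measurable (A k) by apply: measurableD; exact: measurable_eball.
have AI : \bigcap_k A k = [set y | enorm (x - y) = t0].
  apply/seteqP; split=> [y Ay|y /= yt k _]; last first.
    rewrite /A; split; rewrite /eball /closed_ball_ /= yt; first by rewrite lerDl ltW.
    by apply/negP; rewrite -ltNge ltrBlDr ltrDl.
  have close k : `|enorm (x - y) - t0| <= h k.
    have [] := Ay k I; rewrite /eball /closed_ball_ /= => a /negP; rewrite -ltNge => b.
    by rewrite ler_norml; apply/andP; split; lra.
  apply/eqP; rewrite -subr_eq0 -normr_le0 leNgt; apply/negP => p0.
  have := close (Num.truncn (`|enorm (x - y) - t0|^-1)).
  rewrite leNgt => /negP; apply; rewrite /h -[ltRHS]invrK ltf_pV2 ?posrE ?invr_gt0//.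
  exact: truncnS_gt.
have cv : (mu \o A) k @[k --> \oo] --> mu (\bigcap_k A k).
  apply: nonincreasing_cvg_mu => //.
  - by rewrite -ge0_fin_numE // fin_num_measure.
  - by apply: bigcap_measurable => // k _; exact: mA.
  - move=> k l kl; apply/subsetPset => y [a b]; split.
      by apply: mono a; rewrite lerD2l lef_pV2 ?posrE// ler_nat.
    by move=> c; apply: b; apply: mono c; rewrite lerD2l lerN2 lef_pV2 ?posrE// ler_nat.
have muI : mu (\bigcap_k A k) = 0%E.
  by rewrite AI mE ?m_sphere// -AI; apply: bigcap_measurable => // k _; exact: mA.
rewrite muI in cv; have /fine_cvgP[_ /cvgrPdist_le /(_ _ e0) [k _ /(_ k (leqnn k))]] := cv.
rewrite /= sub0r normrN => hk.
exists (h k) => // t; rewrite ler_norml => /andP[a b].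
have : m (A k) <= e by rewrite (le_trans (ler_norm _)).
rewrite m_setD; try exact: measurable_eball; last by apply: mono; have := h0 k; lra.
have h1 : m (eball x t) <= m (eball x (t0 + h k)).
  by apply: m_le; try exact: measurable_eball; apply: mono; lra.
have h2 : m (eball x (t0 - h k)) <= m (eball x t).
  by apply: m_le; try exact: measurable_eball; apply: mono; lra.
have h3 : m (eball x t0) <= m (eball x (t0 + h k)).
  by apply: m_le; try exact: measurable_eball; apply: mono; have := h0 k; lra.
have h4 : m (eball x (t0 - h k)) <= m (eball x t0).
  by apply: m_le; try exact: measurable_eball; apply: mono; have := h0 k; lra.
by rewrite ler_norml => ?; apply/andP; split; lra.
Qed.

(** * Local dimensions *)

Definition k0 : R := (1 + 2 * c0)^-1.

Lemma k0_gt0 : 0 < k0. Proof. by rewrite invr_gt0 ltr_wpDr // mulr_ge0 // ltW. Qed.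
Lemma k0_le1 : k0 <= 1.
Proof. by rewrite invf_le1 ?lerDl ?mulr_ge0 ?(ltW c0_gt0)// ltr_wpDr // mulr_ge0 // ltW. Qed.
Lemma k0_c0 : 2 * c0 * k0 <= 1.
Proof.
have h : 0 < 1 + 2 * c0 by rewrite ltr_wpDr // mulr_ge0 // ltW.
by rewrite ler_pdivrMr // mul1r lerDr.
Qed.
Local Hint Resolve k0_gt0 k0_le1 : core.

(** [k0] is chosen so that a stopped cylinder of scale [k0 * t] lies in the ball
    of radius [t] around each of its points. *)
Lemma m_ball_ge_stop x t v : stop r (k0 * t) v -> 0 <= t -> (sw v @` Q) x ->
  wt p v <= m (eball x t).
Proof.
move=> sv t0 xv; apply: m_ball_ge => //.
rewrite (@le_trans _ _ (2 * c0 * (k0 * t)))//.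
  by rewrite ler_wpM2l ?mulr_ge0 ?(ltW c0_gt0)//; exact: stop_le sv.
by rewrite mulrA ler_piMl // k0_c0.
Qed.

Lemma image_sub_Q v x : (sw v @` K) x -> (sw v @` Q) x.
Proof. by move=> [z Kz <-]; exists z => //; exact: K_Q. Qed.

Lemma m_ball_gt0 x t : K x -> 0 < t -> 0 < m (eball x t).
Proof.
move=> Kx t0; have kt0 : 0 < k0 * t by exact: mulr_gt0.
have [v [sv xv _]] := stop_point [::] kt0 Kx.
by apply: (lt_le_trans (wtp_gt0 v)); apply: m_ball_ge_stop sv (ltW t0) (image_sub_Q xv).
Qed.

(** The ball contains a cylinder and is controlled by another one, both of
    comparable size; their weights lie between powers [amax] and [amin] of
    their ratios. *)
Lemma ln_m_bounds : exists2 C, 0 <= C & forall x t, K x -> 0 < t <= 1 ->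
  amin * - ln t - C <= - ln (m (eball x t)) <= amax * - ln t + C.
Proof.
have [|M M0 hM] := @m_ball_le 1; first by rewrite ltr01 lexx.
pose C1 := amax * (- ln k0 - ln rmin).
have C10 : 0 <= C1.
  by rewrite mulr_ge0 ?(ltW amax_gt0)// addr_ge0 // oppr_ge0 ln_le0 // ltW.
exists (C1 + `|ln M|); first by rewrite addr_ge0.
move=> x t Kx t01; have /andP[t0 t1] := t01; have mt := m_ball_gt0 Kx t0; apply/andP; split.
  have [v [sv _ mv]] := hM x t t01 mt; rewrite mul1r in sv.
  have sl := stop_lr t0 sv; have /andP[pl _] := lp_bounds v.
  have : ln (m (eball x t)) <= ln M + ln (wt p v).
    by rewrite -lnM ?posrE// ler_ln ?posrE// mulr_gt0.
  have := ler_norm (ln M); have : amin * - ln t <= amin * lr v by rewrite ler_wpM2l // ltW.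
  by rewrite /lp in pl *; lra.
have kt0 : 0 < k0 * t by exact: mulr_gt0.
have [v [sv xv _]] := stop_point [::] kt0 Kx.
have mv := m_ball_ge_stop sv (ltW t0) (image_sub_Q xv).
have kt1 : k0 * t <= 1 by rewrite mulr_ile1 // ltW.
have sg := stop_gt_rmin kt1 sv; have /andP[_ pl] := lp_bounds v.
have : ln (wt p v) <= ln (m (eball x t)) by rewrite ler_ln ?posrE.
have : lr v <= - ln k0 - ln t - ln rmin.
  rewrite /lr lerNl !opprB opprK.
  have -> : ln rmin + (ln t + ln k0) = ln (k0 * t * rmin).
    by rewrite !lnM ?posrE ?mulr_gt0//; ring.
  by rewrite ler_ln ?posrE ?mulr_gt0// ltW.
move=> /(ler_wpM2l (ltW amax_gt0)); have := normr_ge0 (ln M).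
by rewrite /lp /C1 in pl *; lra.
Qed.

Local Notation D x t := (Dr mu t x).

Lemma DE x t : D x t = - ln (m (eball x t)) / - ln t.
Proof. by rewrite /Dr invrN mulrNN. Qed.

(** Near scale [0] the constants in [ln_m_bounds] become negligible. *)
Lemma D_bounds e : 0 < e -> exists2 del, 0 < del <= 1 & forall x t, K x ->
  0 < t < del -> amin - e <= D x t <= amax + e.
Proof.
move=> e0; have [C C0 hC] := ln_m_bounds; pose del := expR (- (C / e + 1)).
have Ce : 0 <= C / e by rewrite divr_ge0 // ltW.
have d1 : del <= 1 by rewrite expR_le1; lra.
exists del; first by rewrite expR_gt0.
move=> x t Kx /andP[t0 td]; have t1 : t < 1 by exact: lt_le_trans d1.
have lt0 : C / e + 1 < - ln t.
  by rewrite -[ltLHS]opprK ltrN2 -(expRK (- _)) ltr_ln ?posrE ?expR_gt0.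
have ht0 : 0 < - ln t by lra.
have Ct : C <= e * - ln t.
  by rewrite mulrC -ler_pdivrMr //; lra.
have := hC x t Kx; rewrite t0 (ltW t1) => /(_ isT) /andP[h1 h2].
rewrite DE ler_pdivlMr // ler_pdivrMr //; apply/andP; split; lra.
Qed.

Lemma D_continuous x t : K x -> 0 < t < 1 -> {for t, continuous (fun t => D x t)}.
Proof.
move=> Kx /andP[t0 t1]; have mt := m_ball_gt0 Kx t0.
have cm : {for t, continuous (fun t => m (eball x t))}.
  apply/cvgrPdist_le => e e0; have [del del0 h] := m_ball_continuous x t e0.
  apply/nbhs_ballP; exists del => //= s; rewrite /ball /= => ts.
  by rewrite distrC; apply: h; rewrite distrC ltW.
have cl : {for t, continuous (fun t => ln (m (eball x t)))}.
  apply: (@continuous_comp _ _ _ (fun t => m (eball x t)) (@ln R)) => //.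
  exact: continuous_ln.
apply: cvgM; first exact: cl.
by apply: cvgV; [rewrite lt_eqF // ln_lt0 // t0|exact: continuous_ln].
Qed.

Lemma near_inv (e : R) : 0 < e -> \forall k \near \oo, k.+1%:R^-1 < e.
Proof.
move=> e0; exists (Num.truncn e^-1) => // k /= ke.
rewrite -[ltRHS]invrK ltf_pV2 ?posrE ?invr_gt0//.
by rewrite (lt_le_trans (truncnS_gt _)) // ler_nat ltnS.
Qed.

(** If the quotient comes close to [y] at arbitrarily small scales, radii can be
    chosen recursively, each at most the previous one. *)
Lemma accP x (y : R) : accumulation_points mu x y <-> 0 < y /\
  forall e del, 0 < e -> 0 < del -> exists2 t, 0 < t < del & `|D x t - y| < e.
Proof.
split=> [[y0 [rk [rk0 _ rk_cv D_cv]]]|[y0 h]]; split=> //.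
  move=> e del e0 del0.
  have /cvgrPdist_lt /(_ _ e0) [k1 _ h1] := D_cv.
  have /cvgrPdist_lt /(_ _ del0) [k2 _ h2] := rk_cv.
  exists (rk (maxn k1 k2)).
    rewrite rk0 /=; have := h2 _ (leq_maxr k1 k2); rewrite /= sub0r normrN.
    by rewrite gtr0_norm.
  by rewrite distrC; exact: h1 _ (leq_maxl k1 k2).
pose P (z : R * nat) t := 0 < z.1 ->
  [/\ 0 < t, t <= z.1, t <= z.2.+1%:R^-1 & `|D x t - y| < z.2.+1%:R^-1].
have exP zk : exists t, P zk t.
  case: zk => s k; rewrite /P /=; have [s0|] := boolP (0 < s); last by exists 0.
  have [||t /andP[t0 ts] ty] := h k.+1%:R^-1 (Num.min s k.+1%:R^-1).
  - by rewrite invr_gt0.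
  - by rewrite lt_min s0 invr_gt0 ltr0n.
  exists t => _; rewrite t0; move: ts; rewrite lt_min => /andP[/ltW ts /ltW tk].
  by split.
have [T hT] := choice exP.
pose rk := fix rk k := if k is k'.+1 then T (rk k', k) else T (1, 0%N).
have rkP k : [/\ 0 < rk k, rk k <= k.+1%:R^-1 & `|D x (rk k) - y| < k.+1%:R^-1].
  elim: k => [|k [IH _ _]]; first by have [//|? ? ? ?] := hT (1, 0%N); split.
  by have [//|? ? ? ?] := hT (rk k, k.+1); split.
exists rk; split.
- by move=> k; have [] := rkP k.
- apply/nonincreasing_seqP => k; have [rk0 _ _] := rkP k.
  by have [] := hT (rk k, k.+1) rk0.
- apply/cvgrPdist_le => e e0; near=> k; rewrite sub0r normrN.
  have [rk0 rkk _] := rkP k; rewrite gtr0_norm // (le_trans rkk) //.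
  by apply/ltW; near: k; exact: near_inv.
- apply/cvgrPdist_le => e e0; near=> k; rewrite distrC.
  have [_ _ rkk] := rkP k; rewrite (le_trans (ltW rkk)) //.
  by apply/ltW; near: k; exact: near_inv.
Unshelve. all: by end_near. Qed.

(** Bolzano-Weierstrass: at small scales the quotients stay in the compact
    interval that [D_bounds] provides. *)
Lemma acc_closed x (C : set R) : K x -> closed C ->
  (forall del, 0 < del -> exists2 t, 0 < t < del & C (D x t)) ->
  exists2 y, C y & accumulation_points mu x y.
Proof.
move=> Kx cC h; have [|e e0 hD] := @D_bounds (amin / 2); first by rewrite divr_gt0.
have /andP[e_0 e_1] := e0.
have h' (k : nat) : exists t, 0 < t < Num.min e k.+1%:R^-1 /\ C (D x t).
  have [|t t0 Ct] := h (Num.min e k.+1%:R^-1); last by exists t.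
  by rewrite lt_min e_0 invr_gt0 ltr0n.
have [t ht] := choice h'.
pose B := `[amin / 2, amax + amin / 2]%classic `&` C.
have cB : compact B by apply: compact_closedI => //; exact: segment_compact.
have Bt k : B (D x (t k)).
  have [/andP[t0 +] Ct] := ht k; rewrite lt_min => /andP[te _].
  split=> //; have := hD x (t k) Kx; rewrite t0 te => /(_ isT) /andP[a b].
  by rewrite /= in_itv /= b andbT; lra.
have [|y [By cy]] := cB (D x (t k) @[k --> \oo]) _; first by exists 0%N => // k _ /=; exact: Bt.
have [/= yI Cy] := By; exists y => //; apply/accP; split.
  by move: yI; rewrite in_itv /= => /andP[+ _]; apply: lt_le_trans; rewrite divr_gt0.
move=> e1 del e10 del0.
have := cy [set z | exists2 k, k.+1%:R^-1 < del & z = D x (t k)] (ball y e1).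
case.
- by have [k1 _ hk] := near_inv del0; exists k1 => //= k /hk kd; exists k.
- exact: nbhsx_ballx.
move=> z [[k kd ->]]; rewrite /ball /= distrC => zy; exists (t k) => //.
have [/andP[t0 +] _] := ht k; rewrite t0 lt_min => /andP[_ tk].
exact: lt_trans kd.
Qed.

(** The accumulation points form a non-empty closed bounded set. A value [z]
    strictly between two of them is taken at arbitrarily small scales, because
    the quotient is continuous in the radius and comes close to both of them
    there. *)
Lemma acc_interval x : K x ->
  closed_subinterval amin amax (accumulation_points mu x).
Proof.
move=> Kx; set A := accumulation_points mu x.
have Abd (y : R) : A y -> amin <= y <= amax.
  move=> /accP[y0 h]; apply/andP; split; apply/ler_addgt0Pr => e e0.
  - have e20 : 0 < e / 2 by rewrite divr_gt0.
    have [del /andP[d0 _] hd] := D_bounds e20; have [t td yt] := h _ _ e20 d0.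
    by have /andP[+ _] := hd x t Kx td; move: yt; rewrite ltr_norml => /andP[]; lra.
  - have e20 : 0 < e / 2 by rewrite divr_gt0.
    have [del /andP[d0 _] hd] := D_bounds e20; have [t td yt] := h _ _ e20 d0.
    by have /andP[_ +] := hd x t Kx td; move: yt; rewrite ltr_norml => /andP[]; lra.
have [y0 _ Ay0] : exists2 y, setT y & A y.
  apply: acc_closed => // del d0.
  by exists (del / 2); rewrite // divr_gt0 //= ltr_pdivrMr // mulr_natr mulr2n ltrDl.
have lbA : has_lbound A by exists amin => y /Abd /andP[].
have ubA : has_ubound A by exists amax => y /Abd /andP[].
have infA : has_inf A by split=> //; exists y0.
have supA : has_sup A by split=> //; exists y0.
have Acl (y : R) : amin <= y -> (forall e, 0 < e -> exists2 z, A z & `|z - y| < e) -> A y.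
  move=> ay h; apply/accP; split; first exact: lt_le_trans ay.
  move=> e del e0 d0; have [|z Az zy] := h (e / 2); first by rewrite divr_gt0.
  have /accP[_ hz] := Az; have [|t td tz] := hz (e / 2) del _ d0; first by rewrite divr_gt0.
  by exists t => //; have := ler_normD (D x t - z) (z - y); rewrite addrA subrK; lra.
have Ainf : A (inf A).
  apply: Acl => [|e e0]; first by apply: lb_le_inf; [exists y0|move=> y /Abd /andP[]].
  have [z Az zi] := inf_adherent e0 infA; exists z => //.
  by have := ge_inf lbA Az; rewrite ltr_norml => ?; apply/andP; split; lra.
have Asup : A (sup A).
  apply: Acl => [|e e0].
    by rewrite (le_trans _ (ub_le_sup ubA Ay0)) //; have /andP[] := Abd _ Ay0.
  have [z Az zi] := sup_adherent e0 supA; exists z => //.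
  by have := ub_le_sup ubA Az; rewrite ltr_norml => ?; apply/andP; split; lra.
exists (inf A), (sup A); split.
- by have /andP[] := Abd _ Ainf.
- exact: ge_inf.
- by have /andP[] := Abd _ Asup.
apply/seteqP; split=> [y Ay|z]; rewrite /= in_itv /=.
  by rewrite (ge_inf lbA) // (ub_le_sup ubA).
rewrite le_eqVlt => /andP[/orP[/eqP <- //|az]]; rewrite le_eqVlt => /orP[/eqP -> //|zb].
apply/accP; split; first by rewrite (lt_trans _ az) //; have /accP[] := Ainf.
move=> e del e0 d0; have /accP[_ h1] := Ainf; have /accP[_ h2] := Asup.
have md0 : 0 < Num.min del 1 by rewrite lt_min d0 ltr01.
have [|t1 /andP[t10 t1d] D1] := h1 (z - inf A) _ _ md0; first by rewrite subr_gt0.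
have [|t2 /andP[t20 t2d] D2] := h2 (sup A - z) _ _ md0; first by rewrite subr_gt0.
have D1z : D x t1 < z by move: D1; rewrite ltr_norml => /andP[]; lra.
have D2z : z < D x t2 by move: D2; rewrite ltr_norml => /andP[]; lra.
have cD a b : 0 < a -> b < Num.min del 1 -> {within `[a, b], continuous (fun t => D x t)}.
  move=> a0 bd; apply: continuous_in_subspaceT => t; rewrite inE /= in_itv /= => /andP[ta tb].
  apply: D_continuous => //; rewrite (lt_le_trans a0 ta) (le_lt_trans tb) //.
  by rewrite (lt_le_trans bd) // ge_min lexx orbT.
have fin a b : 0 < a -> b < Num.min del 1 -> a <= b ->
    Num.min (D x a) (D x b) <= z <= Num.max (D x a) (D x b) ->
    exists2 t, 0 < t < del & `|D x t - z| < e.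
  move=> a0 bd ab zab; have [t] := IVT ab (cD a b a0 bd) zab.
  rewrite in_itv /= => /andP[ta tb] tz; exists t; last by rewrite tz subrr normr0.
  rewrite (lt_le_trans a0 ta) (le_lt_trans tb) // (lt_le_trans bd) //.
  by rewrite ge_min lexx.
have [t12|/ltW t21] := leP t1 t2.
  by apply: (fin t1 t2) => //; rewrite ge_min le_max (ltW D1z) (ltW D2z) orbT.
by apply: (fin t2 t1) => //; rewrite ge_min le_max (ltW D1z) (ltW D2z) orbT.
Qed.

(** * The function beta *)

Context (beta : R -> R).
Context (hbeta : forall q : R, \sum_(i < N) p i `^ q * r i `^ beta q = 1).

Lemma termE i q t : p i `^ q * r i `^ t = expR (q * ln (p i) + t * ln (r i)).
Proof. by rewrite /powR !gt_eqF// expRD. Qed.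

Lemma beta_le q t : \sum_(i < N) p i `^ q * r i `^ t <= 1 -> beta q <= t.
Proof.
move=> le1; rewrite leNgt; apply/negP => tb; move: le1; apply/negP; rewrite -ltNge.
have i0 : 'I_N by case: N hN => // k _; exact: ord0.
rewrite -(hbeta q); apply: ltr_sum => [|i _]; last first.
  by rewrite !termE ltr_expR ltrD2l ltr_nM2r.
by apply/hasP; exists i0; rewrite ?mem_index_enum.
Qed.

Lemma expR_convex (l u v : R) : 0 <= l <= 1 ->
  expR (l * u + (1 - l) * v) <= l * expR u + (1 - l) * expR v.
Proof.
move=> /andP[l0 l1]; set w := l * u + _.
have tangent (z : R) : expR w * (1 + (z - w)) <= expR z.
  have -> : expR z = expR w * expR (z - w) by rewrite -expRD addrC subrK.
  rewrite ler_wpM2l ?expR_ge0//.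
  exact: expR_ge1Dx.
have hu := ler_wpM2l l0 (tangent u).
have l1' : 0 <= 1 - l by rewrite subr_ge0.
have hv := ler_wpM2l l1' (tangent v).
apply: le_trans (lerD hu hv); rewrite le_eqVlt; apply/orP; left; apply/eqP.
by rewrite /w; ring.
Qed.

(** Holder's inequality for the defining sums, here as convexity of [expR]. *)
Lemma beta_convex l a b : 0 <= l <= 1 ->
  beta (l * a + (1 - l) * b) <= l * beta a + (1 - l) * beta b.
Proof.
move=> l01; apply: beta_le.
rewrite [leRHS](_ : 1 = l * (\sum_(i < N) p i `^ a * r i `^ beta a) +
    (1 - l) * (\sum_(i < N) p i `^ b * r i `^ beta b)); last first.
  by rewrite !hbeta; ring.
rewrite !big_distrr -big_split /=; apply: ler_sum => i _; rewrite !termE.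
apply: le_trans (expR_convex _ _ l01); rewrite ler_expR le_eqVlt.
by apply/orP; left; apply/eqP; ring.
Qed.

Lemma term_le1 q i : q * ln (p i) + beta q * ln (r i) <= 0.
Proof.
rewrite -expR_le1 -termE -(hbeta q) (bigD1 i) //= lerDl sumr_ge0 // => j _.
by rewrite termE expR_ge0.
Qed.

(** No term of the defining sum exceeds [1], so the inequality holds at the
    exponents of the single letters, in particular at the two extreme ones; it is
    linear in [alpha]. *)
Lemma legendre_ge0 alpha q : amin <= alpha <= amax -> 0 <= alpha * q + beta q.
Proof.
move=> /andP[a1 a2]; have attained i : 0 <= (ln (p i) / ln (r i)) * q + beta q.
  rewrite -(ler_nM2r (ln_r_lt0 i)) mul0r mulrDl mulrAC divfK ?lt_eqF//.
  by rewrite [ln _ * q]mulrC term_le1.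
have [q0|/ltW q0] := leP 0 q.
  have [[i _ iE] _] := hmin; have := attained i; rewrite iE => h0.
  by rewrite (le_trans h0) // lerD2r ler_wpM2r.
have [[i _ iE] _] := hmax; have := attained i; rewrite iE => h0.
by rewrite (le_trans h0) // lerD2r ler_wnM2r.
Qed.

(** Minimax. For [q > 0] and [q < 0] the required inequality bounds [alpha] from
    below and from above by difference quotients of [beta], and convexity makes
    these bounds compatible. *)
Lemma minimax a b s : a <= b ->
  (forall q, s <= Num.max (a * q) (b * q) + beta q) ->
  exists2 alpha, a <= alpha <= b & forall q, s <= alpha * q + beta q.
Proof.
move=> ab h.
have hpos q : 0 < q -> s <= b * q + beta q.
  by move=> q0; have := h q; rewrite max_r // ler_wpM2r // ltW.
have hneg q : q < 0 -> s <= a * q + beta q.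
  by move=> q0; have := h q; rewrite max_l // ler_wnM2r // ltW.
pose E := [set (s - beta q) / q | q in [set q : R | 0 < q]].
have Eb : ubound E b.
  by move=> _ [q /= q0 <-]; rewrite ler_pdivrMr //; have := hpos q q0; lra.
have E1 : E ((s - beta 1) / 1) by exists 1 => //=.
have hE : has_ubound E by exists b.
exists (Num.max a (sup E)).
  rewrite le_max lexx /= ge_max ab /=; apply: ge_sup => //.
  by exists ((s - beta 1) / 1).
move=> q; have [q0|q0|->] := ltgtP q 0.
- suff : Num.max a (sup E) <= (beta q - s) / - q.
    by rewrite ler_pdivlMr ?oppr_gt0//; lra.
  rewrite ge_max ler_pdivlMr ?oppr_gt0//; apply/andP; split.
    by have := hneg q q0; lra.
  apply: ge_sup; first by exists ((s - beta 1) / 1).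
  move=> _ [q1 /= q10 <-]; rewrite ler_pdivrMr // mulrAC ler_pdivlMr ?oppr_gt0//.
  have t0 : 0 < q1 - q by rewrite subr_gt0 (lt_trans q0).
  have := @beta_convex (- q / (q1 - q)) q1 q.
  have -> : 1 - - q / (q1 - q) = q1 / (q1 - q) by field; rewrite gt_eqF.
  have -> : - q / (q1 - q) * q1 + q1 / (q1 - q) * q = 0 by field; rewrite gt_eqF.
  rewrite divr_ge0 ?oppr_ge0 ?(ltW t0) ?(ltW q0)// ler_pdivrMr // mul1r lerDr (ltW q10).
  move=> /(_ isT) c0.
  have s0 : s <= beta 0 by have := h 0; rewrite !mulr0 maxxx add0r.
  have := le_trans s0 c0; rewrite -(ler_pM2r t0) mulrDl.
  have -> : - q / (q1 - q) * beta q1 * (q1 - q) = - q * beta q1 by field; rewrite gt_eqF.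
  have -> : q1 / (q1 - q) * beta q * (q1 - q) = q1 * beta q by field; rewrite gt_eqF.
  lra.
- have : (s - beta q) / q <= Num.max a (sup E).
    by rewrite le_max; apply/orP; right; apply: ub_le_sup => //; exists q.
  by rewrite ler_pdivrMr //; lra.
- by rewrite mulr0 add0r; have := h 0; rewrite !mulr0 maxxx add0r.
Qed.

(** * The upper bound for the packing measure *)

Lemma packing_premeasure_ge0 s (E : set 'rV[R]_d) :
  (0 <= packing_premeasure s E)%E.
Proof.
apply: le_ereal_inf_tmp => _ [del _ <-]; apply: ereal_sup_ubound.
exists set0, (fun=> 0), (fun=> 1); split; last by rewrite esum_set0.
by split=> //; exact: trivIset_set0.
Qed.

Lemma packing_measure_ge0 s (E : set 'rV[R]_d) : (0 <= packing_measure s E)%E.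
Proof.
apply: le_ereal_inf_tmp => _ [F [_ ->]].
by apply: nneseries_ge0 => i _ _; exact: packing_premeasure_ge0.
Qed.

(** The logarithm of the weight of [w] for the probability vector
    [p i `^ q * r i `^ beta q]. *)
Definition wpi q w : R := q * - lp w + beta q * - lr w.

Lemma wpiE q w : wt (fun i => p i `^ q * r i `^ beta q) w = expR (wpi q w).
Proof.
rewrite wt_powR // /powR !gt_eqF//= -expRD /wpi /lp /lr !opprK //.
Qed.

(** A ball centred in [K] on which the local dimension quotient is controlled
    contains a whole cylinder whose weight dominates a power of the radius. For
    [q >= 0] the heaviest cylinder meeting the ball of half the radius is used,
    for [q <= 0] the one containing the centre. *)
Lemma ball_contains_cylinder q a b : exists C, forall x t, K x -> 0 < t < 1 ->
  (forall t', 0 < t' <= t -> a <= D x t' <= b) ->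
  exists2 v, (forall y, Q y -> eball x t (sw v y)) &
    (Num.max (a * q) (b * q) + beta q) * ln (2 * t) <= C + wpi q v.
Proof.
pose tau := Num.max (a * q) (b * q) + beta q.
have [|M M0 hM] := @m_ball_le k0; first by rewrite k0_gt0 k0_le1.
pose C1 := - ln k0 - ln rmin.
exists (`|tau| * (2 * `|ln 2|) + `|q| * `|ln M| + `|beta q| * C1) => x t Kx /andP[t0 t1] hD.
have lnr (u : R) v : 0 < u <= 1 -> stop r (k0 * u) v ->
    - ln u <= lr v <= - ln u + C1.
  move=> /andP[u0 u1] sv; have ku0 : 0 < k0 * u by exact: mulr_gt0.
  have ku1 : k0 * u <= 1 by rewrite mulr_ile1 // ltW.
  apply/andP; split.
    apply: le_trans (stop_lr ku0 sv); rewrite lerN2 ler_ln ?posrE//.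
    by rewrite ler_piMl // ltW.
  have := stop_gt_rmin ku1 sv => sg.
  rewrite /lr /C1 lerNl !(opprB, opprD, opprK).
  have -> : ln u + (ln rmin + ln k0) = ln (k0 * u * rmin).
    by rewrite !lnM ?posrE ?mulr_gt0//; ring.
  by rewrite ler_ln ?posrE ?mulr_gt0// ltW.
have lnD t' : 0 < t' <= t -> b * ln t' <= ln (m (eball x t')) <= a * ln t'.
  move=> ht; have /andP[h1 h2] := hD t' ht; have /andP[t'0 t't] := ht.
  have lt0 : ln t' < 0 by rewrite ln_lt0 // t'0 (le_lt_trans t't).
  have E : ln (m (eball x t')) = D x t' * ln t' by rewrite /Dr divfK // lt_eqF.
  by rewrite E !ler_wnM2r // ltW.
have C10 : 0 <= C1 by rewrite addr_ge0 // oppr_ge0 ln_le0 // ltW.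
have bnd (u : R) v : 0 < u <= 1 -> stop r (k0 * u) v ->
    beta q * ln u - `|beta q| * C1 <= beta q * - lr v.
  move=> u01 sv; have /andP[l1 l2] := lnr u v u01 sv.
  have : `|beta q * (- lr v - ln u)| <= `|beta q| * C1.
    by rewrite normrM ler_wpM2l // ler_norml; apply/andP; split; lra.
  by rewrite ler_norml => /andP[+ _]; lra.
have tl : tau * ln (2 * t) <= tau * ln t + `|tau| * (2 * `|ln 2|) - `|tau| * `|ln 2|.
  rewrite lnM ?posrE// mulrDr; have := ler_norm (tau * ln 2); rewrite normrM; lra.
have [q0|q0] := leP 0 q; last first.
  have kt0 : 0 < k0 * t by exact: mulr_gt0.
  have [v [sv xv _]] := stop_point [::] kt0 Kx.
  have mv := m_ball_ge_stop sv (ltW t0) (image_sub_Q xv).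
  exists v.
    have [z Kz /= zE] := xv; move=> y Qy; rewrite -zE.
    rewrite /eball /closed_ball_ /= sw_sim.
    rewrite (@le_trans _ _ (k0 * t * (2 * c0)))//.
      by rewrite ler_pM ?enorm_ge0 ?(ltW (wtr_gt0 _)) ?(Q_diam (K_Q Kz)) ?(stop_le r_gt0).
    by rewrite mulrAC ler_piMl ?(ltW t0)// mulrC k0_c0.
  have t01 : 0 < t <= 1 by rewrite t0 ltW.
  have := bnd t v t01 sv.
  have tE : tau = a * q + beta q.
    rewrite /tau max_l // ler_wnM2r ?(ltW q0)//.
    by have /andP[] := hD t (introT andP (conj t0 (lexx t))); exact: le_trans.
  have : q * - lp v >= q * (a * ln t).
    rewrite ler_wnM2l ?(ltW q0)// /lp opprK.
    apply: (@le_trans _ _ (ln (m (eball x t)))).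
      by rewrite ler_ln ?posrE // m_ball_gt0.
    by have /andP[] := lnD t (introT andP (conj t0 (lexx t))).
  move: tl; rewrite -/tau tE /wpi.
  have : 0 <= `|a * q + beta q| * `|ln 2| by rewrite mulr_ge0.
  have : 0 <= `|q| * `|ln M| by rewrite mulr_ge0.
  lra.
have t20 : 0 < t / 2 by rewrite divr_gt0.
have t21 : t / 2 <= 1 by rewrite ler_pdivrMr //; lra.
have t2t : t / 2 <= t by rewrite ler_pdivrMr //; lra.
have t01 : 0 < t / 2 <= 1 by rewrite t20.
have [v [sv [y0 Qy0 xy0] mv]] := hM x (t / 2) t01 (m_ball_gt0 Kx t20).
exists v.
  move=> y Qy; rewrite /eball /closed_ball_ /=.
  rewrite (le_trans (enorm_triangle (sw v y0) _ _))// sw_sim.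
  rewrite [leRHS](_ : t = t / 2 + t / 2); last by field.
  rewrite lerD // (@le_trans _ _ (k0 * (t / 2) * (2 * c0)))//.
    by rewrite ler_pM ?enorm_ge0 ?(ltW (wtr_gt0 _)) ?Q_diam ?(stop_le r_gt0).
  by rewrite mulrAC ler_piMl ?(ltW t20)// mulrC k0_c0.
have := bnd (t / 2) v t01 sv.
have tE : tau = b * q + beta q.
  rewrite /tau max_r // ler_wpM2r //.
  by have /andP[] := hD t (introT andP (conj t0 (lexx t))); exact: le_trans.
have : q * (b * ln (t / 2)) <= q * (ln M - lp v).
  rewrite ler_wpM2l // /lp opprK -lnM ?posrE//.
  apply: (@le_trans _ _ (ln (m (eball x (t / 2))))).
    by have /andP[] := lnD (t / 2) (introT andP (conj t20 t2t)).
  by rewrite ler_ln ?posrE ?mulr_gt0// m_ball_gt0.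
have : q * ln M <= `|q| * `|ln M| by rewrite -normrM ler_norm.
have lt2 : ln (t / 2) = ln t - ln 2 by rewrite lnM ?posrE ?invr_gt0// lnV ?posrE.
have : tau * ln 2 <= `|tau| * `|ln 2| by rewrite -normrM ler_norm.
move: tl; rewrite -/tau lt2 tE /wpi; lra.
Qed.

(** The set is covered by the sets [E k] of the points whose quotient stays
    within [eta] of the interval at all scales below [1 / k]. In a packing of
    [E k] every ball contains a cylinder, and disjoint balls contain incomparable
    ones. Their weights sum to at most [1] by Kraft's inequality, and the strict
    inequality leaves over a positive power of the radii. *)
Lemma packing_measure_eq0 q a b s : Num.max (a * q) (b * q) + beta q < s ->
  packing_measure s [set x | K x /\ accumulation_points mu x `<=` `[a, b]%classic]
    = 0%E.
Proof.
move=> taus; pose gap := s - (Num.max (a * q) (b * q) + beta q).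
have gap0 : 0 < gap by rewrite subr_gt0.
pose eta := gap / (2 * (`|q| + 1)).
have q1 : 0 < `|q| + 1 by rewrite ltr_wpDl.
have eta0 : 0 < eta by rewrite divr_gt0 // mulr_gt0.
have etaq : eta * `|q| < gap.
  by rewrite /eta mulrAC ltr_pdivrMr ?mulr_gt0// ltr_pM2l //; have := normr_ge0 q; lra.
pose tau := Num.max ((a - eta) * q) ((b + eta) * q) + beta q.
have stau : 0 < s - tau.
  rewrite subr_gt0 /tau -ltrBrDr gt_max; apply/andP; split.
    have : a * q <= Num.max (a * q) (b * q) by rewrite le_max lexx.
    have : - (eta * q) <= eta * `|q| by rewrite -mulrN ler_wpM2l ?(ltW eta0)// ler_normr lexx orbT.
    by move: etaq; rewrite /gap; lra.
  have : b * q <= Num.max (a * q) (b * q) by rewrite le_max lexx orbT.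
  have : eta * q <= eta * `|q| by rewrite ler_wpM2l ?(ltW eta0)// ler_norm.
  by move: etaq; rewrite /gap; lra.
have [C hC] := ball_contains_cylinder q (a - eta) (b + eta).
pose E (k : nat) : set 'rV[R]_d := [set x | K x /\
  forall t, 0 < t < k.+1%:R^-1 -> a - eta <= D x t <= b + eta].
have EP k : packing_premeasure s (E k) = 0%E.
  apply/eqP; rewrite eq_le packing_premeasure_ge0 andbT.
  apply/lee_addgt0Pr => e e0; rewrite add0e.
  (* Below this scale the gain [(2 t)^(s - tau)] absorbs the constant [expR C]
     and leaves the factor [e]. *)
  pose del := Num.min k.+1%:R^-1 (expR ((ln e - C) / (s - tau))).
  have del0 : 0 < del by rewrite lt_min invr_gt0 ltr0n expR_gt0.
  apply: (@le_trans _ _ (packing_premeasure_at s del (E k))).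
    by apply: ereal_inf_lbound; exists del.
  apply: ge_ereal_sup => _ [J [c [rad [[pk tJ] ->]]]].
  have exv i : exists v, J i -> (forall y, Q y -> eball (c i) (rad i) (sw v y)) /\
      (2 * rad i) `^ s <= e * expR (wpi q v).
    have [/asboolP Ji|/asboolP nJi] := boolP `[< J i >]; last by exists [::].
    have [[Kc cD] rad0 raddel] := pk i Ji.
    have h2 : 2 * rad i <= k.+1%:R^-1.
      by rewrite (le_trans raddel) // ge_min lexx.
    have k1 : k.+1%:R^-1 <= 1 :> R by rewrite invf_le1 // ler1n.
    have radk : rad i < k.+1%:R^-1.
      by rewrite (lt_le_trans _ h2) // mulr_natl mulr2n ltrDl.
    have [||v vQ vle] := hC (c i) (rad i) Kc.
    - by rewrite rad0 (lt_le_trans radk).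
    - move=> t' /andP[t'0 t'r]; apply: cD; rewrite t'0; exact: le_lt_trans radk.
    exists v => _; split=> //.
    have rad20 : 0 < 2 * rad i by rewrite mulr_gt0.
    rewrite /powR gt_eqF // -{1}(lnK e0) -expRD ler_expR.
    have : (s - tau) * ln (2 * rad i) <= ln e - C.
      rewrite mulrC -ler_pdivlMr // -[leRHS]expRK ler_ln ?posrE ?expR_gt0//.
      by rewrite (le_trans raddel) // ge_min lexx orbT.
    by rewrite -/tau in vle; lra.
  have [vf hv] := choice exv.
  apply: ge_ereal_sup => _ [A [fA AJ] <-]; rewrite fsbig_finite //= sumEFin lee_fin.
  have inA i : i \in fset_set A -> J i.
    by rewrite in_fset_set // inE => /AJ.
  have vinj i j : J i -> J j -> prefix (vf i) (vf j) -> i = j.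
    move=> Ji Jj /prefixP[u vj]; apply: tJ => //.
    have Q0 : Q 0 by rewrite /Q /= enorm0 ltW.
    exists (sw (vf j) 0); split; last by have [+ _] := hv j Jj; apply.
    by rewrite vj sw_cat; have [+ _] := hv i Ji; apply; exact: sw_Q.
  have uv : uniq (map vf (fset_set A)).
    rewrite map_inj_in_uniq ?fset_uniq// => i j /inA Ji /inA Jj ij.
    by apply: vinj => //; rewrite ij prefix_refl.
  apply: (@le_trans _ _ (e * \sum_(w <- map vf (fset_set A)) expR (wpi q w))).
    rewrite big_map big_distrr /= big_seq [leRHS]big_seq; apply: ler_sum => i /inA Ji.
    by have [_] := hv i Ji.
  rewrite ler_piMr ?(ltW e0)//.
  under eq_bigr do rewrite -wpiE.
  apply: kraft => //.
  - by move=> i; rewrite termE expR_ge0.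
  - by rewrite hbeta.
  - move=> _ _ /mapP[i /inA Ji ->] /mapP[j /inA Jj ->] ij.
    by rewrite (vinj i j).
apply/eqP; rewrite eq_le packing_measure_ge0 andbT; apply: ereal_inf_lbound.
exists E; split; last by rewrite eseries0.
move=> x [Kx accx]; apply: contrapT => nE.
(* A point of none of the [E k] has quotients outside the open [eta]-neighbourhood
   of the interval at arbitrarily small scales, hence an accumulation point there. *)
pose B := [set z : R | z <= a - eta] `|` [set z | b + eta <= z].
have cB : closed B by apply: closedU; [exact: closed_le|exact: closed_ge].
have [|y By /accx] := acc_closed Kx cB.
  move=> del del0; have [k _ hk] := near_inv del0.
  apply: contrapT => no; apply: nE; exists k => //; split=> // t /andP[t0 tk].
  have td : 0 < t < del by rewrite t0 (lt_trans tk) //; exact: (hk k (leqnn k)).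
  apply: contrapT => /negP; rewrite negb_and -!ltNge => h; apply: no; exists t => //.
  by case/orP: h => /ltW h; [left|right].
rewrite /= in_itv /= => /andP[ya yb]; case: By => /=; lra.
Qed.

(** * A word that separates *)

Definition near v w := exists x y, [/\ Q x, Q y & enorm (sw v x - sw w y) <= wt r w].

Definition neighbours w (L : seq (seq 'I_N)) :=
  uniq L /\ forall v, v \in L -> stop r (wt r w) v /\ near v w.

Lemma neighbours_bound : exists M, forall w L, neighbours w L -> (size L <= M)%N.
Proof.
have [|M hM] := @near_bound (2 * c0 + 1).
  by rewrite addr_ge0 // mulr_ge0 // ltW.
exists M => w L [uL nL]; apply: (hM (wt r w) (sw w 0) L) => //.
  by rewrite wtr_gt0 wtr_le1.
move=> v /nL [sv [x [y [Qx Qy xy]]]]; split=> //; exists x => //.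
rewrite (le_trans (enorm_triangle (sw w y) _ _)) // mulrDl mul1r lerD //; last first.
  by rewrite enormB.
rewrite sw_sim mulrC ler_wpM2r ?(ltW (wtr_gt0 _))// Q_diam //.
by rewrite /Q /= enorm0 ltW.
Qed.

(** Take a word with the largest number of neighbours. Prefixing it by [u]
    translates its neighbours to neighbours, and by maximality there are no
    other ones. *)
Lemma separating_word : exists w, forall u v, stop r (wt r (u ++ w)) v ->
  near v (u ++ w) -> prefix u v.
Proof.
have [M hM] := neighbours_bound.
pose P k := `[< exists w L, neighbours w L /\ size L = k >].
have P0 : exists k, P k by exists 0%N; apply/asboolP; exists [::], [::].
have PM k : P k -> (k <= M)%N by move=> /asboolP[w [L [/hM + <-]]].
case: (ex_maxnP P0 PM) => k /asboolP[w [L [[uL nL] sL]]] kmax.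
exists w => u v sv nv.
have inj : injective (cat u) by move=> a b /eqP; rewrite eqseq_cat // eqxx => /eqP.
have nL' v' : v' \in map (cat u) L -> stop r (wt r (u ++ w)) v' /\ near v' (u ++ w).
  move=> /mapP[v0 /nL[sv0 [x [y [Qx Qy xy]]]] ->]; split.
    by rewrite wt_cat; apply: stop_cat => //; rewrite wtr_gt0 wtr_le1.
  exists x, y; split=> //; rewrite !sw_cat sw_sim wt_cat.
  by rewrite ler_wpM2l // ltW.
have [/mapP[v0 _ ->]|vL] := boolP (v \in map (cat u) L); first exact: prefix_prefix.
suff /kmax : P k.+1 by rewrite ltnn.
apply/asboolP; exists (u ++ w), (v :: map (cat u) L); split; last by rewrite /= size_map sL.
split; first by rewrite /= vL map_inj_uniq.
by move=> v'; rewrite inE => /orP[/eqP->|/nL'].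
Qed.

Definition w0 : seq 'I_N := projT1 (cid separating_word).

Lemma w0P u v : stop r (wt r (u ++ w0)) v -> near v (u ++ w0) -> prefix u v.
Proof. by rewrite /w0; case: (cid _) => w /= h; exact: h. Qed.

(** Only stopped cylinders inside that of [u] meet this ball. *)
Lemma m_ball_le_prefix u x : (sw (u ++ w0) @` Q) x ->
  m (eball x (wt r (u ++ w0))) <= wt p u.
Proof.
move=> [y Qy yx]; have rho0 := wtr_gt0 (u ++ w0).
have [L [uL memL sL]] := stop_enum hr rho0.
apply: (le_trans (m_le_meeting (measurable_eball _ _) sL)).
apply: kraft_prefix => //.
- by move=> i; exact: ltW.
- by rewrite p_sum.
- exact: filter_uniq.
- apply: (@kraft_stop _ _ r (wt r (u ++ w0))) => v; rewrite mem_filter memL.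
  by case/andP.
- move=> v; rewrite mem_filter memL => /andP[/asboolP[z Qz xz] sv].
  by apply: w0P => //; exists z, y; split=> //; rewrite yx enormB.
Qed.

(** Otherwise the cylinder of [y] at the scale of [u ++ w0] would be near
    [u ++ w0], hence inside the cylinder of [u]. *)
Lemma separated u u' x y : (sw (u ++ w0) @` Q) x -> (sw u' @` K) y ->
  ~~ prefix u u' -> ~~ prefix u' u -> wt r (u ++ w0) < enorm (x - y).
Proof.
move=> [x' Qx' xE] [y' Ky' yE] uu' u'u; rewrite ltNge; apply/negP => xy.
have [v [sv [z Kz zE] u'v]] := stop_point u' (wtr_gt0 (u ++ w0)) Ky'.
have uv : prefix u v.
  apply: w0P => //; exists z, x'; split=> //; first exact: K_Q.
  by rewrite zE yE xE enormB.
case/orP: u'v => [u'v|vu'].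
  by have := prefix_total uv u'v; rewrite (negbTE uu') (negbTE u'u).
by move: uu'; rewrite (prefix_trans uv vu').
Qed.

(** * Sizes and weights *)

Definition lam : R := - ln rmax.
Definition Lam : R := - ln rmin.

Lemma lam_gt0 : 0 < lam.
Proof. by rewrite oppr_gt0 ln_lt0 // rmax_gt0 rmax_lt1. Qed.
Lemma Lam_gt0 : 0 < Lam.
Proof. by rewrite oppr_gt0 ln_lt0 // rmin_gt0 rmin_lt1. Qed.
Local Hint Resolve lam_gt0 Lam_gt0 amax_gt0 : core.

Lemma lr_ge w : (size w)%:R * lam <= lr w.
Proof.
elim: w => [|i w IH]; first by rewrite mul0r lr_nil.
rewrite lr_cons /= -add1n natrD mulrDl mul1r lerD // lerN2 ler_ln ?posrE//.
exact: rmax_ge.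
Qed.

Lemma lr_le w : lr w <= (size w)%:R * Lam.
Proof.
elim: w => [|i w IH]; first by rewrite mul0r lr_nil.
rewrite lr_cons /= -add1n natrD mulrDl mul1r lerD // lerN2 ler_ln ?posrE//.
exact: rmin_le.
Qed.

Lemma lp_le w : lp w <= (size w)%:R * (amax * Lam).
Proof.
have /andP[_ h] := lp_bounds w; apply: (le_trans h).
by rewrite mulrCA ler_wpM2l ?(ltW amax_gt0)// lr_le.
Qed.

(** * Blocks of prescribed exponent *)

(** Building bricks of the tree of codes: ending with [w0] keeps distinct
    concatenations of bricks apart and controls the mass of small balls, and the
    last condition gives local dimensions close to [g]. *)
Definition blocks (g eta : R) (l : nat) (W : seq (seq 'I_N)) :=
  [/\ (0 < l)%N, uniq W, W != [::] & forall w, w \in W ->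
    [/\ size w = l, exists u, w = u ++ w0 & `|lp w - g * lr w| <= eta * lr w]].

(** The letters with the extreme exponents. *)
Lemma letter_signs g : amin <= g <= amax -> exists i j,
  0 <= ln (p i) - g * ln (r i) /\ ln (p j) - g * ln (r j) <= 0.
Proof.
move=> /andP[g1 g2]; have [[i _ iE] _] := hmin; have [[j _ jE] _] := hmax.
exists i, j; split.
  have -> : ln (p i) = amin * ln (r i) by rewrite -iE divfK // lt_eqF.
  by rewrite -mulrBl mulr_le0 ?subr_le0 ?(ltW (ln_r_lt0 _)).
have -> : ln (p j) = amax * ln (r j) by rewrite -jE divfK // lt_eqF.
by rewrite -mulrBl mulr_ge0_le0 ?subr_ge0 ?(ltW (ln_r_lt0 _)).
Qed.

(** Greedily appending a letter that pulls the deviation back towards [0]. *)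
Lemma balanced_words g : amin <= g <= amax -> exists2 C, 0 <= C &
  forall n, exists2 w, size w = n & `|lp w - g * lr w| <= C.
Proof.
move=> hg; have [i [j [hi hj]]] := letter_signs hg.
pose Y k := ln (p k) - g * ln (r k).
exists (`|Y i| + `|Y j|); first by rewrite addr_ge0.
elim=> [|n [w sw' hw]]; first by exists [::] => //; rewrite lp_nil lr_nil mulr0 subrr normr0 addr_ge0.
have cE k : lp (k :: w) - g * lr (k :: w) = (lp w - g * lr w) - Y k.
  by rewrite lp_cons lr_cons /Y; ring.
have Yi : `|Y i| = Y i by rewrite ger0_norm.
have Yj : `|Y j| = - Y j by rewrite ler0_norm.
rewrite Yi Yj in hw *; move: hw; rewrite ler_norml => /andP[h1 h2].
have [X0|X0] := leP 0 (lp w - g * lr w).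
  exists (i :: w); rewrite /= ?sw'// cE ler_norml.
  by rewrite -/(Y i) -/(Y j) in hi hj; apply/andP; split; lra.
exists (j :: w); rewrite /= ?sw'// cE ler_norml.
by rewrite -/(Y i) -/(Y j) in hi hj; apply/andP; split; lra.
Qed.

(** A long balanced word; its length makes its bounded deviation and that of the
    final [w0] negligible. *)
Lemma blocks_single g eta : amin <= g <= amax -> 0 < eta ->
  exists l W, blocks g eta l W.
Proof.
move=> hg eta0; have [C C0 hC] := balanced_words hg.
pose C1 := C + `|lp w0 - g * lr w0|.
pose n := (Num.truncn (C1 / (eta * lam))).+1.
have el0 : 0 < eta * lam by rewrite mulr_gt0.
have [w sw' hw] := hC n.
exists (size (w ++ w0)), [:: w ++ w0]; split=> //; first by rewrite size_cat sw'.
move=> w'; rewrite inE => /eqP->; split=> //; first by exists w.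
rewrite lp_cat lr_cat mulrDr opprD addrACA (le_trans (ler_normD _ _))//.
apply: (@le_trans _ _ C1); first by rewrite lerD2r.
rewrite mulrDr ler_wpDr ?mulr_ge0 ?lr_ge0 ?(ltW eta0)//.
apply: (@le_trans _ _ (eta * (n%:R * lam))).
  rewrite mulrCA -ler_pdivrMr // ltW // truncnS_gt //.
by rewrite ler_wpM2l ?(ltW eta0)// -sw' lr_ge.
Qed.

(** * Families of blocks with a large power sum *)

Lemma expR_le_quadratic (x : R) : x <= 2^-1 -> expR x <= 1 + x + 2 * x ^+ 2.
Proof.
move=> x2; have x1 : 0 < 1 - x by lra.
have h : 1 - x <= expR (- x) by exact: expR_ge1Dx.
rewrite -[expR x]invrK -expRN (@le_trans _ _ (1 - x)^-1)//.
  by rewrite lef_pV2 ?posrE ?expR_gt0.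
rewrite -[leLHS]mul1r ler_pdivrMr //.
have : 0 <= x ^+ 2 * (1 - 2 * x) by rewrite mulr_ge0 ?sqr_ge0//; lra.
by lra.
Qed.

(** One-sided first order condition for a minimum. *)
Lemma mean_ge0 (pi Z : 'I_N -> R) (h0 : R) : (forall i, 0 <= pi i) ->
  \sum_i pi i = 1 -> 0 < h0 ->
  (forall h, 0 < h <= h0 -> 1 <= \sum_i pi i * expR (h * Z i)) ->
  0 <= \sum_i pi i * Z i.
Proof.
move=> pi0 pi1 h00 hmin'; rewrite leNgt; apply/negP => neg.
pose B := \sum_i `|Z i| + 1.
have B0 : 0 < B by rewrite ltr_wpDl // sumr_ge0.
have ZB i : `|Z i| <= B.
  by rewrite /B (bigD1 i) //= -addrA lerDl addr_ge0 // sumr_ge0.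
pose V := \sum_i pi i * (2 * Z i ^+ 2).
have V0 : 0 <= V by apply: sumr_ge0 => i _; rewrite mulr_ge0 // mulr_ge0 // sqr_ge0.
pose e := - \sum_i pi i * Z i.
have e0 : 0 < e by rewrite oppr_gt0.
(* So small that the quadratic term cannot compensate the negative linear one. *)
pose h := Num.min h0 (Num.min (2^-1 / B) (e / (V + 1) / 2)).
have hpos : 0 < h by rewrite !lt_min h00 !divr_gt0 // ltr_wpDl.
have hB : h * B <= 2^-1 by rewrite -ler_pdivlMr // /h !ge_min lexx !orbT.
have hV : h * (V + 1) < e.
  have : h <= e / (V + 1) / 2 by rewrite /h !ge_min lexx !orbT.
  have V1 : 0 < V + 1 by rewrite ltr_wpDl.
  by rewrite ler_pdivlMr // -(ler_pM2r V1) divfK ?gt_eqF//; lra.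
have := hmin' h; rewrite hpos /h ge_min lexx -/h => /(_ isT).
rewrite leNgt => /negP; apply.
apply: (@le_lt_trans _ _ (\sum_i (pi i + h * (pi i * Z i) + h ^+ 2 * (pi i * (2 * Z i ^+ 2))))).
  apply: ler_sum => i _.
  have : h * Z i <= 2^-1.
    rewrite (le_trans _ hB) // ler_wpM2l ?(ltW hpos)//.
    exact: le_trans (ler_norm _) (ZB i).
  move=> /expR_le_quadratic /(ler_wpM2l (pi0 i)); rewrite exprMn; lra.
rewrite !big_split /= -!big_distrr /= pi1 -/V.
have : h * (h * (V + 1)) < h * e by rewrite ltr_pM2l.
have : 0 < h ^+ 2 by rewrite exprn_gt0.
by rewrite /e expr2; lra.
Qed.

(** A tilted probability vector with exponent close to [al]. It comes from the
    minimiser [q] of the convex function [sum_i r_i^s exp (q Y_i)] with an extra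
    factor that makes it coercive also when [al] is an endpoint. *)
Lemma tilted_weights al s eta : amin <= al <= amax -> 0 < eta ->
  (forall q, s <= al * q + beta q) ->
  exists (pi : 'I_N -> R) (kap q : R), [/\ forall i, 0 < pi i,
    \sum_i pi i = 1, `|kap| <= eta,
    \sum_i pi i * (ln (p i) - (al + kap) * ln (r i)) = 0 &
    forall i, pi i <= expR (s * ln (r i) + q * (ln (p i) - (al + kap) * ln (r i)))].
Proof.
move=> hal eta0 hs; pose Y i := ln (p i) - al * ln (r i).
pose l i := - ln (r i).
have l0 i : 0 < l i by rewrite oppr_gt0.
pose ex q i := - s * l i + q * Y i + eta * `|q| * l i.
pose G q := \sum_i expR (ex q i).
have g1 q : 1 <= \sum_i expR (- s * l i + q * Y i).
  rewrite -(hbeta q); apply: ler_sum => i _; rewrite termE ler_expR.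
  by have := hs q; have := l0 i; rewrite /Y /l => ? h; have := ler_wpM2r (ltW (l0 i)) h; rewrite /l; lra.
have G1 q : 1 <= G q.
  apply: (le_trans (g1 q)); apply: ler_sum => i _; rewrite ler_expR lerDl.
  by rewrite !mulr_ge0 // ltW.
have cG : continuous G.
  apply: continuous_sumr => i q.
  apply: continuous_comp; last exact: continuous_expR.
  apply: cvgD; first apply: cvgD; first exact: cvg_cst.
    by apply: cvgM; [exact: cvg_id|exact: cvg_cst].
  apply: cvgM; last exact: cvg_cst.
  apply: cvgM; first exact: cvg_cst.
  exact: (@cvg_norm _ _ _ _ _ id q).
have [i1 [i2 [Y1 Y2]]] := letter_signs hal.
pose c i := expR (- s * l i) * (eta * l i).
have c_gt0 i : 0 < c i by rewrite mulr_gt0 ?expR_gt0 // mulr_gt0.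
have coer i q : 0 <= q * Y i -> c i * `|q| <= G q.
  move=> qY; apply: (@le_trans _ _ (expR (ex q i))); last first.
    by rewrite /G (bigD1 i) //= lerDl sumr_ge0 // => j _; exact: expR_ge0.
  rewrite /ex -addrA expRD /c -mulrA ler_wpM2l ?expR_ge0//.
  apply: le_trans (expR_ge1Dx _); have := l0 i; lra.
pose T := G 0 / c i1 + G 0 / c i2.
have G00 : 0 < G 0 by rewrite (lt_le_trans ltr01).
have T0 : 0 < T by rewrite addr_gt0 // divr_gt0.
have out q : T < `|q| -> G 0 <= G q.
  move=> Tq; have [q0|/ltW q0] := leP 0 q.
    apply: (le_trans _ (coer i1 q _)); last by rewrite mulr_ge0.
    rewrite mulrC -ler_pdivrMr // (le_trans _ (ltW Tq)) // lerDl.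
    by rewrite divr_ge0 // ltW.
  apply: (le_trans _ (coer i2 q _)); last by rewrite mulr_le0.
  rewrite mulrC -ler_pdivrMr // (le_trans _ (ltW Tq)) // lerDr.
  by rewrite divr_ge0 // ltW.
have [||q qT qmin'] := @EVT_min R G (- T) T.
- by rewrite lerNl (le_trans _ (ltW T0)) // oppr_le0 ltW.
- by apply: continuous_subspaceT => q; exact: cG.
have qmin q' : G q <= G q'.
  have [q'T|/out h] := leP `|q'| T.
    by apply: qmin'; rewrite in_itv /= -ler_norml.
  by apply: le_trans h; apply: qmin'; rewrite in_itv /= oppr_le0 (ltW T0).
pose pi i := expR (ex q i) / G q.
have Gq0 : 0 < G q by rewrite (lt_le_trans ltr01).
have pi0 i : 0 < pi i by rewrite divr_gt0 // expR_gt0.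
have pi1 : \sum_i pi i = 1 by rewrite -big_distrl /= divff // gt_eqF.
(* Minimality of [q], with the sum normalised by its value there. *)
have foc h : 1 <= \sum_i pi i * expR (h * Y i + eta * (`|q + h| - `|q|) * l i).
  rewrite -(@ler_pM2l _ (G q)) // mulr1 (le_trans (qmin (q + h))) //.
  rewrite big_distrr /= le_eqVlt; apply/orP; left; apply/eqP.
  apply: eq_bigr => i _; rewrite /pi mulrAC mulrCA divff ?gt_eqF// mulr1 mulrC.
  by rewrite -expRD; congr expR; rewrite /ex; ring.
pose my := \sum_i pi i * Y i; pose ml := \sum_i pi i * l i.
have ml0 : 0 < ml.
  rewrite /ml (bigD1 i1) //=; apply: ltr_pwDl; first exact: mulr_gt0.
  by apply: sumr_ge0 => j _; apply: mulr_ge0; exact: ltW.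
have mean a b : \sum_i pi i * (a * Y i + b * l i) = a * my + b * ml.
  rewrite /my /ml !big_distrr -big_split /=; apply: eq_bigr => i _; ring.
have side a h0 : 0 < h0 -> `|a| = 1 ->
    forall b, (forall h, 0 < h <= h0 -> `|q + a * h| - `|q| = b * h) ->
    0 <= a * my + eta * b * ml.
  move=> h00 a1 b hb; rewrite -mean; apply: (@mean_ge0 _ _ h0) => // [i|h hh].
    exact: ltW.
  have := foc (a * h); rewrite hb // => /le_trans; apply.
  rewrite le_eqVlt; apply/orP; left; apply/eqP; apply: eq_bigr => i _.
  by congr (_ * expR _); ring.
pose kap := my / ml.
have kml : kap * ml = my by rewrite /kap divfK // gt_eqF.
have [kb kq] : `|kap| <= eta /\ q * kap = - (eta * `|q|).
  have [q0|q0|q0] := ltgtP q 0.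
  - have h1 := @side 1 (- q) _ (normr1 _) (-1); have h2 := @side (-1) 1 ltr01 (normrN1 _) 1.
    have /eqP : kap * ml = eta * ml.
      apply/eqP; rewrite eq_le; apply/andP; split; rewrite kml.
        have : 0 <= -1 * my + eta * 1 * ml.
          apply: h2 => h /andP[h_0 _]; rewrite !ltr0_norm //; first by ring.
          by rewrite mulN1r subr_lt0 (lt_trans q0).
        lra.
      have : 0 <= 1 * my + eta * -1 * ml.
        apply: h1; first by rewrite oppr_gt0.
        move=> h /andP[h_0 hq]; rewrite mul1r (ler0_norm (ltW q0)) ler0_norm; first by ring.
        by lra.
      lra.
    rewrite -subr_eq0 -mulrBl mulf_eq0 (gt_eqF ml0) orbF subr_eq0 => /eqP ->.
    by rewrite (ltr0_norm q0) gtr0_norm //; split => //; ring.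
  - have h1 := @side 1 1 ltr01 (normr1 _) 1; have h2 := @side (-1) q q0 (normrN1 _) (-1).
    have /eqP : kap * ml = - eta * ml.
      apply/eqP; rewrite eq_le; apply/andP; split; rewrite kml.
        have : 0 <= -1 * my + eta * -1 * ml.
          apply: h2 => h /andP[h_0 hq]; rewrite (gtr0_norm q0) ger0_norm; first by ring.
          by rewrite mulN1r subr_ge0.
        lra.
      have : 0 <= 1 * my + eta * 1 * ml.
        apply: h1 => h /andP[h_0 hq]; rewrite !gtr0_norm //; first by ring.
        by rewrite mul1r addr_gt0.
      lra.
    rewrite -subr_eq0 -mulrBl mulf_eq0 (gt_eqF ml0) orbF subr_eq0 => /eqP ->.
    by rewrite normrN (gtr0_norm q0) gtr0_norm //; split => //; ring.
  - split; last by rewrite q0 normr0; ring.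
    have h1 : 0 <= 1 * my + eta * 1 * ml.
      apply: (@side 1 1 ltr01 (normr1 _) 1) => h /andP[h_0 _].
      by rewrite q0 normr0 !mul1r add0r subr0 gtr0_norm.
    have h2 : 0 <= -1 * my + eta * 1 * ml.
      apply: (@side (-1) 1 ltr01 (normrN1 _) 1) => h /andP[h_0 _].
      by rewrite q0 normr0 mulN1r add0r subr0 normrN mul1r gtr0_norm.
    by rewrite ler_norml /kap ler_pdivlMr // ler_pdivrMr //; apply/andP; split; lra.
exists pi, (- kap), q; split=> //; first by rewrite normrN.
- transitivity (\sum_i pi i * (1 * Y i + (- kap) * l i)).
    by apply: eq_bigr => i _; rewrite /Y /l; ring.
  by rewrite mean mulNr kml; ring.
- move=> i; rewrite ler_pdivrMr // -[leLHS]mulr1 ler_pM ?expR_ge0//.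
  rewrite ler_expR /ex /l /Y.
  have -> : q * (ln (p i) - (al - kap) * ln (r i)) = q * (ln (p i) - al * ln (r i)) + (q * kap) * ln (r i) by ring.
  by rewrite kq le_eqVlt; apply/orP; left; apply/eqP; ring.
Qed.

Fixpoint words n : seq (seq 'I_N) :=
  if n is n'.+1 then [seq i :: w | i <- enum 'I_N, w <- words n'] else [:: [::]].

Lemma words_size n w : w \in words n -> size w = n.
Proof.
elim: n w => [|n IH] w; first by rewrite inE => /eqP->.
by move=> /allpairsP[[i v] /= [_ /IH sv ->]] /=; rewrite sv.
Qed.

Lemma words_uniq n : uniq (words n).
Proof.
elim: n => // n IH; apply: allpairs_uniq => //; first exact: enum_uniq.
by move=> [i v] [j w] _ _ /= [-> ->].
Qed.

Lemma sum_words n (F : seq 'I_N -> R) :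
  \sum_(w <- words n.+1) F w = \sum_i \sum_(w <- words n) F (i :: w).
Proof. by rewrite /= big_allpairs_dep big_enum. Qed.

(** Chebyshev's inequality for a centred additive functional of a word. *)
Lemma words_chebyshev (pi X : 'I_N -> R) n del : (forall i, 0 <= pi i) ->
  \sum_i pi i = 1 -> \sum_i pi i * X i = 0 -> 0 < del -> (0 < n)%N ->
  1 - (\sum_i pi i * X i ^+ 2) / (del ^+ 2 * n%:R) <=
  \sum_(w <- [seq w <- words n | `|\sum_(i <- w) X i| <= del * n%:R]) wt pi w.
Proof.
move=> pi0 pi1 X0 del0 n0; set V := \sum_i _; pose XX w := \sum_(i <- w) X i.
have XXc i w : XX (i :: w) = X i + XX w by rewrite /XX big_cons.
have A k : \sum_(w <- words k) wt pi w = 1.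
  elim: k => [|k IH]; first by rewrite big_seq1 wt_nil.
  rewrite sum_words -[RHS]pi1; apply: eq_bigr => i _.
  by under eq_bigr do rewrite wt_cons; rewrite -big_distrr /= IH mulr1.
have B k : \sum_(w <- words k) wt pi w * XX w = 0.
  elim: k => [|k IH]; first by rewrite big_seq1 /XX big_nil mulr0.
  rewrite sum_words -[RHS]X0; apply: eq_bigr => i _.
  transitivity (pi i * X i * (\sum_(w <- words k) wt pi w) + pi i * (\sum_(w <- words k) wt pi w * XX w)).
    rewrite !big_distrr -big_split /=; apply: eq_bigr => w _.
    by rewrite wt_cons XXc; ring.
  by rewrite A IH; ring.
have C k : \sum_(w <- words k) wt pi w * XX w ^+ 2 = k%:R * V.
  elim: k => [|k IH]; first by rewrite big_seq1 /XX big_nil expr0n /= mulr0 mul0r.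
  rewrite sum_words.
  transitivity (\sum_i (pi i * X i ^+ 2 + pi i * (k%:R * V))).
    apply: eq_bigr => i _.
    transitivity (pi i * X i ^+ 2 * (\sum_(w <- words k) wt pi w)
      + 2 * (pi i * X i) * (\sum_(w <- words k) wt pi w * XX w)
      + pi i * (\sum_(w <- words k) wt pi w * XX w ^+ 2)).
      rewrite !big_distrr -!big_split /=; apply: eq_bigr => w _.
      by rewrite wt_cons XXc; ring.
    by rewrite A B IH; ring.
  by rewrite big_split /= -big_distrl /= pi1 -/V -natr1; ring.
have dn0 : 0 < del ^+ 2 * n%:R ^+ 2 by rewrite mulr_gt0 ?exprn_gt0// ltr0n.
have wt0 w : 0 <= wt pi w by apply: prodr_ge0.
have bad : \sum_(w <- words n | ~~ (`|XX w| <= del * n%:R)) wt pi w <= V / (del ^+ 2 * n%:R).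
  apply: (@le_trans _ _ (\sum_(w <- words n) wt pi w * XX w ^+ 2 / (del ^+ 2 * n%:R ^+ 2))).
    rewrite big_mkcond /=; apply: ler_sum => w _; case: ifP => [|_]; last first.
      by rewrite divr_ge0 ?(ltW dn0)// mulr_ge0 // sqr_ge0.
    rewrite -ltNge => lt; rewrite ler_pdivlMr // ler_wpM2l // -exprMn.
    rewrite -[leRHS]real_normK ?num_real// ler_pXn2r ?nnegrE ?mulr_ge0 ?(ltW del0)//.
    exact: ltW.
  rewrite -big_distrl /= C le_eqVlt; apply/orP; left; apply/eqP.
  by field; rewrite pnatr_eq0 -lt0n n0 gt_eqF.
rewrite big_filter lerBlDr -[leLHS](A n) (bigID (fun w => `|XX w| <= del * n%:R)) /=.
by rewrite lerD2l.
Qed.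

Lemma wt_powRs s w : wt r w `^ s = expR (- (s * lr w)).
Proof. by rewrite /powR gt_eqF // /lr mulrN opprK. Qed.

(** By the law of large numbers at least half of the tilted mass sits on the words
    of length [n] with exponent close to [al], and on them the tilted weight is at
    most [wt r w `^ s'] up to a factor that is exponential in [n] with a small rate.
    Passing from [s'] to [s] gains an exponential factor with a larger rate, which
    also pays for appending [w0]. *)
Lemma blocks_rich al s s' eta : amin <= al <= amax -> 0 < eta -> 0 <= s < s' ->
  (forall q, s' <= al * q + beta q) ->
  exists l W, blocks al eta l W /\ 2 <= \sum_(w <- W) wt r w `^ s.
Proof.
move=> hal eta0 /andP[s0 ss] hs; have eta4 : 0 < eta / 4 by rewrite divr_gt0.
have [pi [kap [q [pi0 pi1 hk mean0 pile]]]] := tilted_weights hal eta4 hs.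
pose X i := ln (p i) - (al + kap) * ln (r i).
pose V := \sum_i pi i * X i ^+ 2.
have V0 : 0 <= V by apply: sumr_ge0 => i _; rewrite mulr_ge0 ?sqr_ge0// ltW.
have XE w : \sum_(i <- w) X i = - lp w + (al + kap) * lr w.
  elim: w => [|i w IH]; first by rewrite big_nil lp_nil lr_nil; ring.
  by rewrite big_cons IH lp_cons lr_cons /X; ring.
have piE w : wt pi w <= expR (- (s' * lr w) + q * \sum_(i <- w) X i).
  elim: w => [|i w IH]; first by rewrite wt_nil big_nil lr_nil !mulr0 oppr0 addr0 expR0.
  rewrite wt_cons big_cons lr_cons.
  have -> : - (s' * (- ln (r i) + lr w)) + q * (X i + \sum_(j <- w) X j) =
      (s' * ln (r i) + q * X i) + (- (s' * lr w) + q * \sum_(j <- w) X j) by ring.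
  rewrite expRD ler_pM ?(ltW (pi0 i)) ?pile//.
  by apply/ltW/wt_gt0.
pose g := (s' - s) * lam.
have g0 : 0 < g by rewrite mulr_gt0 // subr_gt0.
pose del := Num.min (eta / 4 * lam) (g / 2 / (`|q| + 1)).
have q1 : 0 < `|q| + 1 by rewrite ltr_wpDl.
have del0 : 0 < del by rewrite lt_min mulr_gt0 // divr_gt0 // divr_gt0.
have del1 : del <= eta / 4 * lam by rewrite /del ge_min lexx.
have del2 : `|q| * del <= g / 2.
  apply: (@le_trans _ _ ((`|q| + 1) * del)).
    by rewrite ler_wpM2r ?(ltW del0)// lerDl.
  by rewrite mulrC -ler_pdivlMr // /del ge_min lexx orbT.
pose C0 := `|lp w0 - al * lr w0|.
pose E0 := expR (s * lr w0).
(* Three lower bounds for [n]: for Chebyshev's inequality to leave half of the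
   mass, for the deviation of [w0] to be negligible, and for the exponential gain
   to exceed [4 * E0]. *)
pose A := V / del ^+ 2 * 2 + 2 * C0 / (eta * lam) + 8 * E0 / g.
have el0 : 0 < eta * lam by rewrite mulr_gt0.
have A1 : 0 <= V / del ^+ 2 * 2 by rewrite mulr_ge0 // divr_ge0 // exprn_ge0 // ltW.
have A2 : 0 <= 2 * C0 / (eta * lam) by rewrite divr_ge0 ?(ltW el0)// mulr_ge0 // /C0 normr_ge0.
have A3 : 0 <= 8 * E0 / g by rewrite divr_ge0 ?(ltW g0)// mulr_ge0 // expR_ge0.
pose n := (Num.truncn A).+1; have nA : A < n%:R by exact: truncnS_gt.
have n0 : 0 < n%:R :> R by rewrite ltr0n.
have half : 2^-1 <= \sum_(w <- [seq w <- words n | `|\sum_(i <- w) X i| <= del * n%:R]) wt pi w.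
  have := @words_chebyshev pi X n del (fun i => ltW (pi0 i)) pi1 mean0 del0 isT.
  apply: le_trans; rewrite -/V lerBrDr -lerBrDl.
  have d20 : 0 < del ^+ 2 by rewrite exprn_gt0.
  rewrite (_ : 1 - 2^-1 = 2^-1); last by field.
  rewrite ler_pdivrMr ?mulr_gt0// mulrA mulrC.
  have : V / del ^+ 2 * 2 <= n%:R by rewrite /A in nA; lra.
  move=> h; have := ler_wpM2r (ltW d20) h; rewrite mulrAC divfK ?gt_eqF//; lra.
pose U := [seq w <- words n | `|\sum_(i <- w) X i| <= del * n%:R].
rewrite -/U in half.
have UP u : u \in U -> size u = n /\ `|\sum_(i <- u) X i| <= del * n%:R.
  by rewrite mem_filter => /andP[? /words_size].
have inj : injective (cat^~ w0 : seq 'I_N -> seq 'I_N).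
  move=> a b ab; have sab : size a = size b.
    by move: (congr1 size ab); rewrite !size_cat => /addIn.
  by move/eqP: ab; rewrite eqseq_cat // => /andP[/eqP].
exists (n + size w0)%N, (map (cat^~ w0) U); split.
  split=> //.
  - by rewrite map_inj_uniq // filter_uniq // words_uniq.
  - apply/eqP => /(congr1 size); rewrite size_map /= => /size0nil U0.
    by move: half; rewrite U0 big_nil; lra.
  - move=> _ /mapP[u /UP[su hu] ->]; split; [by rewrite size_cat su|by exists u|].
    have ln : n%:R * lam <= lr u by rewrite -su lr_ge.
    rewrite lp_cat lr_cat.
    have -> : lp u + lp w0 - al * (lr u + lr w0) =
      - (\sum_(i <- u) X i) + kap * lr u + (lp w0 - al * lr w0) by rewrite XE; ring.
    rewrite (le_trans (ler_normD _ _))// mulrDr.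
    have h1 : `|- \sum_(i <- u) X i + kap * lr u| <= eta / 4 * lr u + eta / 4 * lr u.
      rewrite (le_trans (ler_normD _ _))// normrN lerD //.
        rewrite (le_trans hu) // (@le_trans _ _ (eta / 4 * lam * n%:R))//.
          by rewrite ler_wpM2r.
        by rewrite -mulrA ler_wpM2l ?(ltW eta4)// mulrC.
      by rewrite normrM (ger0_norm (lr_ge0 u)) ler_wpM2r ?lr_ge0.
    have h2 : C0 <= eta / 2 * lr u.
      have : 2 * C0 / (eta * lam) <= n%:R by rewrite /A in nA; lra.
      rewrite ler_pdivrMr //; have := ler_wpM2l (ltW eta0) ln; lra.
    have h3 : 0 <= eta * lr w0 by rewrite mulr_ge0 ?lr_ge0 ?ltW.
    by rewrite /C0 in h2; lra.
rewrite big_map.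
apply: (@le_trans _ _ (\sum_(u <- U) wt pi u * (4 : R))).
  by rewrite -big_distrl /=; lra.
rewrite big_seq [leRHS]big_seq; apply: ler_sum => u /UP[su hu].
have ln : n%:R * lam <= lr u by rewrite -su lr_ge.
rewrite wt_powRs lr_cat (mulrDr s) opprD expRD.
have qX : q * \sum_(i <- u) X i <= g / 2 * n%:R.
  rewrite (le_trans (ler_norm _)) // normrM (@le_trans _ _ (`|q| * (del * n%:R)))//.
    by rewrite ler_wpM2l.
  by rewrite mulrA ler_wpM2r.
have E4 : 4 * E0 <= expR (g / 2 * n%:R).
  apply: le_trans (expR_ge1Dx _).
  have : 8 * E0 / g <= n%:R by rewrite /A in nA; lra.
  by rewrite ler_pdivrMr //; lra.
apply: (@le_trans _ _ (expR (- (s' * lr u) + g / 2 * n%:R) * 4)).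
  by rewrite ler_wpM2r // (le_trans (piE u)) // ler_expR lerD2l.
have -> : expR (- (s * lr w0)) = E0^-1 by rewrite expRN.
rewrite ler_pdivlMr ?expR_gt0// -[leLHS]mulrA (@le_trans _ _ (expR (- (s' * lr u) + g / 2 * n%:R) * expR (g / 2 * n%:R)))//.
  by rewrite ler_wpM2l // expR_ge0.
rewrite -expRD ler_expR.
have : (s' - s) * (n%:R * lam) <= (s' - s) * lr u by rewrite ler_wpM2l // subr_ge0 ltW.
by rewrite /g; lra.
Qed.

(** * Concatenations of blocks *)

Fixpoint concats (W : seq (seq 'I_N)) k : seq (seq 'I_N) :=
  if k is k'.+1 then [seq w ++ v | w <- W, v <- concats W k'] else [:: [::]].

Lemma concatsP g eta l W k v : blocks g eta l W -> v \in concats W k ->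
  [/\ size v = (k * l)%N, `|lp v - g * lr v| <= eta * lr v &
      (0 < k)%N -> exists u, v = u ++ w0].
Proof.
move=> [_ _ _ hW]; elim: k v => [|k IH] v.
  by rewrite inE => /eqP->; rewrite lp_nil lr_nil !mulr0 subr0 normr0.
move=> /allpairsP[[w v'] /= [/hW[sw' [u wE] hw] /IH[sv hv ev] ->]]; split.
- by rewrite size_cat sw' sv mulSn.
- rewrite lp_cat lr_cat mulrDr opprD addrACA (le_trans (ler_normD _ _))//.
  by rewrite mulrDr lerD.
move=> _; case: k {IH} sv ev => [|k] sv ev.
  by exists u; move/size0nil: sv => ->; rewrite cats0.
by have [//|u' ->] := ev; exists (w ++ u'); rewrite catA.
Qed.

Lemma concats_uniq g eta l W k : blocks g eta l W -> uniq (concats W k).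
Proof.
move=> [_ uW _ hW]; elim: k => //= k IH; apply: allpairs_uniq => //.
move=> [w v] [w' v'] /allpairsP[[w1 v1] /= [/hW[sw' _ _] _ [-> ->]]].
move=> /allpairsP[[w2 v2] /= [/hW[sw2 _ _] _ [-> ->]]] /= /eqP.
by rewrite eqseq_cat ?sw'// => /andP[/eqP-> /eqP->].
Qed.

Lemma concats_neq0 W k : W != [::] -> concats W k != [::].
Proof.
by case: W => // w W _; elim: k => //= k; case: (concats _ k).
Qed.

Lemma concats_sum s W k :
  \sum_(v <- concats W k) wt r v `^ s = (\sum_(w <- W) wt r w `^ s) ^+ k.
Proof.
elim: k => [|k IH]; first by rewrite big_seq1 wt_nil powR1 expr0.
rewrite /= big_allpairs_dep exprS -IH big_distrl /=; apply: eq_bigr => w _.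
rewrite big_distrr /=; apply: eq_bigr => v _.
by rewrite wt_cat powRM // ltW.
Qed.

(** The longest initial part that consists of whole blocks. *)
Lemma concats_take g eta l W k v j : blocks g eta l W -> v \in concats W k ->
  (j <= size v)%N -> exists k' v1 v2,
    [/\ take j v = v1 ++ v2, v1 \in concats W k' & (size v2 < l)%N].
Proof.
move=> bW; have [l0 _ _ hW] := bW; elim: k v j => [|k IH] v j.
  by rewrite inE => /eqP-> _; exists 0%N, [::], [::].
move=> /allpairsP[[w v'] /= [wW v'k ->]]; have [sw' _ _] := hW w wW.
rewrite size_cat sw' take_cat sw' => jl; case: ltnP => jl'.
  exists 0%N, [::], (take j w); split=> //; rewrite size_take sw' jl' //.
have [|k' [v1 [v2 [E v1k v2l]]]] := IH v' (j - l)%N v'k; first by rewrite leq_subLR.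
exists k'.+1, (w ++ v1), v2; split=> //; first by rewrite E catA.
by apply/allpairsP; exists (w, v1).
Qed.

Lemma take_mkseq (om : nat -> 'I_N) i j : (i <= j)%N ->
  take i (mkseq om j) = mkseq om i.
Proof. by move=> ij; rewrite /mkseq -map_take take_iota (minn_idPl ij). Qed.

Lemma mkseq_split (om : nat -> 'I_N) i j : (i <= j)%N ->
  exists2 v, size v = (j - i)%N & mkseq om j = mkseq om i ++ v.
Proof.
move=> ij; exists (drop i (mkseq om j)); first by rewrite size_drop size_mkseq.
by rewrite -(take_mkseq om ij) cat_take_drop.
Qed.

Lemma closed_sw w (A : set 'rV[R]_d) : closed A -> closed (sw w @` A).
Proof.
move=> cA; rewrite -[sw w @` A]setCK; apply: open_closedC; apply: eball_open.
move=> y Ay; have [z zE] := sw_surj w y.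
have nAz : (~` A) z by move=> Az; apply: Ay; exists z.
have [e e0 he] := open_eballP (closed_openC cA) nAz.
exists (wt r w * e); first exact: mulr_gt0.
move=> y'; have [z' <-] := sw_surj w y'; rewrite -zE sw_sim ltr_pM2l // => /he nA.
by move=> [z2 Az2 /sw_inj z2E]; apply: nA; rewrite -z2E.
Qed.

Lemma point_exists (om : nat -> 'I_N) : exists x, K x /\
  forall k, (sw (mkseq om k) @` K) x.
Proof.
have [[z Kz] cK _] := hK; pose y k := sw (mkseq om k) z.
have [|x [Kx cx]] := cK (y k @[k --> \oo]) _.
  by exists 0%N => // k _; exact: K_sw.
exists x; split=> // k; have clK : closed K by apply: compact_closed.
have := @closed_sw (mkseq om k) _ clK; apply=> B xB.
have [|t [At Bt]] := cx (sw (mkseq om k) @` K) B _ xB; last by exists t.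
exists k => // j /= kj; have [v _ E] := mkseq_split om kj.
by exists (sw v z); [exact: K_sw|rewrite /y E sw_cat].
Qed.

(** * The tree of codes *)

Section Tree.
Context (a b : R) (ha : amin <= a) (hb : b <= amax).
Context (g : nat -> R) (l : nat -> nat) (W : nat -> seq (seq 'I_N)) (c1 : nat).
Context (hg : forall k, a <= g k <= b).
Context (hW : forall k, blocks (g k) k.+1%:R^-1 (l k) (W k)) (c1_gt0 : (0 < c1)%N).

(** Stage [k] consists of [stages k] blocks of [W k] and ends at the position
    [len k.+1]. There are so many that everything before, and one block of the
    next stage, are negligible. The factor [c1] makes the power sum of the stage
    outweigh the ratio of the word before it. *)
Fixpoint len k : nat :=
  if k is k'.+1 then (len k' + c1 * k'.+1 * (len k' + l k + 1) * l k')%N else 0%N.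

Definition stages k := (c1 * k.+1 * (len k + l k.+1 + 1))%N.

Lemma lenS k : len k.+1 = (len k + stages k * l k)%N. Proof. by []. Qed.

Lemma l_gt0 k : (0 < l k)%N. Proof. by have [] := hW k. Qed.

Lemma stages_ge k : (k.+1 * (len k + l k.+1 + 1) <= stages k)%N.
Proof. by rewrite /stages -mulnA leq_pmull. Qed.

Lemma stages_gt0 k : (0 < stages k)%N.
Proof. by rewrite (leq_trans _ (stages_ge k)) // muln_gt0 /= addn1. Qed.

Lemma len_ge k : (k.+1 * (len k + l k.+1 + 1) <= len k.+1)%N.
Proof.
rewrite (leq_trans (stages_ge k)) // lenS (leq_trans _ (leq_addl _ _)) //.
by rewrite leq_pmulr // l_gt0.
Qed.

Lemma len_gtS k : (k < len k.+1)%N.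
Proof. by rewrite (leq_trans _ (len_ge k)) // leq_pmulr // addn1. Qed.

Lemma len_leS k : (len k <= len k.+1)%N. Proof. by rewrite lenS leq_addr. Qed.

Lemma len_mono : {homo len : i j / (i <= j)%N}.
Proof. by apply: homo_leq => //; [exact: leq_trans|exact: len_leS]. Qed.

Fixpoint nodes k : seq (seq 'I_N) :=
  if k is k'.+1 then [seq t ++ v | t <- nodes k', v <- concats (W k') (stages k')]
  else [:: [::]].

Lemma nodesS k w : w \in nodes k.+1 -> exists t v,
  [/\ t \in nodes k, v \in concats (W k) (stages k) & w = t ++ v].
Proof. by move=> /allpairsP[[t v] /= [tk vW ->]]; exists t, v. Qed.

Lemma nodes_size k t : t \in nodes k -> size t = len k.
Proof.
elim: k t => [|k IH] t; first by rewrite inE => /eqP->.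
move=> /nodesS[t' [v [/IH sz /(concatsP (hW k))[sv _ _] ->]]].
by rewrite size_cat sz sv.
Qed.

Lemma nodes_take i j t : (i <= j)%N -> t \in nodes j -> take (len i) t \in nodes i.
Proof.
elim: j t => [|j IH] t; first by rewrite leqn0 => /eqP-> zj; rewrite take0.
rewrite leq_eqVlt => /orP[/eqP->|ij] zj.
  by rewrite take_oversize // (nodes_size zj).
have [t' [v [z'j _ ->]]] := nodesS zj.
rewrite takel_cat; first exact: IH.
by rewrite (nodes_size z'j); apply: len_mono.
Qed.

Lemma nodes_extend i j t : (i <= j)%N -> t \in nodes i ->
  exists2 t', t' \in nodes j & prefix t t'.
Proof.
move=> ij zi; elim: j ij => [|j IH].
  by rewrite leqn0 => /eqP i0; exists t; rewrite -?i0// prefix_refl.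
rewrite leq_eqVlt => /orP[/eqP ij|ij].
  by exists t; rewrite -?ij// prefix_refl.
have [t' z'j zz'] := IH ij.
have [_ _ W0 _] := hW j; have := @concats_neq0 _ (stages j) W0.
case vE : (concats _ _) => [//|v V] _.
exists (t' ++ v); last by rewrite (prefix_trans zz') // prefix_prefix.
by apply/allpairsP; exists (t', v); rewrite /= z'j vE mem_head.
Qed.

Definition is_code (om : nat -> 'I_N) := forall k, mkseq om (len k) \in nodes k.

(** The bound for the pieces that are short compared with the whole word. *)
Lemma crude_deviation e w : 0 <= e <= amax ->
  `|lp w - e * lr w| <= amax * Lam * (size w)%:R.
Proof.
move=> /andP[e0 e1]; have := lp_ge0 w; have := lp_le w; rewrite mulrC => h1 h2.
have h3 : 0 <= e * lr w by rewrite mulr_ge0 ?lr_ge0.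
have h4 : e * lr w <= amax * Lam * (size w)%:R.
  by rewrite -mulrA ler_pM ?lr_ge0// mulrC lr_le.
by rewrite ler_norml; apply/andP; split; lra.
Qed.

Definition C2 : R := 1 + amax * Lam / lam.

Let AL := amax * Lam.
Let AL0 : 0 <= AL. Proof. by rewrite mulr_ge0 // ltW. Qed.

(** The stage that has just ended fills all but a fraction [1 / k.+1] of the
    word. *)
Lemma stage_end om k : is_code om ->
  `|lp (mkseq om (len k.+1)) - g k * lr (mkseq om (len k.+1))| <=
  C2 / k.+1%:R * lr (mkseq om (len k.+1)).
Proof.
move=> /(_ k.+1); move E : (mkseq om _) => w wk.
have sw' : size w = len k.+1 by exact: nodes_size.
have lw := lr_ge w; rewrite sw' in lw; move: wk lw.
move=> /nodesS[t [v [zk /(concatsP (hW k))[sv hv _] ->]]].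
rewrite lp_cat lr_cat => lw.
have /andP[ga gb] := hg k.
have gz : `|lp t - g k * lr t| <= AL * (len k)%:R.
  rewrite -(nodes_size zk); apply: crude_deviation.
  by rewrite (le_trans gb hb) (le_trans (ltW amin_gt0)) // (le_trans ha).
have k0' : 0 < k.+1%:R :> R by rewrite ltr0n.
have lk : (len k)%:R <= (lr t + lr v) / lam / k.+1%:R.
  rewrite ler_pdivlMr // ler_pdivlMr // (le_trans _ lw)// ler_wpM2r ?(ltW lam_gt0)//.
  rewrite -natrM ler_nat (leq_trans _ (len_ge k)) // mulnC leq_mul //.
  by rewrite -addnA leq_addr.
rewrite mulrDr opprD addrACA (le_trans (ler_normD _ _))//.
have h1 := ler_wpM2l AL0 lk.
have h2 : k.+1%:R^-1 * lr v <= k.+1%:R^-1 * (lr t + lr v).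
  by rewrite ler_wpM2l // lerDr lr_ge0.
rewrite (_ : C2 / _ * _ = AL * ((lr t + lr v) / lam / k.+1%:R) + k.+1%:R^-1 * (lr t + lr v)).
  by rewrite (le_trans (lerD gz hv)) // lerD.
by rewrite /C2 /AL; ring.
Qed.

(** The last complete stage together with the complete blocks of the current
    one fill all but a fraction [1 / k.+1] of the word; their exponents are
    close to [g k] and [g k.+1], both in [[a, b]]. They end with [w0], which
    makes the mass of small balls computable. *)
Lemma stage_middle om k n : is_code om -> (len k.+1 <= n <= len k.+2)%N ->
  [/\ (a - C2 / k.+1%:R) * lr (mkseq om n) <= lp (mkseq om n),
      lp (mkseq om n) <= (b + C2 / k.+1%:R) * lr (mkseq om n) &
      exists u v, mkseq om n = (u ++ w0) ++ v /\ (size v * k.+1 <= n)%N].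
Proof.
move=> om_code /andP[n1 n2].
have := om_code k.+2; have := take_mkseq om n2; move: (mkseq om (len k.+2)) => w.
move=> wn /nodesS[t [v [zk vW wE]]]; rewrite -{}wn {w}wE.
have sz := nodes_size zk; rewrite take_cat sz ltnNge n1 /=.
have [sv _ _] := concatsP (hW k.+1) vW.
have [|k' [v1 [v2 [vE v1k v2l]]]] := concats_take (j := (n - len k.+1)%N) (hW k.+1) vW.
  by rewrite sv leq_subLR -lenS.
have sn : size (t ++ take (n - len k.+1) v) = n.
  rewrite size_cat sz size_take_min sv (minn_idPl _) ?subnKC//.
  by rewrite leq_subLR -lenS.
have ln := lr_ge (t ++ take (n - len k.+1) v); rewrite sn in ln.
move: sn ln zk; rewrite vE => sn ln /nodesS[t' [v' [zk v'k zE]]].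
have [_ hv' ev'] := concatsP (hW k) v'k; have [_ hv1 ev1] := concatsP (hW k.+1) v1k.
have v2n : (size v2 * k.+1 <= n)%N.
  rewrite (leq_trans _ n1) // (leq_trans _ (len_ge k)) // mulnC leq_mul //.
  by rewrite (leq_trans (ltnW v2l)) // addn1 leqW // leq_addl.
split; last first.
- have [u' uE] := ev' (stages_gt0 k).
  case: k' v1k ev1 {hv1} => [|k'] v1k ev1.
    move: v1k; rewrite inE => /eqP ->; exists (t' ++ u'), v2; split=> //.
    by rewrite zE uE /= -!catA.
  by have [//|u1 ->] := ev1; exists (t ++ u1), v2; split=> //; rewrite !catA.
all: have k0' : 0 < k.+1%:R :> R by rewrite ltr0n.
all: have [tot totE] : exists tot, tot = lr t' + lr v' + (lr v1 + lr v2) by eexists.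
all: move: ln; rewrite zE !lp_cat !lr_cat -totE => ln.
all: have lk : (len k)%:R + (size v2)%:R <= tot / lam / k.+1%:R.
1,3: rewrite ler_pdivlMr // ler_pdivlMr // (le_trans _ ln)// ler_wpM2r ?(ltW lam_gt0)//.
1,2: rewrite -natrD -natrM ler_nat (leq_trans _ n1) // (leq_trans _ (len_ge k)) // mulnC leq_mul //.
1,2: by rewrite addn1 leqW // leq_add2l ltnW.
all: have h1 := ler_wpM2l AL0 lk.
all: have /andP[ga gb] := hg k; have /andP[ga' gb'] := hg k.+1.
all: have a01 : 0 <= a <= amax by rewrite (le_trans (ltW amin_gt0) ha) (le_trans _ hb) // (le_trans ga).
all: have b01 : 0 <= b <= amax by rewrite hb andbT (le_trans _ gb) // (le_trans _ ga) // (le_trans _ ha) // ltW.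
all: have ik : k.+2%:R^-1 <= k.+1%:R^-1 :> R by rewrite lef_pV2 ?posrE ?ltr0n// ler_nat.
all: have h2 := ler_wpM2r (lr_ge0 v1) ik.
all: have h3 : k.+1%:R^-1 * (lr v' + lr v1) <= k.+1%:R^-1 * tot.
1,3: rewrite ler_wpM2l // totE; have := lr_ge0 t'; have := lr_ge0 v2; lra.
all: have CE : C2 / k.+1%:R * tot = AL * (tot / lam / k.+1%:R) + k.+1%:R^-1 * tot.
1,3: by rewrite /C2 /AL; ring.
all: have tE e : e * tot = e * lr t' + e * lr v' + (e * lr v1 + e * lr v2) by rewrite totE; ring.
- rewrite [leRHS]mulrDl CE; have := crude_deviation t' b01; have := crude_deviation v2 b01.
  rewrite (nodes_size zk) -/AL !ler_norml => /andP[_ c2] /andP[_ c1'].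
  move: hv' hv1; rewrite !ler_norml => /andP[_ d1] /andP[_ d2].
  have e1 := ler_wpM2r (lr_ge0 v') gb; have e2 := ler_wpM2r (lr_ge0 v1) gb'.
  rewrite (tE b); move: h1 h2 h3 c2 c1' d1 d2 e1 e2.
  by move: (tot / _ / _) => X; move: (_^-1) (_^-1) => k1 k2; lra.
- rewrite mulrBl CE; have := crude_deviation t' a01; have := crude_deviation v2 a01.
  rewrite (nodes_size zk) -/AL !ler_norml => /andP[c2 _] /andP[c1' _].
  move: hv' hv1; rewrite !ler_norml => /andP[d1 _] /andP[d2 _].
  have e1 := ler_wpM2r (lr_ge0 v') ga; have e2 := ler_wpM2r (lr_ge0 v1) ga'.
  rewrite (tE a); move: h1 h2 h3 c2 c1' d1 d2 e1 e2.
  by move: (tot / _ / _) => X; move: (_^-1) (_^-1) => k1 k2; lra.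
Qed.

(** The ball of radius [t] contains the cylinder of a slightly longer word of the
    code, and its mass is at most the weight of the slightly shorter word [u]
    such that [u ++ w0] is a prefix of the code. The two logarithmic weights
    differ by a fraction of order [1 / k.+1]. *)
Lemma D_approx : exists2 C3, 0 <= C3 & forall om x k n t, is_code om ->
  (forall j, (sw (mkseq om j) @` K) x) -> (len k.+1 <= n <= len k.+2)%N ->
  wt r (mkseq om n.+1) < t <= wt r (mkseq om n) ->
  `|D x t - lp (mkseq om n) / lr (mkseq om n)| <= C3 / k.+1%:R.
Proof.
(* After [h] more letters a cylinder meeting the centre fits into the ball. *)
have [h hh] : exists h, rmax ^+ h <= (1 + 2 * c0)^-1.
  by apply: expr_small; rewrite ?rmax_lt1 ?(ltW rmax_gt0)// k0_gt0.
have h2c : 2 * c0 * rmax ^+ h <= 1.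
  apply: le_trans k0_c0; rewrite ler_wpM2l // mulr_ge0 // ltW //.
pose A := lp w0 + h.+1%:R * AL.
have A0 : 0 <= A by rewrite addr_ge0 ?lp_ge0 // mulr_ge0.
have A2 : 0 <= A + AL + AL := addr_ge0 (addr_ge0 A0 AL0) AL0.
exists ((A + AL + AL) / lam); first by rewrite divr_ge0 // ltW.
move=> om x k n t om_code addr kn /andP[t1 t2].
have [_ _ [u [v [uvE vn]]]] := stage_middle om_code kn.
have /andP[n1 n2] := kn.
have t0 : 0 < t by apply: lt_trans t1.
pose P := lp (mkseq om n); pose L := lr (mkseq om n).
have Ln : n%:R * lam <= L by have := lr_ge (mkseq om n); rewrite size_mkseq.
have kn' : (k.+1 <= n)%N by rewrite (leq_trans _ n1) // len_gtS.
have n0 : 0 < n%:R :> R by rewrite ltr0n (leq_trans _ kn').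
have L0 : 0 < L by rewrite (lt_le_trans _ Ln) // mulr_gt0.
have lnt1 : L <= - ln t by rewrite lerN2 ler_ln ?posrE.
have lnt2 : - ln t <= L + Lam.
  have : lr (mkseq om n.+1) <= L + Lam.
    have [w sw1 ->] := mkseq_split om (leqnSn n); rewrite lr_cat lerD2l.
    by have := lr_le w; rewrite sw1 subSnn mul1r.
  apply: le_trans; rewrite lerN2 ler_ln ?posrE//; exact: ltW.
have lnt0 : 0 < - ln t by exact: lt_le_trans lnt1.
have PL : 0 <= P <= amax * L by rewrite lp_ge0; have /andP[] := lp_bounds (mkseq om n).
have t_1 : t <= 1 by rewrite (le_trans t2) // wtr_le1.
have xK : K x by have := addr 0%N => -[z Kz <-].
have up : - ln (m (eball x t)) <= P + h.+1%:R * AL.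
  have [w sw1 wE] := mkseq_split om (leq_addr h n.+1).
  have sE : size w = h by rewrite sw1 addKn.
  have [w1 sw2 w1E] := mkseq_split om (leqnSn n).
  have le : wt p (mkseq om (n.+1 + h)) <= m (eball x t).
    apply: m_ball_ge; first exact/image_sub_Q/addr.
    rewrite wE wt_cat mulrCA (le_trans _ (ltW t1)) // ler_piMr ?(ltW (wtr_gt0 _))//.
    rewrite (le_trans _ h2c) // ler_wpM2l ?mulr_ge0 ?(ltW c0_gt0)//.
    by rewrite -sE wtr_le_exp.
  have : - ln (m (eball x t)) <= lp (mkseq om (n.+1 + h)).
    by rewrite lerN2 ler_ln ?posrE// m_ball_gt0.
  rewrite wE w1E !lp_cat -/P.
  have := lp_le w; have := lp_le w1; rewrite sE sw2 subSnn -/AL -natr1; lra.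
have lo : P - lp w0 - (size v)%:R * AL <= - ln (m (eball x t)).
  have xu : (sw (u ++ w0) @` Q) x.
    have [z Kz zE] := addr n; exists (sw v z); first by apply: sw_Q; exact: K_Q.
    by rewrite -sw_cat -uvE.
  have le : m (eball x t) <= wt p u.
    apply: le_trans (m_ball_le_prefix xu); apply: m_le; try exact: measurable_eball.
    move=> y /le_trans; apply; rewrite (le_trans t2) // uvE wt_cat.
    by rewrite ler_piMr ?(ltW (wtr_gt0 _))// wtr_le1.
  have : lp u <= - ln (m (eball x t)) by rewrite lerN2 ler_ln ?posrE// m_ball_gt0.
  by rewrite /P uvE !lp_cat; have := lp_le v; rewrite -/AL; lra.
have vk : (size v)%:R <= n%:R / k.+1%:R :> R.
  by rewrite ler_pdivlMr ?ltr0n// -natrM ler_nat.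
have num : `|- ln (m (eball x t)) - (P / L) * - ln t| <= A + (size v)%:R * AL + AL.
  have e1 : `|- ln (m (eball x t)) - P| <= A + (size v)%:R * AL.
    have := lp_ge0 w0; have : 0 <= (size v)%:R * AL by rewrite mulr_ge0.
    have : 0 <= h.+1%:R * AL by rewrite mulr_ge0.
    by rewrite /A ler_norml => ? ? ?; apply/andP; split; lra.
  have e2 : `|(P / L) * (- ln t - L)| <= AL.
    have PL0 : 0 <= P / L by rewrite divr_ge0 ?lp_ge0 // ltW.
    rewrite normrM (ger0_norm PL0) ger0_norm ?subr_ge0// ler_pM ?subr_ge0//.
      by rewrite ler_pdivrMr //; have /andP[] := PL.
    by rewrite lerBlDr addrC.
  have -> : - ln (m (eball x t)) - (P / L) * - ln t =
     (- ln (m (eball x t)) - P) - (P / L) * (- ln t - L).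
    by rewrite [(P / L) * (_ - L)]mulrBr divfK ?gt_eqF//; ring.
  by rewrite (le_trans (ler_normB _ _)) // lerD.
have -> : D x t - P / L = (- ln (m (eball x t)) - (P / L) * - ln t) / - ln t.
  by rewrite DE [RHS]mulrBl mulfK // gt_eqF.
rewrite normrM normfV (gtr0_norm lnt0) ler_pdivrMr // (le_trans num) //.
have k1 : 0 < k.+1%:R :> R by rewrite ltr0n.
have big : n%:R / k.+1%:R * (A + AL + AL) <= (A + AL + AL) / lam / k.+1%:R * - ln t.
  have : n%:R * lam <= - ln t by exact: le_trans lnt1.
  have AA : 0 <= (A + AL + AL) / lam / k.+1%:R.
    by rewrite divr_ge0 // divr_ge0 // ltW.
  move=> /(ler_wpM2l AA); apply: le_trans; rewrite le_eqVlt; apply/orP; left; apply/eqP.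
  move: (lt0r_neq0 k1) (lt0r_neq0 lam_gt0); move: k.+1%:R => z *.
  by field; apply/andP; split.
apply: le_trans big.
have nk1 : 1 <= n%:R / k.+1%:R :> R by rewrite ler_pdivlMr // mul1r ler_nat.
have := ler_wpM2r AL0 vk; have := ler_wpM2r AL0 nk1; have := ler_wpM2r A0 nk1.
suff aux (z A' L' V : R) : 1 * A' <= z * A' -> 1 * L' <= z * L' -> V <= z * L' ->
    A' + V + L' <= z * (A' + L' + L') by move=> *; exact: aux.
by move=> *; lra.
Qed.

Lemma find_stage om k1 : exists2 del, 0 < del & forall t, 0 < t < del ->
  exists k n, [/\ (k1 <= k)%N, (len k.+1 <= n <= len k.+2)%N &
    wt r (mkseq om n.+1) < t <= wt r (mkseq om n)].
Proof.
exists (rmin ^+ len k1.+1); first exact: exprn_gt0.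
move=> t /andP[t0 td]; pose P k := wt r (mkseq om k) < t.
have exP : exists k, P k.
  have t20 : 0 < t / 2 by rewrite divr_gt0.
  have [|k hk] := @expr_small R rmax (t / 2) _ t20; first by rewrite rmax_lt1 ltW.
  exists k; rewrite /P (le_lt_trans (wtr_le_exp _)) // size_mkseq.
  by rewrite (le_lt_trans hk) // ltr_pdivrMr // mulr_natr mulr2n ltrDl.
case: (ex_minnP exP) => -[|n] Pn nmin.
  have : t < 1 by rewrite (lt_le_trans td) // exprn_ile1 // ltW.
  by move: Pn; rewrite /P wt_nil => /lt_trans h /h; rewrite ltxx.
have tn : t <= wt r (mkseq om n).
  by rewrite leNgt; apply/negP => /nmin; rewrite ltnn.
have nk1 : (len k1.+1 <= n)%N.
  rewrite leqNgt; apply/negP => nlt.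
  move: Pn; apply/negP; rewrite -leNgt (le_trans (ltW td)) //.
  apply: (@le_trans _ _ (rmin ^+ n.+1)).
    by rewrite ler_wiXn2l // ltW.
  by have := wtr_ge_exp (mkseq om n.+1); rewrite size_mkseq.
pose S' k := (len k.+1 <= n)%N.
have exS : exists k, S' k by exists k1.
have boundS k : S' k -> (k <= n)%N by apply: leq_trans; exact/ltnW/len_gtS.
case: (ex_maxnP exS boundS) => k Sk kmax; exists k, n; split.
- exact: kmax.
- apply/andP; split=> //.
  by rewrite ltnW // ltnNge; apply/negP => /kmax; rewrite ltnn.
- by rewrite tn andbT.
Qed.

Lemma acc_subset om x : is_code om -> (forall j, (sw (mkseq om j) @` K) x) ->
  accumulation_points mu x `<=` `[a, b]%classic.
Proof.
move=> om_code addr y /accP[y0 hy].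
have [C3 C30 hC] := D_approx.
suff h e : 0 < e -> a - e <= y <= b + e.
  rewrite /= in_itv /=; apply/andP; split; apply/ler_addgt0Pr => e e0.
    by have /andP[] := h e e0; lra.
  by have /andP[] := h e e0; lra.
move=> e0; have e20 : 0 < e / 2 by rewrite divr_gt0.
have C20 : 0 <= C2 by rewrite addr_ge0 // divr_ge0 ?(ltW lam_gt0).
have CC : 0 < C2 + C3 + 1 by rewrite ltr_wpDl // addr_ge0.
have [k1 _ hk1] := near_inv (divr_gt0 e20 CC).
have [del del0 hdel] := find_stage om k1.
have [t td yt] := hy (e / 2) del e20 del0.
have [k [n [kk kn wtn]]] := hdel t td.
have := hC om x k n t om_code addr kn wtn.
have [lo hi _] := stage_middle om_code kn.
have L0 : 0 < lr (mkseq om n).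
  rewrite (lt_le_trans _ (lr_ge _)) // size_mkseq mulr_gt0 // ltr0n.
  by case/andP: kn => + _; apply: leq_trans; rewrite (leq_trans _ (len_gtS k)).
rewrite -ler_pdivlMr // in lo; rewrite -ler_pdivrMr // in hi.
have ke : (C2 + C3) / k.+1%:R <= e / 2.
  have := hk1 k kk; rewrite ltr_pdivlMr // => /ltW; apply: le_trans.
  by rewrite mulrC ler_wpM2l // lerDl.
rewrite mulrDl in ke.
move: yt lo hi ke; rewrite ler_norml ltr_norml.
move: (C2 / _) (C3 / _) (lp _ / lr _) (D x t) => X Y Z' T.
by move=> /andP[y1 y2] lo hi ke /andP[z1 z2]; apply/andP; split; lra.
Qed.

(** The exponents at the ends of the stages with target [c] tend to [c]. *)
Lemma acc_target c om x : is_code om -> (forall j, (sw (mkseq om j) @` K) x) ->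
  (forall k1, exists2 k, (k1 <= k)%N & g k = c) -> accumulation_points mu x c.
Proof.
move=> om_code addr hc; have [C3 C30 hC] := D_approx; apply/accP; split.
  have [k _ <-] := hc 0%N; have /andP[ga _] := hg k.
  by rewrite (lt_le_trans amin_gt0) // (le_trans ha).
move=> e del e0 del0.
have C20 : 0 <= C2 by rewrite addr_ge0 // divr_ge0 ?(ltW lam_gt0).
have CC : 0 < C2 + C3 + 1 by rewrite ltr_wpDl // addr_ge0.
have [k1 _ hk1] := near_inv (divr_gt0 e0 CC).
have [||k2 hk2] := @expr_small R rmax (del / 2).
- by rewrite rmax_lt1 ltW.
- by rewrite divr_gt0.
have [[|k] kk gk] := hc (maxn k1 k2).+1; first by [].
rewrite ltnS geq_max in kk; have /andP[kk1 kk2] := kk.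
pose n := len k.+2; pose w := mkseq om n.
have kn : (len k.+1 <= n <= len k.+2)%N by rewrite leqnn andbT; exact: len_leS.
have wn : wt r (mkseq om n.+1) < wt r w <= wt r w.
  have [v sv ->] := mkseq_split om (leqnSn n); rewrite lexx andbT wt_cat.
  by rewrite gtr_pMr // (le_lt_trans (wtr_le_exp v)) // sv subSnn expr1.
have := hC om x k n (wt r w) om_code addr kn wn.
have := stage_end k.+1 om_code; rewrite gk -/n -/w.
have L0 : 0 < lr w.
  rewrite (lt_le_trans _ (lr_ge _)) // size_mkseq mulr_gt0 // ltr0n.
  by rewrite (leq_trans _ (len_gtS k.+1)).
move=> h1 h2; exists (wt r w).
  rewrite wtr_gt0 /= (le_lt_trans (wtr_le_exp w)) // size_mkseq.
  apply: (@le_lt_trans _ _ (rmax ^+ k2)).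
    rewrite ler_wiXn2l ?(ltW rmax_gt0) ?(ltW rmax_lt1)// (leq_trans kk2) //.
    by rewrite (leq_trans (leqnSn k)) // (leq_trans (leqnSn _)) // len_gtS.
  by rewrite (le_lt_trans hk2) // ltr_pdivrMr // mulr_natr mulr2n ltrDl.
have h3 : `|lp w / lr w - c| <= C2 / k.+2%:R.
  have -> : lp w / lr w - c = (lp w - c * lr w) / lr w by rewrite mulrBl mulfK // gt_eqF.
  by rewrite normrM normfV (gtr0_norm L0) ler_pdivrMr.
have h4 : C2 / k.+2%:R <= C2 / k.+1%:R.
  by rewrite ler_wpM2l // lef_pV2 ?posrE ?ltr0n// ler_nat.
have ke : (C2 + C3) / k.+1%:R < e.
  have := hk1 k kk1; rewrite ltr_pdivlMr //; apply: le_lt_trans.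
  by rewrite mulrC ler_wpM2l // lerDl.
rewrite -[_ - c](subrKA (lp w / lr w)) (le_lt_trans (ler_normD _ _)) //.
rewrite mulrDl in ke; move: h2 h3 h4 ke.
move: (C2 / _) (C2 / _) (C3 / _) `|_| `|_| => X X' Y T T'; lra.
Qed.

Context (s : R) (s_ge0 : 0 <= s) (hc1 : 1 <= 2 ^+ c1 * expR (- (s * Lam))).
Context (hfree : forall k1, exists2 k, (k1 <= k)%N & 2 <= \sum_(w <- W k) wt r w `^ s).

Definition code_point (om : nat -> 'I_N) := projT1 (cid (point_exists om)).

Lemma code_point_K om : K (code_point om).
Proof. by rewrite /code_point; case: cid => /= x []. Qed.

Lemma code_pointP om j : (sw (mkseq om j) @` K) (code_point om).
Proof. by rewrite /code_point; case: cid => /= x []. Qed.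

(** The power sum of the stage is at least [2 ^+ stages k], and [stages k] is at
    least [c1 * len k], which beats the ratio of [t]. *)
Lemma children_sum k t : 2 <= \sum_(w <- W k) wt r w `^ s -> t \in nodes k ->
  1 <= \sum_(v <- concats (W k) (stages k)) wt r (t ++ v) `^ s.
Proof.
move=> free tk.
have -> : \sum_(v <- concats (W k) (stages k)) wt r (t ++ v) `^ s =
    wt r t `^ s * (\sum_(w <- W k) wt r w `^ s) ^+ stages k.
  rewrite -concats_sum big_distrr /=; apply: eq_bigr => v _.
  by rewrite wt_cat powRM // ltW.
apply: (@le_trans _ _ (expR (- (s * Lam)) ^+ len k * 2 ^+ (c1 * len k))).
  rewrite exprM -exprMn_comm; last exact: mulrC.
  by apply: exprn_ege1; rewrite mulrC.
apply: ler_pM; [by rewrite exprn_ge0|by rewrite exprn_ge0| |].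
  rewrite wt_powRs -expRM_natl ler_expR mulrN lerN2 mulrCA ler_wpM2l //.
  by rewrite -(nodes_size tk) lr_le.
apply: (@le_trans _ _ (2 ^+ stages k)).
  rewrite ler_eXn2l ?ltr1n// /stages -mulnA leq_mul2l; apply/orP; right.
  by rewrite (leq_trans _ (leq_pmull _ _)) // -addnA leq_addr.
by rewrite lerXn2r // nnegrE; [exact: ler0n|exact: le_trans (ler0n _ 2) free].
Qed.

(** Below [t] and at an arbitrarily deep stage with a large power sum, one point
    of [F] is taken in each child. The balls with half the ratios of the children
    as radii are disjoint because the children end with [w0]. *)
Lemma dense_premeasure (F : set 'rV[R]_d) m t : t \in nodes m ->
  (forall m' t', (m < m')%N -> t' \in nodes m' -> prefix t t' ->
    exists om, mkseq om (len m') = t' /\ F (code_point om)) ->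
  (1 <= packing_premeasure s F)%E.
Proof.
move=> tm dense; apply: le_ereal_inf_tmp => _ [del /= del0 <-].
have [k1 hk1] := @expr_small R rmax del (introT andP (conj (ltW rmax_gt0) rmax_lt1)) del0.
have [k] := hfree (maxn m k1); rewrite geq_max => /andP[mk k1k] free.
have [t' t'k tt'] := nodes_extend mk tm.
pose V := concats (W k) (stages k); pose L := [seq t' ++ v | v <- V].
have uL : uniq L.
  rewrite map_inj_uniq; first exact: concats_uniq (hW k).
  by move=> v v' /eqP; rewrite eqseq_cat // eqxx => /eqP.
have Lk w : w \in L -> w \in nodes k.+1 /\ exists u, w = u ++ w0.
  move=> /mapP[v vV ->]; split; first by apply/allpairsP; exists (t', v).
  have [_ _ /(_ (stages_gt0 k))[u ->]] := concatsP (hW k) vV.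
  by exists (t' ++ u); rewrite catA.
have codes w : exists om, w \in L -> mkseq om (len k.+1) = w /\ F (code_point om).
  have [wL|] := boolP (w \in L); last by exists (fun=> Ordinal (ltnW hN)).
  have tw : prefix t w.
    by move/mapP: wL => [v _ ->]; rewrite (prefix_trans tt') // prefix_prefix.
  by have [om hom] := dense k.+1 w mk (Lk w wL).1 tw; exists om.
have [f hf] := choice codes.
pose c i := code_point (f (nth [::] L i)); pose rad i := wt r (nth [::] L i) / 2.
have rad2 i : 2 * rad i = wt r (nth [::] L i) by rewrite /rad mulrC divfK.
have sum_ge : (1 <= \esum_(i in `I_(size L)) ((2 * rad i) `^ s)%:E)%E.
  rewrite esum_fset; last 2 first.
  - exact: finite_II.
  - by move=> i _; rewrite lee_fin powR_ge0.
  rewrite -fsbig_ord sumEFin lee_fin (le_trans (children_sum free t'k)) //.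
  rewrite -/V -(big_map (fun v => t' ++ v) xpredT (fun w => wt r w `^ s)) -/L.
  rewrite [leLHS](big_nth [::]) big_mkord le_eqVlt; apply/orP; left; apply/eqP.
  by apply: eq_bigr => i _; rewrite rad2.
apply: le_trans sum_ge _; apply: ereal_sup_ubound; exists `I_(size L), c, rad; split=> //.
split=> [i iL|].
  have wL : nth [::] L i \in L by exact: mem_nth.
  have [wk _] := Lk _ wL; split.
  - exact: (hf _ wL).2.
  - by rewrite /rad divr_gt0.
  - rewrite rad2 (le_trans (wtr_le_exp _)) // (nodes_size wk) (le_trans _ hk1) //.
    rewrite ler_wiXn2l ?(ltW rmax_gt0) ?(ltW rmax_lt1)// (leq_trans k1k) //.
    exact: ltnW (len_gtS k).
move=> i j iL jL [y [yi yj]]; apply/eqP; apply: contrapT => /negP ij.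
pose w := nth [::] L i; pose w' := nth [::] L j.
have ww' : w != w' by rewrite nth_uniq.
have wL : w \in L by exact: mem_nth.
have w'L : w' \in L by exact: mem_nth.
have [/nodes_size sz [u uE]] := Lk _ wL; have [/nodes_size sz' [u' u'E]] := Lk _ w'L.
have su : size u = size u'.
  by apply/eqP; rewrite -(eqn_add2r (size w0)) -!size_cat -uE -u'E sz sz'.
have uu' : u != u' by apply: contraNneq ww' => uu'; rewrite uE u'E uu'.
have noprefix v v' : size v = size v' -> v != v' -> ~~ prefix v v'.
  by move=> sv; rewrite prefixE sv take_size eq_sym.
have in_cyl v v0 : v ++ v0 \in L -> size (v ++ v0) = len k.+1 ->
    (sw (v ++ v0) @` Q) (code_point (f (v ++ v0))) /\
    (sw v @` K) (code_point (f (v ++ v0))).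
  move=> vL sv; have [E _] := hf _ vL.
  split; first by apply: image_sub_Q; rewrite -[X in sw X]E; exact: code_pointP.
  have vE : mkseq (f (v ++ v0)) (size v) = v.
    rewrite -(@take_mkseq _ _ (len k.+1)) ?E ?take_size_cat// -sv.
    by rewrite size_cat leq_addr.
  by have := code_pointP (f (v ++ v0)) (size v); rewrite vE.
have [x1 x2] : (sw (u ++ w0) @` Q) (c i) /\ (sw u @` K) (c i).
  by rewrite /c -/w uE; apply: in_cyl; rewrite -uE.
have [y1 y2] : (sw (u' ++ w0) @` Q) (c j) /\ (sw u' @` K) (c j).
  by rewrite /c -/w' u'E; apply: in_cyl; rewrite -u'E.
have u'u : u' != u by rewrite eq_sym.
have su' := esym su.
have h1 := separated x1 y2 (noprefix _ _ su uu') (noprefix _ _ su' u'u).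
have h2 := separated y1 x2 (noprefix _ _ su' u'u) (noprefix _ _ su uu').
have := enorm_triangle y (c i) (c j); rewrite [enorm (y - _)]enormB.
move: yi yj; rewrite /eball /closed_ball_ /= /rad -/w -/w' uE u'E => h3 h4.
by rewrite [enorm (c j - c i)]enormB in h2; lra.
Qed.

Lemma avoid (F : set 'rV[R]_d) m t : t \in nodes m -> (packing_premeasure s F < 1)%E ->
  exists m' t', [/\ (m < m')%N, t' \in nodes m', prefix t t' &
    forall om, mkseq om (len m') = t' -> ~ F (code_point om)].
Proof.
move=> tm Flt; apply: contrapT => no; move: Flt; apply/negP; rewrite -leNgt.
apply: dense_premeasure tm _ => m' t' mm' t'm' tt'; apply: contrapT => no'.
by apply: no; exists m', t'; split=> // om omE Fom; apply: no'; exists om.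
Qed.

(** A cover with small total premeasure has no member that is dense below a
    node, so every node has a descendant that avoids a given member. The branch
    that avoids one member after the other is a code whose point is not covered:
    this is Baire's theorem in the tree. *)
Lemma packing_tree : packing_measure s [set code_point om | om in is_code] <> 0%E.
Proof.
move=> P0; have := @lte01 R; rewrite -{1}P0 => /ereal_inf_lt[_ [F [cover ->]] Flt].
have F1 i : (packing_premeasure s (F i) < 1)%E.
  apply: le_lt_trans Flt.
  apply: le_trans (nneseries_lim_ge i.+1 _); last by move=> *; exact: packing_premeasure_ge0.
  rewrite big_nat_recr //= leeDr //; apply: sume_ge0 => j _.
  exact: packing_premeasure_ge0.
pose node (mt : nat * seq 'I_N) := mt.2 \in nodes mt.1.
have step (imt : nat * (nat * seq 'I_N)) : exists mt', node imt.2 ->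
    [/\ (imt.2.1 < mt'.1)%N, node mt', prefix imt.2.2 mt'.2 &
      forall om, mkseq om (len mt'.1) = mt'.2 -> ~ F imt.1 (code_point om)].
  case: imt => i [m' t]; have [tm|] := boolP (t \in nodes m'); last first.
    by move=> nt; exists (0%N, [::]); rewrite /node /= (negbTE nt).
  by have [m1 [t1 [? ? ? ?]]] := avoid tm (F1 i); exists (m1, t1).
have [next hnext] := choice step.
(* A level and a node at that level, whose descendants avoid the first [i]
   members of the cover. *)
pose st := fix st i := if i is i'.+1 then next (i', st i') else (0%N, [::]).
have st_node i : node (st i).
  by elim: i => [|i /(hnext (i, _))[]//]; rewrite /node /= mem_head.
have stP i := hnext (i, st i) (st_node i).
have st_ge i : (i <= (st i).1)%N.
  by elim: i => // i IH; have [/= lt _ _ _] := stP i; exact: leq_ltn_trans lt.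
have st_prefix : {homo (fun i => (st i).2) : i j / (i <= j)%N >-> prefix i j}.
  apply: homo_leq => [t|y x z|i]; [exact: prefix_refl|exact: prefix_trans|].
  by have [] := stP i.
have len_id k : (k <= len k)%N by case: k => // k; exact: len_gtS.
pose i0 := Ordinal (ltnW hN); pose om n := nth i0 (st n.+1).2 n.
have om_st i : mkseq om (len (st i).1) = (st i).2.
  have sz j : size (st j).2 = len (st j).1 by exact: nodes_size (st_node j).
  apply: (@eq_from_nth _ i0); first by rewrite size_mkseq sz.
  rewrite size_mkseq => n ni; rewrite nth_mkseq // /om.
  have nn : (n < size (st n.+1).2)%N.
    by rewrite sz (leq_trans (st_ge n.+1)).
  rewrite -sz in ni; have [ij|/ltnW ij] := leqP i n.+1; have /prefixP[v E] := st_prefix _ _ ij.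
    by rewrite E nth_cat ni.
  by rewrite E nth_cat nn.
have om_code : is_code om.
  move=> k; rewrite -(take_mkseq om (len_mono (st_ge k))) om_st.
  by apply: nodes_take (st_node k); exact: st_ge.
have [|i _ Fi] := cover (code_point om); first by exists om.
by have [_ _ _ /(_ om (om_st i.+1))] := stP i.
Qed.

End Tree.

(** * Points with a prescribed interval of local dimensions *)

(** The targets of the stages run cyclically through [a], [b] and [al]. The first
    two make [a] and [b] accumulation points, the third one makes the packing
    measure positive. *)
Lemma packing_lower a b al s s' : amin <= a -> a <= al <= b -> b <= amax ->
  0 <= s < s' -> (forall q, s' <= al * q + beta q) ->
  packing_measure s [set x | K x /\ accumulation_points mu x = `[a, b]%classic] <> 0%E.
Proof.
move=> ha /andP[aal alb] hb ss hs; have ab := le_trans aal alb.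
have hal : amin <= al <= amax by rewrite (le_trans ha aal) (le_trans alb hb).
pose g k := if (k %% 3 == 0)%N then a else if (k %% 3 == 1)%N then b else al.
have hg k : a <= g k <= b by rewrite /g; do 2?case: ifP; rewrite ?lexx ?ab ?aal ?alb.
have exW k : exists lW : nat * seq (seq 'I_N), blocks (g k) k.+1%:R^-1 lW.1 lW.2 /\
    ((k %% 3 == 2)%N -> 2 <= \sum_(w <- lW.2) wt r w `^ s).
  have k0' : 0 < k.+1%:R^-1 :> R by rewrite invr_gt0.
  have [/eqP k2|k2] := boolP ((k %% 3 == 2)%N).
    have [l [W [? ?]]] := blocks_rich hal k0' ss hs.
    by exists (l, W); rewrite /g k2.
  have gk : amin <= g k <= amax.
    by have /andP[h1 h2] := hg k; rewrite (le_trans ha h1) (le_trans h2 hb).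
  by have [l [W ?]] := blocks_single gk k0'; exists (l, W).
have [lW hlW] := choice exW.
have [c1 c1_gt0 hc1] : exists2 c1, (0 < c1)%N & 1 <= 2 ^+ c1 * expR (- (s * Lam)).
  have h2 : 0 <= (2^-1 : R) < 1 by apply/andP; split; lra.
  have [c hc] := @expr_small R 2^-1 (expR (- (s * Lam))) h2 (expR_gt0 _).
  exists c.+1 => //; rewrite mulrC -ler_pdivrMr ?exprn_gt0// div1r -exprVn.
  by apply: le_trans hc; rewrite exprS ler_piMl ?exprn_ge0//; lra.
have hW k := (hlW k).1.
have often i : (i < 3)%N -> forall k1, exists2 k, (k1 <= k)%N & (k %% 3)%N = i.
  move=> i3 k1; exists (k1 * 3 + i)%N; last by rewrite modnMDl modn_small.
  by rewrite (leq_trans _ (leq_addr _ _)) // leq_pmulr.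
have free k1 : exists2 k, (k1 <= k)%N & 2 <= \sum_(w <- (lW k).2) wt r w `^ s.
  by have [//|k kk /eqP k2] := often 2%N _ k1; exists k; rewrite // (hlW k).2.
have s0 : 0 <= s by case/andP: ss.
have P0 := packing_tree hW c1_gt0 s0 hc1 free.
move=> P; apply: P0; apply/eqP; rewrite eq_le packing_measure_ge0 andbT -P.
apply: ereal_inf_le_tmp => _ [F [cover ->]]; exists F; split=> // x [om om_code <-].
apply: cover; split; first exact: code_point_K.
have addr := code_pointP om; have xK := code_point_K om.
have sub := acc_subset ha hb hg hW c1_gt0 om_code addr.
have aA : accumulation_points mu (code_point om) a.
  apply: (acc_target ha hb hg hW c1_gt0 om_code addr) => k1.
  by have [//|k kk k0'] := often 0%N _ k1; exists k; rewrite // /g k0'.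
have bA : accumulation_points mu (code_point om) b.
  apply: (acc_target ha hb hg hW c1_gt0 om_code addr) => k1.
  by have [//|k kk k0'] := often 1%N _ k1; exists k; rewrite // /g k0'.
have [a' [b' [_ _ _ E]]] := acc_interval xK.
apply/seteqP; split=> // y; rewrite /= in_itv /= => /andP[ay yb].
move: aA bA; rewrite E /= !in_itv /= => /andP[a1 _] /andP[_ b1].
by rewrite (le_trans a1 ay) (le_trans yb b1).
Qed.

Lemma packing_dim_mono (E E' : set 'rV[R]_d) : E `<=` E' ->
  (packing_dim E <= packing_dim E')%E.
Proof.
move=> EE'; apply: ereal_inf_le_tmp => _ [s [s0 P0] <-]; exists s => //; split=> //.
apply/eqP; rewrite eq_le packing_measure_ge0 andbT -P0.
by apply: ereal_inf_le_tmp => _ [F [cover ->]]; exists F; split=> // x /EE'/cover.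
Qed.

(** If [s] exceeds the supremum, then by the minimax lemma a single [q] satisfies
    the hypothesis of [packing_measure_eq0]. *)
Lemma packing_dim_le a b : amin <= a -> a <= b -> b <= amax ->
  (packing_dim [set x | K x /\ accumulation_points mu x `<=` `[a, b]%classic] <=
   ereal_sup [set legendre beta al | al in `[a, b]%classic])%E.
Proof.
move=> ha ab hb; have aI : `[a, b]%classic a by rewrite /= in_itv /= lexx.
have: (0 <= ereal_sup [set legendre beta al | al in `[a, b]%classic])%E.
  apply: (@le_trans _ _ (legendre beta a)); last by apply: ereal_sup_ubound; exists a.
  apply: le_ereal_inf_tmp => _ [q _ <-].
  by rewrite lee_fin legendre_ge0 // ha (le_trans ab hb).
case supE : (ereal_sup _) => [v| |] // v0; last by rewrite leey.
rewrite lee_fin in v0; apply/lee_addgt0Pr => e e0.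
apply: ereal_inf_lbound; exists (v + e) => //; split; first by rewrite addr_ge0 // ltW.
have [q hq] : exists q, Num.max (a * q) (b * q) + beta q < v + e.
  apply: contrapT => no; have [|al /andP[aal alb] hal] := minimax (s := v + e) ab.
    by move=> q; rewrite leNgt; apply/negP => h; apply: no; exists q.
  have : (legendre beta al <= v%:E)%E.
    by rewrite -supE; apply: ereal_sup_ubound; exists al; rewrite //= in_itv /= aal.
  apply/negP; rewrite -ltNge (@lt_le_trans _ _ (v + e)%:E) ?lte_fin ?ltrDl//.
  by apply: le_ereal_inf_tmp => _ [q _ <-]; rewrite lee_fin.
exact: packing_measure_eq0 hq.
Qed.

Lemma packing_dim_ge a b : amin <= a -> a <= b -> b <= amax ->
  (ereal_sup [set legendre beta al | al in `[a, b]%classic] <=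
   packing_dim [set x | K x /\ accumulation_points mu x = `[a, b]%classic])%E.
Proof.
move=> ha ab hb; apply: ge_ereal_sup => _ [al /= + <-]; rewrite in_itv /= => hal.
apply: le_ereal_inf_tmp => _ [s [s0 P0] <-]; rewrite leNgt; apply/negP => lt.
have le q : (legendre beta al <= (al * q + beta q)%:E)%E.
  by apply: ereal_inf_lbound; exists q.
case E : (legendre beta al) lt le => [s'| |] // lt le; last by have := le 0.
by apply: (@packing_lower a b al s s') P0 => //; rewrite s0 -lte_fin.
Qed.

End SelfSimilarMeasure.

Theorem theorem1p5 (R : realType) (d N : nat) (hd : (0 < d)%N) (hN : (2 <= N)%N)
  (S : 'I_N -> 'rV[R]_d -> 'rV[R]_d) (r p : 'I_N -> R)
  (hr : forall i, 0 < r i < 1)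
  (hS : forall i, similarity (r i) (S i))
  (hp : probability_vector p) (hp0 : forall i, 0 < p i)
  (K : set 'rV[R]_d) (hK : self_similar_set S K)
  (mu : probability (borelRV R d) R) (hmu : self_similar_measure S p mu)
  (hOSC : open_set_condition S)
  (alpha_min alpha_max : R)
  (hmin : minimum_of (range (fun i => ln (p i) / ln (r i))) alpha_min)
  (hmax : maximum_of (range (fun i => ln (p i) / ln (r i))) alpha_max)
  (beta : R -> R)
  (hbeta : forall q : R, \sum_(i < N) p i `^ q * r i `^ beta q = 1) :
  (forall I : set R, ~ closed_subinterval alpha_min alpha_max I ->
     [set x | K x /\ accumulation_points mu x = I] = set0) /\
  (forall I : set R, closed_subinterval alpha_min alpha_max I ->
     packing_dim [set x | K x /\ accumulation_points mu x = I] =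
       packing_dim [set x | K x /\ accumulation_points mu x `<=` I] /\
     packing_dim [set x | K x /\ accumulation_points mu x `<=` I] =
       ereal_sup [set legendre beta alpha | alpha in I]).
Proof.
split=> I.
  move=> notI; apply/seteqP; split=> // x [xK accE]; apply: notI; rewrite -accE.
  exact: (acc_interval hN hr hS hp hp0 hK hmu hOSC hmin hmax xK).
move=> [a [b [ha ab hb ->]]].
have upper := packing_dim_le hN hr hS hp hp0 hK hmu hOSC hmin hmax hbeta ha ab hb.
have lower := packing_dim_ge hN hr hS hp hp0 hK hmu hOSC hmin hmax hbeta ha ab hb.
have mono : (packing_dim [set x | K x /\ accumulation_points mu x = `[a, b]%classic] <=
    packing_dim [set x | K x /\ accumulation_points mu x `<=` `[a, b]%classic])%E.
  by apply: packing_dim_mono => x [xK accE]; split=> //; rewrite accE.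
by split; apply/eqP; rewrite eq_le ?mono ?upper ?(le_trans upper lower) ?(le_trans lower mono).
Qed.
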